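(* Let $n\geq2$, $d\geq1$, $\Omega\subset\mathbb{R}^n$ open, $0\leq\lambda\leq n-1$ and $\alpha=1-\frac{\lambda}{n-1}$. Let $f\in W^{1,1}_{\mathrm{loc}}(\Omega;\mathbb{R}^d)$ and let $N\subset\Omega$ be a set of Lebesgue measure zero. Suppose that for each $x\in N$ there exist $R=R(x)>0$ and $\mu=\mu(x)>0$ such that $B(x,R)\subset\Omega$ and $$\omega_f(x,r)\leq\begin{cases}\exp\bigl(-\mu\log^\alpha(1/r)\bigr), & \alpha>0,\\ \log^{-\mu}(1/r), & \alpha=0,\end{cases}\qquad 0<r\leq R.$$ If $\int_\Omega|Df|^n\log^\lambda(e+|Df|)\,dy<\infty$, then $\mathcal{H}^n(f(N))=0$.
   Context: $f$ is a fixed measurable (pointwise defined) representative. $B(x,r)$ is the open ball. The median modulus of continuity is $\omega_f(x,r)=\inf\{s\geq0: |\{y\in B(x,r): |f(y)-f(x)|\geq s\}|<\tfrac12|B(x,r)|\}$, where $|\cdot|$ is Lebesgue measure. $\mathcal{H}^n$ is the $n$-dimensional Hausdorff measure in $\mathbb{R}^d$. *)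

(* Defs.v *)
From HB Require Import structures.
From mathcomp Require Import all_boot all_order all_algebra.
From mathcomp Require Import all_classical all_reals all_analysis.
Set Implicit Arguments. Unset Strict Implicit. Unset Printing Implicit Defensive.
Import Order.TTheory GRing.Theory Num.Theory.
Import numFieldNormedType.Exports.
Local Open Scope classical_set_scope.
Local Open Scope ring_scope.

Section Euclid.
Variable (R : realType).

Definition enorm (m : nat) (v : 'rV[R]_m) : R :=
  Num.sqrt (\sum_(i < m) (v ord0 i) ^+ 2).

Definition eball (m : nat) (x : 'rV[R]_m) (r : R) : set 'rV[R]_m :=
  [set y | enorm (y - x) < r].

End Euclid.

Definition boxT (R : realType) (n : nat) := 'rV[R]_n.

Section Lebesgue.
Variables (R : realType) (n : nat).
Local Open Scope ereal_scope.

HB.instance Definition _ := Pointed.on (boxT R n).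
HB.instance Definition _ := @isMeasurable.Build default_measure_display
  (boxT R n) discrete_measurable discrete_measurable0
  discrete_measurableC discrete_measurableU.

Definition box (a b : 'rV[R]_n) : set (boxT R n) :=
  [set x | forall i, (a ord0 i <= x ord0 i < b ord0 i)%R].

Definition box_vol (a b : 'rV[R]_n) : R := (\prod_(i < n) (b ord0 i - a ord0 i))%R.

(* elementary volume: volume on boxes, 0 on the empty set, +oo otherwise *)
Definition box_content (A : set (boxT R n)) : \bar R :=
  ereal_inf [set v | (A = set0 /\ v = 0)
    \/ exists a b : 'rV[R]_n, (forall i, (a ord0 i <= b ord0 i)%R) /\
        A = box a b /\ v = (box_vol a b)%:E].

Lemma box_content_ge0 A : 0 <= box_content A.
Proof.
apply: le_ereal_inf_tmp => v [[_ ->]//|[a [b [ab [_ ->]]]]].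
rewrite lee_fin; apply: prodr_ge0 => i _; rewrite subr_ge0; exact: ab.
Qed.

Lemma box_content0 : box_content set0 = 0.
Proof.
apply/eqP; rewrite eq_le box_content_ge0 andbT.
by apply: ereal_inf_lbound; left.
Qed.

Definition leb_outer : set (boxT R n) -> \bar R := mu_ext box_content.

HB.instance Definition _ := isOuterMeasure.Build R (boxT R n) leb_outer
  (mu_ext0 box_content0 box_content_ge0)
  (mu_ext_ge0 box_content_ge0)
  (le_mu_ext box_content)
  (mu_ext_sigma_subadditive box_content_ge0).

End Lebesgue.

Definition LebT (R : realType) (n : nat) := caratheodory_type (@leb_outer R n).
Definition lebn (R : realType) (n : nat) : set (LebT R n) -> \bar R :=
  @leb_outer R n.

Section Sobolev.
Variables (R : realType) (n d : nat).
Local Open Scope ereal_scope.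

Definition pderivs (s : seq 'I_n) (phi : 'rV[R]_n -> R) : 'rV[R]_n -> R :=
  foldr (fun i g => fun x => derive g x (delta_mx ord0 i)) phi s.

Definition smooth (phi : 'rV[R]_n -> R) : Prop :=
  forall s : seq 'I_n, continuous (pderivs s phi) /\
    (forall (i : 'I_n) (x : 'rV[R]_n), derivable (pderivs s phi) x (delta_mx ord0 i)).

Definition test_fun (Omega : set 'rV[R]_n) (phi : 'rV[R]_n -> R) : Prop :=
  smooth phi /\ exists K : set 'rV[R]_n,
    [/\ compact K, K `<=` Omega & forall x, ~ K x -> phi x = 0%R].

Definition loc_integrable (Omega : set 'rV[R]_n) (g : 'rV[R]_n -> R) : Prop :=
  forall K : set 'rV[R]_n, compact K -> K `<=` Omega ->
    (@lebn R n).-integrable (K : set (LebT R n)) (fun y => (g y)%:E).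

(* f = (f_1,...,f_d) belongs to W^{1,1}_loc(Omega; R^d) and
   Df j i is (a representative of) its weak partial derivative d_i f_j *)
Definition W11loc (Omega : set 'rV[R]_n) (f : 'rV[R]_n -> 'rV[R]_d)
    (Df : 'I_d -> 'I_n -> 'rV[R]_n -> R) : Prop :=
  [/\ forall j, loc_integrable Omega (fun y => f y ord0 j),
      forall j i, loc_integrable Omega (Df j i) &
      forall phi, test_fun Omega phi -> forall j i,
        \int[@lebn R n]_(y in (Omega : set (LebT R n)))
            ((f y ord0 j) * pderivs [:: i] phi y)%:E
        = - \int[@lebn R n]_(y in (Omega : set (LebT R n)))
            (Df j i y * phi y)%:E].

Definition grad_norm (Df : 'I_d -> 'I_n -> 'rV[R]_n -> R) (y : 'rV[R]_n) : R :=
  Num.sqrt (\sum_(j < d) \sum_(i < n) (Df j i y) ^+ 2).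

Definition median_mod (f : 'rV[R]_n -> 'rV[R]_d) (x : 'rV[R]_n) (r : R) : R :=
  inf [set s : R | (0 <= s)%R /\
    @leb_outer R n [set y | eball x r y /\ (s <= enorm (f y - f x))%R]
      < (2^-1)%:E * @leb_outer R n (eball x r)].

End Sobolev.

Section Hausdorff.
Variables (R : realType) (d : nat).
Local Open Scope ereal_scope.

(* Euclidean diameter, with diam(empty) = 0 *)
Definition ediam (C : set 'rV[R]_d) : \bar R :=
  ereal_sup ([set 0] `|`
    [set z | exists x y, [/\ C x, C y & z = (enorm (x - y))%:E]]).

Definition hausdorff_pre (s delta : R) (A : set 'rV[R]_d) : \bar R :=
  ereal_inf [set \sum_(k <oo) ((fine (ediam (C k))) `^ s)%:E
            | C in [set C : (set 'rV[R]_d)^nat |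
                    A `<=` \bigcup_k C k /\ forall k, ediam (C k) <= delta%:E]].

Definition hausdorff (s : R) (A : set 'rV[R]_d) : \bar R :=
  ereal_sup [set hausdorff_pre s delta A | delta in [set delta : R | (0 < delta)%R]].

End Hausdorff.

(* Main.v *)
Require Import Defs.
From HB Require Import structures.
From mathcomp Require Import all_boot all_order all_algebra.
From mathcomp Require Import all_classical all_reals all_analysis.
From mathcomp Require Import measurable_realfun ring lra.
Set Implicit Arguments. Unset Strict Implicit. Unset Printing Implicit Defensive.
Import Order.TTheory GRing.Theory Num.Theory.
Import numFieldNormedType.Exports.
Local Open Scope classical_set_scope.
Local Open Scope ring_scope.

(** Fix x in N and write g(r) for the median modulus at x. Among the scales r_k = 16^-k r_0 one finds
    arbitrarily small r = r_k and a smaller scale r' with g(r') < g(r)/4 (or else g(r) < r, which is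
    easier). Truncating |f - f(x)| at height s = g(r)/2, a Poincare inequality on cubes bounds the
    oscillation between r' and r by the gradient on the set |f - f(x)| < 2s only, and chaining over
    the l scales in between gives s^n <= C l^(n-1) times the integral of |Df|^n over
    Q(x,r) /\ {|f - f(x)| < 2s} /\ {|Df| >= b}, where b is so small that the remaining part of |Df|
    is absorbed. The decay of g permits to choose the scales r_(k_i), with k_(i+1) of order
    k_i + D k_i^(lambda/(n-1)), in such a way that l^(n-1) <= C k^lambda <= C' log^lambda(e + |Df|)
    where |Df| >= b. Hence s^n is bounded by the energy of a subset of a small cube which f maps
    into a ball of radius 2s about f(x). A Vitali covering by such balls makes these subsets
    disjoint, and the energy of small neighbourhoods of the null set N is arbitrarily small.

    The Poincare inequality is obtained from a discrete one on a grid: averages over adjacent cells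
    are compared by testing the weak derivative with products of one-variable functions, which
    avoids Fubini's theorem in R^n. *)

(** * Lebesgue measure of boxes *)

(** Truncation ties the domain to the target. A bound by the energy of a whole cube would not
    survive a covering, since f may send most of the cube far away. The points with |f - f(x)| < 2s
    have their images in a ball, so disjoint balls in the target force disjoint carriers of energy.
    The power l^(n-1) is the price of the critical exponent n. With weights r^(1-n) the l scales are
    on an equal footing in the chained sum; splitting it with a parameter beta of order s/l, so that
    the balanced part costs l beta, leaves s beta^(n-1) bounded by the energy. Only log^lambda can
    pay for this loss, and only where |Df| is exponentially large in k. Hence the cut-off b has to
    grow like 2^k while b r stays below g(r), which is why a scale with g(r_k) > 8^-k is sought. The
    constant obtained at x depends on the decay at x and is not bounded on N. Instead of decomposing
    N, the energy density is weighted: it is multiplied by m on a neighbourhood U_m of N, with U_m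
    so small that the sum over m still has a small integral. A point whose constant is at most m
    then works inside U_m. *)

Section BoxMeasure.
Variables (R : realType) (n : nat).
Local Open Scope ereal_scope.
Implicit Types (a b x : 'rV[R]_n) (A X : set (boxT R n)).

HB.instance Definition _ := isMeasure.Build _ (LebT R n) R (@lebn R n)
  (@caratheodory_measure0 R (boxT R n) (@leb_outer R n))
  (@caratheodory_measure_ge0 R (boxT R n) (@leb_outer R n))
  (@caratheodory_measure_sigma_additive R (boxT R n) (@leb_outer R n)).

Lemma box_content_box a b : (forall i, a ord0 i <= b ord0 i)%R ->
  box_content (box a b) <= (box_vol a b)%:E.
Proof. by move=> ab; apply: ereal_inf_lbound; right; exists a, b. Qed.

Definition halfspace (i : 'I_n) (c : R) : set (boxT R n) :=
  [set x | (x ord0 i < c)%R].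

Lemma box_content_halfspace (i : 'I_n) (c : R) A :
  box_content (A `&` halfspace i c) + box_content (A `&` ~` halfspace i c)
  <= box_content A.
Proof.
pose H := halfspace i c; rewrite -/H; apply: le_ereal_inf_tmp => v [[-> ->]|[a [b [ab [-> ->]]]]].
  by rewrite !set0I box_content0 adde0.
(* Clamping c to the i-th side keeps the corners of both halves ordered even if the hyperplane
   misses the box; one half is then an empty box of volume zero. *)
pose m := Order.min (b ord0 i) (Order.max (a ord0 i) c).
pose b' := (\row_j if j == i then m else b ord0 j)%R.
pose a' := (\row_j if j == i then m else a ord0 j)%R.
have am : (a ord0 i <= m)%R by rewrite /m le_min ab le_max lexx.
have mb : (m <= b ord0 i)%R by rewrite /m ge_min lexx.
have -> : box a b `&` H = box a b'.
  apply/seteqP; split => [x [xab xc] j|x xab].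
    rewrite !mxE; case: eqP => [->|_]; last exact: xab.
    have /andP[-> xb] := xab i.
    by rewrite /m lt_min lt_max xb; move: xc; rewrite /H/= => ->; rewrite orbT.
  split.
    move=> j; have := xab j; rewrite mxE; case: eqP => [->|_]//.
    by move=> /andP[->] /lt_le_trans; exact.
  have := xab i; rewrite mxE eqxx /m => /andP[ax]; rewrite lt_min lt_max => /andP[_].
  by rewrite ltNge ax.
have -> : box a b `&` ~` H = box a' b.
  apply/seteqP; split => [x [xab xc] j|x xab].
    rewrite !mxE; case: eqP => [->|_]; last exact: xab.
    have /andP[ax ->] := xab i; rewrite andbT.
    by rewrite /m ge_min ge_max ax; move/negP: xc; rewrite -leNgt => ->; rewrite orbT.
  split.
    move=> j; have := xab j; rewrite mxE; case: eqP => [->|_]//.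
    by move=> /andP[+ ->]; rewrite andbT; exact: le_trans.
  have := xab i; rewrite mxE eqxx /m ge_min ge_max => /andP[/orP[bx|/andP[_ cx]]].
    by move=> /(le_lt_trans bx); rewrite ltxx.
  by move=> _; rewrite /H/=; apply/negP; rewrite -leNgt.
apply: le_trans (leeD (box_content_box _) (box_content_box _)) _.
- by move=> j; rewrite mxE; case: eqP => // ->.
- by move=> j; rewrite mxE; case: eqP => // ->.
rewrite -EFinD lee_fin /box_vol (bigD1 i)//= [X in (_ + X)%R](bigD1 i)//=.
rewrite [leRHS](bigD1 i)//=.
have e1 : (\prod_(j < n | j != i) (b' ord0 j - a ord0 j) =
           \prod_(j < n | j != i) (b ord0 j - a ord0 j))%R.
  by apply: eq_bigr => j /negbTE ji; rewrite mxE ji.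
have e2 : (\prod_(j < n | j != i) (b ord0 j - a' ord0 j) =
           \prod_(j < n | j != i) (b ord0 j - a ord0 j))%R.
  by apply: eq_bigr => j /negbTE ji; rewrite mxE ji.
rewrite e1 e2 !mxE eqxx -mulrDl.
by rewrite addrC addrA subrK.
Qed.

(** A hyperplane cuts every cover of X into covers of the two parts of X without raising the total
    content, which is Caratheodory's condition. *)
Lemma measurable_halfspace (i : 'I_n) (c : R) :
  measurable (halfspace i c : set (LebT R n)).
Proof.
apply: le_caratheodory_measurable => X.
set H := halfspace i c.
apply: le_ereal_inf_tmp => _ [F [mF XF] <-].
have FH : forall k, box_content (F k `&` H) + box_content (F k `&` ~` H)
    <= box_content (F k) by move=> k; exact: box_content_halfspace.
apply: (@le_trans _ _ (\sum_(k <oo) box_content (F k `&` H) +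
                       \sum_(k <oo) box_content (F k `&` ~` H))).
  apply: leeD; apply: ereal_inf_lbound.
    exists (fun k => F k `&` H) => //; split => // x [Xx Hx].
    by have [k _ Fk] := XF _ Xx; exists k.
  exists (fun k => F k `&` ~` H) => //; split => // x [Xx Hx].
  by have [k _ Fk] := XF _ Xx; exists k.
rewrite -nneseriesD; try by move=> *; exact: box_content_ge0.
by apply: lee_nneseries => // k _; rewrite adde_ge0// box_content_ge0.
Qed.

Lemma measurable_forall (I : finType) (F : I -> set (LebT R n)) :
  (forall i, measurable (F i)) -> measurable ([set x | forall i, F i x] : set (LebT R n)).
Proof.
move=> mF; have -> : [set x | forall i, F i x] = \bigcap_(i in [set: I]) F i.
  by apply/seteqP; split => x /= Fx i => [_|]; exact: Fx.
by apply: fin_bigcap_measurable => //; exact: finite_finset.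
Qed.

Lemma measurable_box a b : measurable (box a b : set (LebT R n)).
Proof.
have -> : box a b = fun x => forall i : 'I_n,
    (~` halfspace i (a ord0 i) `&` halfspace i (b ord0 i)) x.
  apply/seteqP; split => x /= xab i; have := xab i.
    by rewrite /halfspace /= => /andP[ax xb]; split => //=; apply/negP; rewrite -leNgt.
  by rewrite /halfspace /= => -[/negP]; rewrite -leNgt => -> ->.
apply: measurable_forall => i.
by apply: measurableI; [apply: measurableC|]; exact: measurable_halfspace.
Qed.

End BoxMeasure.

Section BoxVolume.
Variables (R : realType) (n : nat).
Local Open Scope ereal_scope.
Implicit Types (a b x : 'rV[R]_n) (A X : set (boxT R n)).

Lemma nneseries_head (u : nat -> \bar R) : (forall k, 0 <= u k) ->
  (forall k, u k.+1 = 0) -> \sum_(k <oo) u k = u 0%N.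
Proof.
by move=> u0 uS; rewrite nneseries_recl// eseries0 ?adde0 => // -[|k] _ _ //.
Qed.

Lemma integral_scaled_indic_itv (G u v : R) : (0 <= G)%R -> (u <= v)%R ->
  \int[lebesgue_measure]_t (G * (u <= t < v)%R%:R)%:E = (G * (v - u))%:E.
Proof.
move=> G0 uv.
under eq_integral.
  move=> t _; have -> : (G * (u <= t < v)%R%:R)%:E = G%:E * (\1_`[u, v[ t)%:E.
    rewrite -EFinM indicE; congr (_ * _%:R)%:E.
    by rewrite mem_setE in_itv.
  over.
rewrite ge0_integralZl//=; last by apply/measurable_EFinP; exact: measurable_indic.
rewrite integral_indic//= setIT lebesgue_measure_itv/= lte_fin EFinM; congr (_ * _).
by case: ltgtP uv => // ->; rewrite subrr.
Qed.

(* The first [m] coordinates of the indicator of [box a b] integrated out. *)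
Definition box_section (m : nat) a b x : R :=
  (\prod_(i < n) if (i < m)%N then b ord0 i - a ord0 i
                 else (a ord0 i <= x ord0 i < b ord0 i)%R%:R)%R.

Lemma box_section_ge0 m a b x : (forall i, a ord0 i <= b ord0 i)%R ->
  (0 <= box_section m a b x)%R.
Proof.
by move=> ab; apply: prodr_ge0 => i _; case: ifP => // _; rewrite subr_ge0.
Qed.

Lemma integral_box_section (i0 : 'I_n) a b x : (forall i, a ord0 i <= b ord0 i)%R ->
  \int[lebesgue_measure]_t
    (box_section i0 a b (\row_i (if i == i0 then t else x ord0 i)))%:E
  = (box_section i0.+1 a b x)%:E.
Proof.
move=> ab.
pose G := (\prod_(i < n | i != i0) if (i < i0)%N then b ord0 i - a ord0 i
                 else (a ord0 i <= x ord0 i < b ord0 i)%R%:R)%R.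
have G0 : (0 <= G)%R.
  by apply: prodr_ge0 => i _; case: ifP => // _; rewrite subr_ge0.
under eq_integral.
  move=> t _; have -> : box_section i0 a b (\row_i (if i == i0 then t else x ord0 i))
      = (G * (a ord0 i0 <= t < b ord0 i0)%R%:R)%R.
    rewrite /box_section (bigD1 i0)//= ltnn mxE eqxx mulrC; congr (_ * _)%R.
    by apply: eq_bigr => i /negbTE ii0; rewrite mxE ii0.
  over.
rewrite integral_scaled_indic_itv//; congr EFin.
rewrite /box_section [RHS](bigD1 i0)//= ltnSn mulrC; congr (_ * _)%R.
apply: eq_bigr => i ii0; rewrite [in RHS]ltnS [in RHS]leq_eqVlt.
by rewrite (_ : (i == i0 :> nat) = false)//; exact: negbTE.
Qed.

Lemma measurable_box_section (i0 : 'I_n) a b x :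
  measurable_fun setT (fun t : R =>
    (box_section i0 a b (\row_i (if i == i0 then t else x ord0 i)))%:E).
Proof.
apply/measurable_EFinP.
apply: measurable_prod => i _; case: (ltnP i i0) => // _.
have [->|ii0] := eqVneq i i0; last first.
  by under eq_fun do rewrite mxE (negbTE ii0); exact: measurable_cst.
under eq_fun.
  move=> t; have -> : (a ord0 i0 <= (\row_i1 (if i1 == i0 then t else x ord0 i1))
    ord0 i0 < b ord0 i0)%R%:R = \1_`[a ord0 i0, b ord0 i0[ t :> R.
    by rewrite mxE eqxx indicE mem_setE in_itv.
  over.
exact: measurable_indic.
Qed.

(** The pointwise inequality between indicators is integrated in one coordinate after the other, so
    that one-dimensional Lebesgue integrals of nonnegative series suffice and no compactness is
    involved. A false flag [c k] stands for an empty member of the cover, which is no box when n =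
    0. *)
Lemma le_box_vol_cover a b (c : nat -> bool) (A B : nat -> 'rV[R]_n) :
  (forall i, a ord0 i <= b ord0 i)%R ->
  (forall k i, A k ord0 i <= B k ord0 i)%R ->
  (forall x, box a b x -> exists k, c k /\ box (A k) (B k) x) ->
  (box_vol a b)%:E <= \sum_(k <oo) ((c k)%:R * box_vol (A k) (B k))%:E.
Proof.
move=> ab AB cov.
have step m : (m <= n)%N -> forall x, (box_section m a b x)%:E <=
    \sum_(k <oo) ((c k)%:R * box_section m (A k) (B k) x)%:E.
  elim: m => [_ x|m ih mn x].
    have sec0 u v : box_section 0 u v x = (`[< box u v x >])%:R.
      rewrite /box_section /=; case: asboolP => [uv|/existsNP[i ui]].
        by rewrite big1// => i _; rewrite uv.
      by rewrite (bigD1 i)//=; move/negP/negbTE : ui => ->; rewrite mul0r.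
    rewrite sec0; case: asboolP => [abx|_]; last first.
      apply: nneseries_ge0 => k _ _; rewrite lee_fin mulr_ge0//.
      exact: box_section_ge0.
    have [k [ck Ck]] := cov _ abx.
    have : \sum_(0 <= j < k.+1) ((c j)%:R * box_section 0 (A j) (B j) x)%:E <=
       \sum_(j <oo) ((c j)%:R * box_section 0 (A j) (B j) x)%:E.
      by apply: nneseries_lim_ge => j _ _; rewrite lee_fin mulr_ge0// box_section_ge0.
    apply: le_trans; rewrite big_nat_recr//= sec0 ck asboolT// mul1r leeDr//.
    by apply: sume_ge0 => j _; rewrite lee_fin mulr_ge0// box_section_ge0.
  pose i0 := Ordinal mn.
  rewrite -(integral_box_section i0 x ab).
  under eq_eseriesr do rewrite EFinM -(integral_box_section i0 x (AB _)).
  have mS k : measurable_fun setT (fun t : R => (c k)%:R%:E *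
    (box_section i0 (A k) (B k) (\row_i (if i == i0 then t else x ord0 i)))%:E).
    by apply: emeasurable_funM => //; exact: measurable_box_section.
  have S0 k t : 0 <= (c k)%:R%:E *
    (box_section i0 (A k) (B k) (\row_i (if i == i0 then t else x ord0 i)))%:E.
    by rewrite -EFinM lee_fin mulr_ge0// box_section_ge0.
  have -> : \sum_(k <oo) ((c k)%:R%:E * \int[lebesgue_measure]_t
    (box_section i0 (A k) (B k) (\row_i (if i == i0 then t else x ord0 i)))%:E)
    = \int[lebesgue_measure]_t \sum_(k <oo) ((c k)%:R%:E *
    (box_section i0 (A k) (B k) (\row_i (if i == i0 then t else x ord0 i)))%:E).
    rewrite integral_nneseries//; apply: eq_eseriesr => k _.
    rewrite ge0_integralZl//; first exact: measurable_box_section.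
    by move=> t _; rewrite lee_fin box_section_ge0.
  apply: ge0_le_integral => //.
  - by move=> t _; rewrite lee_fin box_section_ge0.
  - exact: measurable_box_section.
  - by apply: ge0_emeasurable_sum => // k _; exact: mS.
  - move=> t _; apply: le_trans (ih (ltnW mn) _) _.
    apply: lee_nneseries => [k _ _|k _]; last by rewrite EFinM.
    by rewrite lee_fin mulr_ge0// box_section_ge0.
have full u v x : box_section n u v x = box_vol u v.
  by apply: eq_bigr => i _; rewrite ltn_ord.
have := step n (leqnn n) a; rewrite full.
by under eq_eseriesr do rewrite full.
Qed.

Lemma box_content_boxE a b : (forall i, a ord0 i <= b ord0 i)%R ->
  box_content (box a b) = (box_vol a b)%:E.
Proof.
move=> ab; apply/eqP; rewrite eq_le box_content_box//=.
apply: le_ereal_inf_tmp => v [[bab0 ->]|[a' [b' [ab' [bab' ->]]]]].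
  apply: le_trans (le_box_vol_cover (c := fun=> false) (A := fun=> a) (B := fun=> b)
    ab (fun=> ab) _) _.
    by move=> x; rewrite bab0.
  by rewrite eseries0// => k *; rewrite mul0r.
apply: le_trans (le_box_vol_cover (c := fun k => k == 0%N) (A := fun=> a')
  (B := fun=> b') ab (fun=> ab') _) _.
  by move=> x; rewrite bab' => ?; exists 0%N.
rewrite nneseries_head ?mul1r//= => k; last by rewrite mul0r.
by rewrite lee_fin mulr_ge0// prodr_ge0// => i _; rewrite subr_ge0.
Qed.

Lemma box_content_lty A : box_content A < +oo ->
  A = set0 \/ exists a b, (forall i, a ord0 i <= b ord0 i)%R /\ A = box a b.
Proof.
move=> Aoo; have [v [[-> _]|[a [b [ab [Aab _]]]]]] : [set v | (A = set0 /\ v = 0)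
    \/ exists a b : 'rV[R]_n, (forall i, (a ord0 i <= b ord0 i)%R) /\
        A = box a b /\ v = (box_vol a b)%:E] !=set0.
- by apply/set0P/eqP => E; move: Aoo; rewrite /box_content E ereal_inf0 ltxx.
- by left.
- by right; exists a, b.
Qed.

Lemma leb_outer_box a b : (forall i, a ord0 i <= b ord0 i)%R ->
  @leb_outer R n (box a b) = (box_vol a b)%:E.
Proof.
move=> ab; apply/eqP; rewrite eq_le; apply/andP; split.
  rewrite -box_content_boxE//; apply: ereal_inf_lbound.
  exists (fun k => if k is 0%N then box a b else set0).
    by split => // x abx; exists 0%N.
  by rewrite nneseries_head// => k; [exact: box_content_ge0|exact: box_content0].
apply: le_ereal_inf_tmp => _ [F [mF XF] <-].
have [Fk|/existsNP[k Fk]] := pselect (forall k, box_content (F k) < +oo); last first.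
  rewrite (@eseries_pinfty _ _ predT k) ?leey//.
    by move=> j _; rewrite gt_eqF// (lt_le_trans _ (box_content_ge0 _)).
  by apply/eqP; move/negP : Fk; rewrite -leNgt leye_eq.
have C k : exists w : bool * 'rV[R]_n * 'rV[R]_n,
  [/\ forall i, (w.1.2 ord0 i <= w.2 ord0 i)%R, F k = (if w.1.1 then box w.1.2 w.2 else set0) &
   box_content (F k) = (w.1.1%:R * box_vol w.1.2 w.2)%:E].
  have [F0|[u [w [uw Fuw]]]] := box_content_lty (Fk k).
    by exists (false, 0%R, 0%R); split => //=; rewrite F0 box_content0 mul0r.
  exists (true, u, w); split => //=.
  by rewrite Fuw mul1r box_content_boxE.
have [g gP] := choice C.
apply: le_trans (le_box_vol_cover (c := fun k => (g k).1.1) (A := fun k => (g k).1.2)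
  (B := fun k => (g k).2) ab _ _) _.
- by move=> k; have [] := gP k.
- move=> x abx; have [k _ Fkx] := XF x abx; exists k.
  by have [_ Fg _] := gP k; move: Fkx; rewrite Fg; case: ifP.
by apply: lee_nneseries => // [k _ _|k _]; have [ab' _ <-] := gP k => //; exact: box_content_ge0.
Qed.

Lemma lebn_box a b : (forall i, a ord0 i <= b ord0 i)%R ->
  @lebn R n (box a b) = (box_vol a b)%:E.
Proof. exact: leb_outer_box. Qed.

End BoxVolume.

(** * Measurability of open and compact sets *)

Section OpenSets.
Variables (R : realType) (n : nat).
Implicit Types (a b x : 'rV[R]_n).

Lemma nbhs_rVP x (U : set 'rV[R]_n) : nbhs x U ->
  exists2 e : R, (0 < e) &
    forall y : 'rV[R]_n, (forall i, (`|y ord0 i - x ord0 i| < e)) -> U y.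
Proof.
move=> /nbhs_ballP[e /= e0 eU]; exists e => // y xy; apply: eU.
by split => // i j; rewrite !ord1 /ball/= distrC xy.
Qed.

Definition closed_box a b : set 'rV[R]_n := [set y | forall j, a ord0 j <= y ord0 j <= b ord0 j].

Lemma compact_closed_box a b : compact (closed_box a b).
Proof.
have -> : closed_box a b = [set y | forall j, `[a ord0 j, b ord0 j]%classic (y ord0 j)].
  by apply/seteqP; split=> y /= h j; have := h j; rewrite /= in_itv.
exact: (@rV_compact R n (fun j => `[a ord0 j, b ord0 j]%classic)
  (fun j => @segment_compact _ _ _)).
Qed.

(** The sets are boxes with rational corners, enumerated by [unpickle]. Each sits in a compact
    subset of U because local integrability speaks of compact sets only; this is how it yields
    measurability on all of U. *)
Lemma open_bigcup_box (U : set 'rV[R]_n) : open U ->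
  exists2 E : (set 'rV[R]_n)^nat, U = \bigcup_k E k &
    forall k, measurable (E k : set (LebT R n)) /\
      exists K, [/\ compact K, E k `<=` K & K `<=` U].
Proof.
move=> oU; pose rv (q : 'rV[rat]_n) : 'rV[R]_n := \row_i ratr (q ord0 i).
pose G k : set 'rV[R]_n := if @unpickle ('rV[rat]_n * 'rV[rat]_n)%type k is Some ab
  then (if `[< closed_box (rv ab.1) (rv ab.2) `<=` U >] then box (rv ab.1) (rv ab.2) else set0)
  else set0.
have sub q q' : box (rv q) (rv q') `<=` closed_box (rv q) (rv q').
  by move=> y yb i; have /andP[-> /ltW ->] := yb i.
exists G => [|k]; last first.
  have e0 : exists K : set 'rV[R]_n, [/\ compact K, set0 `<=` K & K `<=` U].
    by exists set0; split=> //; exact: compact0.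
  rewrite /G; case: unpickle => [[u v]/=|]; last by split=> //; exact: measurable0.
  case: asboolP => [uvU|_]; last by split=> //; exact: measurable0.
  split; first exact: measurable_box.
  exists (closed_box (rv u) (rv v)); split=> //; exact: compact_closed_box.
apply/seteqP; split => [x Ux|x [k _]]; last first.
  by rewrite /G; case: unpickle => // -[u v]; case: asboolP => // + /sub; apply.
have [e e0 eU] := nbhs_rVP (open_nbhs_nbhs (conj oU Ux)).
have lo i : {q : rat | ratr q \in `]x ord0 i - e, x ord0 i[}.
  by apply/cid; apply: rat_in_itvoo; rewrite ltrBlDr ltrDl.
have hi i : {q : rat | ratr q \in `]x ord0 i, x ord0 i + e[}.
  by apply/cid; apply: rat_in_itvoo; rewrite ltrDl.
exists (pickle (\row_i sval (lo i), \row_i sval (hi i))) => //.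
rewrite /G pickleK /=; case: asboolP => [_|nU].
  move=> i; rewrite !mxE; case: (lo i) => q /=; rewrite in_itv/= => /andP[_ /ltW ->].
  by case: (hi i) => r /=; rewrite in_itv/= => /andP[-> _].
exfalso; apply: nU => y yb; apply: eU => i; have := yb i; rewrite !mxE.
case: (lo i) => q /=; rewrite in_itv/= => /andP[xq _].
case: (hi i) => r /=; rewrite in_itv/= => /andP[_ rx] /andP[qy yr].
by rewrite ltr_distl (lt_le_trans xq)//= (le_lt_trans yr).
Qed.

Lemma measurable_open (U : set 'rV[R]_n) : open U -> measurable (U : set (LebT R n)).
Proof.
by move=> /open_bigcup_box[E -> hE]; apply: bigcup_measurable => k _; have [] := hE k.
Qed.

Lemma measurable_compact (K : set 'rV[R]_n) : compact K -> measurable (K : set (LebT R n)).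
Proof.
move=> cK; rewrite -[X in measurable X]setCK; apply: measurableC; apply: measurable_open.
by apply: closed_openC; apply: compact_closed => //; exact: norm_hausdorff.
Qed.

Lemma loc_integrable_measurable (Omega : set 'rV[R]_n) (g : 'rV[R]_n -> R) : open Omega ->
  loc_integrable Omega g -> measurable_fun (Omega : set (LebT R n)) (g : LebT R n -> R).
Proof.
move=> /open_bigcup_box[E -> hE] lg; apply/measurable_fun_bigcup => k; first by have [] := hE k.
have [mE [K [cK EK KO]]] := hE k.
apply: (measurable_funS (measurable_compact cK) EK); apply/measurable_EFinP.
by apply: measurable_int; exact: lg.
Qed.

Lemma measurable_coord (i : 'I_n) :
  measurable_fun setT (fun x : LebT R n => (x : 'rV[R]_n) ord0 i).
Proof.
move=> mD; apply: (measurability _ (RGenInftyO.measurableE R)) => //.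
move=> _ [_ [c ->] <-]; rewrite setTI.
have -> : [set` `]-oo, c[%R] = [set r : R | (r < c)%R] by apply/seteqP; split => r; rewrite /= in_itv.
exact: measurable_halfspace.
Qed.

End OpenSets.

(** * The Euclidean norm *)

Section EuclideanNorm.
Variables (R : realType) (m : nat).
Implicit Types u v x : 'rV[R]_m.

Lemma enorm_ge0 v : 0 <= enorm v.
Proof. exact: sqrtr_ge0. Qed.

Lemma sqr_enorm v : enorm v ^+ 2 = \sum_(i < m) v ord0 i ^+ 2.
Proof. by rewrite sqr_sqrtr// sumr_ge0// => i _; exact: sqr_ge0. Qed.

Lemma enormN v : enorm (- v) = enorm v.
Proof. by rewrite /enorm; under eq_bigr do rewrite mxE sqrrN. Qed.

(* Cauchy-Schwarz through Lagrange's identity. *)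
Lemma le_dot_enorm u v : \sum_(i < m) u ord0 i * v ord0 i <= enorm u * enorm v.
Proof.
have [d0|d0] := leP (\sum_(i < m) u ord0 i * v ord0 i) 0.
  by rewrite (le_trans d0)// mulr_ge0// enorm_ge0.
rewrite -(@ler_pXn2r _ 2)// ?nnegrE ?(ltW d0) ?mulr_ge0 ?enorm_ge0// exprMn !sqr_enorm.
have : 0 <= \sum_(i < m) \sum_(j < m) (u ord0 i * v ord0 j - u ord0 j * v ord0 i) ^+ 2.
  by apply: sumr_ge0 => i _; apply: sumr_ge0 => j _; exact: sqr_ge0.
have -> : \sum_(i < m) \sum_(j < m) (u ord0 i * v ord0 j - u ord0 j * v ord0 i) ^+ 2 =
  (\sum_(i < m) u ord0 i ^+ 2) * (\sum_(i < m) v ord0 i ^+ 2) *+ 2 -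
  (\sum_(i < m) u ord0 i * v ord0 i) ^+ 2 *+ 2.
  have e1 : (\sum_(i < m) u ord0 i ^+ 2) * (\sum_(i < m) v ord0 i ^+ 2) =
      \sum_(i < m) \sum_(j < m) u ord0 i ^+ 2 * v ord0 j ^+ 2 by exact: big_distrlr.
  have e2 : (\sum_(i < m) u ord0 i ^+ 2) * (\sum_(i < m) v ord0 i ^+ 2) =
      \sum_(i < m) \sum_(j < m) u ord0 j ^+ 2 * v ord0 i ^+ 2 by rewrite e1 exchange_big.
  have e3 : (\sum_(i < m) u ord0 i * v ord0 i) ^+ 2 =
      \sum_(i < m) \sum_(j < m) (u ord0 i * v ord0 i) * (u ord0 j * v ord0 j).
    by rewrite expr2; exact: big_distrlr.
  rewrite mulr2n {1}e1 e2 e3 -!sumrMnl -big_split/= -sumrB.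
  apply: eq_bigr => i _; rewrite -!sumrMnl -big_split/= -sumrB.
  by apply: eq_bigr => j _; ring.
by rewrite subr_ge0 lerMn2r.
Qed.

Lemma ler_enormD u v : enorm (u + v) <= enorm u + enorm v.
Proof.
rewrite -(@ler_pXn2r _ 2)// ?nnegrE ?addr_ge0 ?enorm_ge0//.
rewrite sqrrD !sqr_enorm.
have -> : \sum_(i < m) (u + v) ord0 i ^+ 2 = \sum_(i < m) u ord0 i ^+ 2 +
    (\sum_(i < m) u ord0 i * v ord0 i) *+ 2 + \sum_(i < m) v ord0 i ^+ 2.
  by rewrite -sumrMnl -!big_split/=; apply: eq_bigr => i _; rewrite mxE sqrrD.
by rewrite lerD2r lerD2l lerMn2r le_dot_enorm orbT.
Qed.

Lemma ler_dist_enorm u v : `|enorm u - enorm v| <= enorm (u - v).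
Proof.
have h (a b : 'rV[R]_m) : enorm a <= enorm (a - b) + enorm b.
  by have := ler_enormD (a - b) b; rewrite subrK.
rewrite ler_norml lerBlDr h andbT lerBrDl.
by have := h v u; rewrite -opprB enormN; lra.
Qed.

Lemma le_coord_enorm v i : `|v ord0 i| <= enorm v.
Proof.
rewrite -sqrtr_sqr ler_sqrt ?sumr_ge0// => [|j _]; last exact: sqr_ge0.
by rewrite (bigD1 i)//= lerDl sumr_ge0// => j _; exact: sqr_ge0.
Qed.

Lemma enorm_le_sum v : enorm v <= \sum_(i < m) `|v ord0 i|.
Proof.
have S0 : 0 <= \sum_(i < m) `|v ord0 i| by exact: sumr_ge0.
rewrite -(@ler_pXn2r _ 2)// ?nnegrE ?enorm_ge0// sqr_enorm expr2 big_distrlr/=.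
apply: ler_sum => i _; rewrite (bigD1 i)//= -normrM -expr2.
by rewrite (ger0_norm (sqr_ge0 _)) lerDl sumr_ge0// => j _; rewrite mulr_ge0.
Qed.

End EuclideanNorm.

(** * Cubes, balls and neighbourhoods of null sets *)

Section Cubes.
Variables (R : realType) (n : nat).
Implicit Types (a b x : 'rV[R]_n).

Definition cube a (r : R) : set (boxT R n) := box a (a + const_mx r).

Lemma cubeE a r x : cube a r x <-> forall i, a ord0 i <= x ord0 i < a ord0 i + r.
Proof. by split=> h i; have := h i; rewrite !mxE. Qed.

Lemma lebn_cube a r : 0 <= r -> @lebn R n (cube a r) = (r ^+ n)%:E.
Proof.
move=> r0; rewrite lebn_box => [|i]; last by rewrite !mxE lerDl.
rewrite /box_vol (eq_bigr (fun=> r)) ?prodr_const ?card_ord// => i _.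
by rewrite !mxE; ring.
Qed.

Lemma measurable_cube a r : measurable (cube a r : set (LebT R n)).
Proof. exact: measurable_box. Qed.

Lemma lebn_box_hyperplane a b (i : 'I_n) (c : R) : (forall j, a ord0 j <= b ord0 j) ->
  @lebn R n (box a b `&` [set x | x ord0 i = c]) = 0%E.
Proof.
move=> ab; apply/eqP; rewrite eq_le outer_measure_ge0 andbT.
pose K := \prod_(j < n | j != i) (b ord0 j - a ord0 j).
have K0 : 0 <= K by apply: prodr_ge0 => j _; rewrite subr_ge0.
apply/lee_addgt0Pr => e e0; rewrite add0e.
pose h := e / (K + 1).
have h0 : 0 < h by rewrite divr_gt0// ltr_wpDl.
pose a' := \row_j if j == i then c else a ord0 j.
pose b' := \row_j if j == i then c + h else b ord0 j.
have ab' j : a' ord0 j <= b' ord0 j by rewrite !mxE; case: ifP => // _; rewrite lerDl ltW.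
apply: (@le_trans _ _ (@lebn R n (box a' b'))).
  apply: le_outer_measure => x [xab /= xc] j; rewrite !mxE.
  by case: eqP => [->|_]; [rewrite xc lexx ltrDl|exact: xab].
rewrite lebn_box// lee_fin /box_vol (bigD1 i)//= !mxE eqxx.
have -> : c + h - c = h by ring.
rewrite (eq_bigr (fun j => b ord0 j - a ord0 j)) => [|j /negbTE ji]; last by rewrite !mxE ji.
by rewrite -/K /h -mulrA ler_piMr ?(ltW e0)// mulrC ler_pdivrMr ?mul1r ?lerDl// ltr_wpDl.
Qed.

Lemma open_eball x r : open (eball x r).
Proof.
rewrite openE => y; rewrite /eball/= => xyr.
pose e := (r - enorm (y - x)) / n.+1%:R.
have e0 : 0 < e by rewrite divr_gt0// subr_gt0.
apply/nbhs_ballP; exists e => //= z [_ yz].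
have := ler_enormD (z - y) (y - x); rewrite addrA subrK => /le_lt_trans; apply.
rewrite -ltrBrDr; apply: le_lt_trans (enorm_le_sum _) _.
apply: (@le_lt_trans _ _ (\sum_(i < n) e)).
  by apply: ler_sum => i _; rewrite !mxE distrC ltW//; exact: yz.
rewrite sumr_const card_ord -[_ *+ n]mulr_natr /e mulrAC ltr_pdivrMr//.
by rewrite ltr_pM2l ?subr_gt0// ltr_nat.
Qed.

Lemma measurable_eball x r : measurable (eball x r : set (LebT R n)).
Proof. by apply: measurable_open; exact: open_eball. Qed.

(** The Euclidean norm is compared with the sum of the coordinates. Dividing by n + 1 makes the
    inequality strict in every dimension; the factors (n + 1) / 2 in later constants come from
    here. *)
Lemma cube_sub_eball x r : 0 < r ->
  cube (x - const_mx (r / n.+1%:R)) (2 * (r / n.+1%:R)) `<=` eball x r.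
Proof.
move=> r0 y /cubeE; rewrite /eball/=; set s := r / _ => xy.
apply: le_lt_trans (enorm_le_sum _) _.
apply: (@le_lt_trans _ _ (\sum_(i < n) s)).
  apply: ler_sum => i _; rewrite !mxE; have := xy i; rewrite !mxE ler_norml => /andP[h1 h2].
  by apply/andP; split; lra.
rewrite sumr_const card_ord -[_ *+ n]mulr_natr /s mulrAC ltr_pdivrMr//.
by rewrite ltr_pM2l// ltr_nat.
Qed.

Lemma eball_sub_cube x r : eball x r `<=` cube (x - const_mx r) (2 * r).
Proof.
move=> y; rewrite /eball/= => xy; apply/cubeE => i; rewrite !mxE.
have := le_lt_trans (le_coord_enorm (y - x) i) xy; rewrite !mxE ltr_norml => /andP[h1 h2].
by apply/andP; split; lra.
Qed.

Lemma lebn_eball_ge x r : 0 < r ->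
  ((((2 / n.+1%:R) * r) ^+ n)%:E <= @lebn R n (eball x r))%E.
Proof.
move=> r0; have h : 0 <= 2 * (r / n.+1%:R) by rewrite mulr_ge0// divr_ge0// ltW.
rewrite -mulrA (mulrC _^-1) -(lebn_cube (x - const_mx (r / n.+1%:R)) h).
by apply: le_outer_measure; exact: cube_sub_eball.
Qed.

Lemma lebn_eball_le x r : 0 <= r -> (@lebn R n (eball x r) <= ((2 * r) ^+ n)%:E)%E.
Proof.
move=> r0; rewrite -(lebn_cube (x - const_mx r)) ?mulr_ge0//.
by apply: le_outer_measure; exact: eball_sub_cube.
Qed.

Lemma box_vol_enlarge a b (e : R) : 0 < e ->
  exists2 h, 0 < h & box_vol (a - const_mx h) b < box_vol a b + e.
Proof.
move=> e0.
have vc : (fun h : R => box_vol (a - const_mx h) b) @ 0 --> box_vol a b.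
  have -> : box_vol a b = \prod_(i < n) (b ord0 i - (a ord0 i - 0)).
    by apply: eq_bigr => i _; rewrite subr0.
  under eq_fun.
    move=> h; have -> : box_vol (a - const_mx h) b = \prod_(i < n) (b ord0 i - (a ord0 i - h)).
      by apply: eq_bigr => i _; rewrite !mxE.
    over.
  apply: cvg_big => [|i _]; first exact: mul_continuous.
  by apply: cvgB; [exact: cvg_cst|apply: cvgB; [exact: cvg_cst|exact: cvg_id]].
have /vc/nbhs_ballP[d /= d0 dP] : nbhs (box_vol a b) [set y | y < box_vol a b + e].
  by apply: lt_nbhsl; rewrite ltrDl.
exists (d / 2); first by rewrite divr_gt0.
apply: dP; rewrite /ball/= sub0r normrN gtr0_norm ?divr_gt0//.
by rewrite ltr_pdivrMr// ltr_pMr// ltr1n.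
Qed.

(** The half-open boxes of a cover are enlarged at their lower faces only, the upper ones being
    excluded already. Half of e is spent on the cover, the other half on the enlargements, with a
    share 2^-(k+1) for the k-th. *)
Lemma lebn_null_open (N : set 'rV[R]_n) (e : R) : @leb_outer R n N = 0%E -> 0 < e ->
  exists U : set 'rV[R]_n, [/\ open U, N `<=` U & (@lebn R n U <= e%:E)%E].
Proof.
move=> N0 e0.
have e20 : 0 < e / 2 by rewrite divr_gt0.
have : (@leb_outer R n N < (e / 2)%:E)%E by rewrite N0 lte_fin.
move=> /ereal_inf_lt[_ [F [_ NF] <-] Fe].
have Fk k : (box_content (F k) < +oo)%E.
  rewrite ltNge leye_eq; apply/negP => /eqP Fk.
  move: Fe; rewrite (@eseries_pinfty _ _ predT k) ?ltNge ?leey// => j _.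
  by rewrite gt_eqF// (lt_le_trans _ (box_content_ge0 _)).
have G k : exists U : set 'rV[R]_n, [/\ open U, F k `<=` U &
    (@lebn R n U <= box_content (F k) + (e / 2 / (2 ^ k.+1)%:R)%:E)%E].
  have ek0 : 0 < e / 2 / (2 ^ k.+1)%:R by rewrite divr_gt0// ltr0n expn_gt0.
  have [F0|[a [b [ab Fab]]]] := box_content_lty (Fk k).
    exists set0; split; [exact: open0|by rewrite F0|].
    by rewrite measure0 adde_ge0 ?box_content_ge0// lee_fin ltW.
  have [h h0 hv] := box_vol_enlarge a b ek0.
  exists [set x | forall i, a ord0 i - h < x ord0 i < b ord0 i]; split.
  - rewrite openE => x xab; rewrite /interior/=.
    have : nbhs x [set y : 'rV[R]_n | forall i, i \in enum 'I_n -> a ord0 i - h < y ord0 i < b ord0 i].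
      elim: (enum 'I_n) => [|i s ih]; first exact: filterE.
      have xi : nbhs x [set y : 'rV[R]_n | a ord0 i - h < y ord0 i < b ord0 i].
        have := xab i; rewrite -[_ && _]/(x ord0 i \in `]a ord0 i - h, b ord0 i[).
        by move=> /near_in_itvoo /(@coord_continuous _ _ _ ord0 i x).
      apply: filterS2 xi ih => y yi ys j; rewrite inE => /predU1P[->//|]; exact: ys.
    by apply: filterS => y ys i; apply: ys; rewrite mem_enum.
  - rewrite Fab => x xab i; have /andP[ax ->] := xab i.
    by rewrite andbT (lt_le_trans _ ax)// gtrBl.
  - rewrite Fab box_content_boxE//; apply: (@le_trans _ _ (@lebn R n (box (a - const_mx h) b))).
      apply: le_outer_measure => x xab i; rewrite !mxE.
      by have /andP[/ltW -> ->] := xab i.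
    rewrite lebn_box ?lee_fin ?ltW// => i.
    by rewrite !mxE lerBlDr (le_trans (ab i))// lerDl ltW.
have [U UP] := choice G.
exists (\bigcup_k U k); split.
- by apply: bigcup_open => k _; have [] := UP k.
- by move=> x /NF[k _ Fx]; exists k => //; have [_ + _] := UP k; apply.
apply: le_trans (outer_measure_sigma_subadditive (@leb_outer R n) U) _.
apply: (@le_trans _ _ (\sum_(k <oo) (box_content (F k) + (e / 2 / (2 ^ k.+1)%:R)%:E))%E).
  by apply: lee_nneseries => k *; [exact: outer_measure_ge0|have [] := UP k].
apply: (@le_trans _ _ (\sum_(k <oo) box_content (F k) + (e / 2)%:E)%E).
  by apply: epsilon_trick (ltW e20) => k; exact: box_content_ge0.
by rewrite [leRHS](_ : _ = ((e / 2)%:E + (e / 2)%:E)%E) ?leeD2r ?ltW// -EFinD -splitr.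
Qed.

End Cubes.

(** * Smooth test functions *)

Section SmoothOneVariable.
Variable (R : realType).
Implicit Types (f g h : R -> R).

(** No continuity is asked of the last derivative: with all k at hand it follows from one more
    differentiability. *)
Fixpoint Ck (k : nat) h : Prop :=
  if k is k'.+1 then (forall x, derivable h x 1) /\ Ck k' (derive1 h) else True.

Definition Cinfty h := forall k, Ck k h.

Lemma derive1_is_derive h h' : (forall x, is_derive x (1:R) h (h' x)) -> (derive1 h) = h'.
Proof. by move=> hh'; apply/funext => x; rewrite derive1E derive_val. Qed.

Lemma CkS k h h' : (forall x, is_derive x (1:R) h (h' x)) -> Ck k h' -> Ck k.+1 h.
Proof. by move=> hh' Ch'; split=> [x|]; [exact: ex_derive|rewrite (derive1_is_derive hh')]. Qed.

Lemma Ck_is_derive k h : Ck k.+1 h -> forall x, is_derive x (1:R) h ((derive1 h) x).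
Proof. by move=> [dh _] x; rewrite derive1E; exact: derivableP. Qed.

Lemma Ck_le k h : Ck k.+1 h -> Ck k h.
Proof. by elim: k h => // k ih h [dh /ih Ch]; split. Qed.

Lemma Ck_cst k (c : R) : Ck k (fun=> c).
Proof.
by elim: k c => // k ih c; apply: (@CkS _ _ (fun=> 0)); exact: ih.
Qed.

Lemma CkD k f g : Ck k f -> Ck k g -> Ck k (fun x => f x + g x).
Proof.
elim: k f g => // k ih f g Cf Cg.
apply: (@CkS _ _ (fun x => (derive1 f) x + (derive1 g) x)); last by apply: ih; [exact: Cf.2|exact: Cg.2].
by move=> x; exact: is_deriveD (Ck_is_derive Cf x) (Ck_is_derive Cg x).
Qed.

Lemma CkM k f g : Ck k f -> Ck k g -> Ck k (fun x => f x * g x).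
Proof.
elim: k f g => // k ih f g Cf Cg.
apply: (@CkS _ _ (fun x => f x * (derive1 g) x + g x * (derive1 f) x)).
  by move=> x; exact: is_deriveM (Ck_is_derive Cf x) (Ck_is_derive Cg x).
by apply: CkD; apply: ih; try exact: Ck_le; [exact: Cg.2|exact: Cf.2].
Qed.

Lemma is_derive1_comp' f g x (df dg : R) : is_derive x (1:R) f df ->
  is_derive (f x) 1 g dg -> is_derive x (1:R) (fun y => g (f y)) (dg * df).
Proof.
move=> [fx <-] [gx <-]; apply: DeriveDef.
  apply/derivable1_diffP; apply: (@differentiable_comp _ _ _ _ f g).
    exact/derivable1_diffP.
  exact/derivable1_diffP.
by rewrite -!derive1E (derive1_comp fx gx).
Qed.

Lemma Ck_affine k h (c d : R) : Ck k h -> Ck k (fun x => h (c * x + d)).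
Proof.
elim: k h => // k ih h Ch.
apply: (@CkS _ _ (fun x => (derive1 h) (c * x + d) * c)).
  move=> x; apply: is_derive1_comp'; last exact: Ck_is_derive Ch _.
  have : is_derive x (1:R) (c \*: id + cst d : R -> R) (c *: 1 + 0) by apply: is_deriveD.
  by rewrite addr0 [c *: 1]mulr1.
by apply: CkM; [exact: ih Ch.2|exact: Ck_cst].
Qed.

Lemma CkV k h : (forall x, h x != 0) -> Ck k h -> Ck k (fun x => (h x)^-1).
Proof.
move=> h0; elim: k => // k ih Ch.
apply: (@CkS _ _ (fun x => - (h x)^-1 ^+ 2 * (derive1 h) x)).
  move=> x; have dh := Ck_is_derive Ch x.
  apply: DeriveDef; first by apply: derivableV => //; exact: ex_derive.
  rewrite (deriveV (h0 x) (@ex_derive _ _ _ _ _ _ _ dh)) (@derive_val _ _ _ _ _ _ _ dh).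
  by rewrite exprVn.
apply: CkM; last exact: Ch.2.
rewrite (_ : (fun _ => _) = fun x => -1 * ((h x)^-1 * (h x)^-1)); last first.
  by apply/funext => x; rewrite mulN1r expr2.
by apply: CkM; [exact: Ck_cst|apply: CkM; apply: ih; exact: Ck_le].
Qed.

(** The classical exp(-1/x) together with its multiples by x^-m: this family is closed under
    differentiation up to linear combinations, so smoothness follows by induction for all m at
    once. *)
Definition flat (m : nat) (x : R) : R :=
  if 0 < x then x^-1 ^+ m * expR (- x^-1) else 0.

Lemma flat_ge0 m x : 0 <= flat m x.
Proof. by rewrite /flat; case: ifP => // x0; rewrite mulr_ge0 ?expR_ge0// exprn_ge0// invr_ge0 ltW. Qed.

Lemma flat_gt0 m x : 0 < x -> 0 < flat m x.
Proof. by move=> x0; rewrite /flat x0 mulr_gt0 ?expR_gt0// exprn_gt0// invr_gt0. Qed.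

Lemma flat_le0 m x : x <= 0 -> flat m x = 0.
Proof. by move=> x0; rewrite /flat ltNge x0. Qed.

(** With y = 1/x this is y^(m+1) <= (m+1)! exp(y). Applied to m + 1 it makes the difference quotient
    of [flat m] at 0 vanish in the limit. *)
Lemma flat_le m x : 0 <= x -> flat m x <= m.+1`!%:R * x.
Proof.
rewrite /flat; case: ltP => [x0 _|x0 x0']; last by rewrite mulr_ge0.
have y0 : 0 < x^-1 by rewrite invr_gt0.
rewrite -ler_pdivrMr// expRN -mulrA mulrC -mulrA ler_pdivrMl ?expR_gt0//.
rewrite mulrC -exprSr mulrC.
have := expR_ge1Dxn m (ltW y0).
rewrite -ler_pdivrMl ?ltr0n ?fact_gt0// mulrC => h; apply: le_trans h.
by rewrite lerDr.
Qed.

Lemma is_derive_flat m x : is_derive x (1:R) (flat m) (- m%:R * flat m.+1 x + flat m.+2 x).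
Proof.
have [x0|x0|->] := ltgtP x 0.
- have -> : - m%:R * flat m.+1 x + flat m.+2 x = 0.
    by rewrite !flat_le0 ?ltW// mulr0 addr0.
  apply: (@near_eq_is_derive _ _ _ (cst 0)).
  near=> y; rewrite /cst flat_le0//; near: y.
  by apply: filterS (lt_nbhsl x0) => y /ltW.
- apply: (@near_eq_is_derive _ _ _ (fun y : R => y^-1 ^+ m * expR (- y^-1))).
    by near=> y; rewrite /flat ifT//; near: y; exact: lt_nbhsr.
  have xn0 : x != 0 by rewrite gt_eqF.
  have dV : is_derive x (1:R) (fun y : R => y^-1) (- x^-1 ^+ 2).
    apply: DeriveDef; first exact: derivableV.
    by rewrite deriveV// derive_id exprVn [_ *: _]mulr1.
  have dE : is_derive x (1:R) (fun y : R => expR (- y^-1)) (expR (- x^-1) * x^-1 ^+ 2).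
    have dN : is_derive x (1 : R) (fun y : R => - y^-1) (x^-1 ^+ 2).
      by rewrite -[X in is_derive _ _ _ X]opprK; exact: is_deriveN dV.
    exact: is_derive1_comp' dN (is_derive_expR _).
  have dX : is_derive x (1:R) (fun y : R => y^-1 ^+ m) ((m%:R * x^-1 ^+ m.-1) * - x^-1 ^+ 2).
    have -> : (fun y : R => y^-1 ^+ m) = (fun y : R => y^-1) ^+ m.
      by apply/funext => y; rewrite exprfctE.
    apply: is_derive_eq (is_deriveX m dV) _.
    by rewrite /GRing.scale/= mulr_natl.
  apply: is_derive_eq (is_deriveM dX dE) _.
  rewrite /flat x0 /GRing.scale/=; case: m {dX} => [|m]; rewrite ?expr0 ?exprS/=; ring.
- have -> : - m%:R * flat m.+1 0 + flat m.+2 0 = 0.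
    by rewrite !flat_le0// mulr0 addr0.
  have cv : h^-1 *: ((flat m \o shift 0) (h *: (1 : R)) - flat m 0) @[h --> 0^'] --> (0 : R).
    apply/cvgr0Pnorm_lt => e e0.
    near=> h; rewrite /= (flat_le0 m (lexx 0)) subr0 addr0 [h *: 1]mulr1.
    have [h0|h0] := ltP 0 h; last by rewrite flat_le0// scaler0 normr0.
    have -> : h^-1 *: flat m h = flat m.+1 h by rewrite /flat h0 [_ *: _]mulrA -exprS.
    rewrite ger0_norm ?flat_ge0// (le_lt_trans (flat_le _ (ltW h0)))//.
    rewrite mulrC -ltr_pdivlMr ?ltr0n ?fact_gt0// -[h]gtr0_norm//.
    near: h; apply: dnbhs0_lt; by rewrite divr_gt0// ltr0n fact_gt0.
  apply: DeriveDef; first by apply/cvg_ex; exists 0.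
  by apply/cvg_lim.
Unshelve. all: by end_near. Qed.

Lemma Cinfty_flat m : Cinfty (flat m).
Proof.
move=> k; elim: k m => // k ih m; apply: CkS (is_derive_flat m) _.
by apply: CkD => //; apply: CkM => //; exact: Ck_cst.
Qed.

Definition step (x : R) : R := flat 0 x / (flat 0 x + flat 0 (1 - x)).

Let step_den_gt0 x : 0 < flat 0 x + flat 0 (1 - x).
Proof.
have [x0|x0] := ltP 0 x; first by rewrite ltr_pwDl ?flat_gt0// flat_ge0.
by rewrite ltr_wpDl ?flat_ge0// flat_gt0//; lra.
Qed.

Lemma Cinfty_step : Cinfty step.
Proof.
move=> k; apply: CkM; first exact: Cinfty_flat.
apply: CkV => [x|]; first by rewrite gt_eqF.
apply: CkD; first exact: Cinfty_flat.
rewrite (_ : (fun _ => _) = fun x => flat 0 (-1 * x + 1)); last first.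
  by apply/funext => x; congr flat; ring.
by apply: Ck_affine; exact: Cinfty_flat.
Qed.

Lemma step_ge0 x : 0 <= step x.
Proof. by rewrite divr_ge0 ?flat_ge0// ltW. Qed.

Lemma step_le1 x : step x <= 1.
Proof. by rewrite ler_pdivrMr// mul1r lerDl flat_ge0. Qed.

Lemma step_le0 x : x <= 0 -> step x = 0.
Proof. by move=> x0; rewrite /step flat_le0// mul0r. Qed.

Lemma step_ge1 x : 1 <= x -> step x = 1.
Proof.
move=> x1; have x0 : 0 < x by rewrite (lt_le_trans _ x1).
rewrite /step [flat 0 (1 - x)]flat_le0 ?addr0 ?divff//; last by lra.
by rewrite gt_eqF// flat_gt0.
Qed.

(** The plateau is placed off centre so that, as e tends to 0, z converges at every point to the
    indicator of the half-open interval from a to b, in agreement with the half-open cubes. *)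
Lemma smooth_plateau (a b e : R) : 0 < e -> exists z : R -> R,
  [/\ Cinfty z, forall x, 0 <= z x <= 1, forall x, a <= x <= b - e -> z x = 1,
      forall x, x <= a - e -> z x = 0 & forall x, b <= x -> z x = 0].
Proof.
move=> e0; exists (fun x => step (e^-1 * x + (1 - a / e)) * step (- e^-1 * x + b / e)).
have e1 x : e^-1 * x + (1 - a / e) = (x - a + e) / e by field; rewrite gt_eqF.
have e2 x : - e^-1 * x + b / e = (b - x) / e by field; rewrite gt_eqF.
split.
- by move=> k; apply: CkM; apply: Ck_affine; exact: Cinfty_step.
- by move=> x; rewrite mulr_ge0 ?step_ge0//= mulr_ile1 ?step_ge0 ?step_le1.
- move=> x /andP[ax xb]; rewrite e1 e2 !step_ge1 ?mulr1// ler_pdivlMr//; lra.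
- by move=> x xa; rewrite e1 step_le0 ?mul0r// pmulr_lle0 ?invr_gt0//; lra.
- by move=> x bx; rewrite e2 [X in _ * X]step_le0 ?mulr0// pmulr_lle0 ?invr_gt0//; lra.
Qed.

End SmoothOneVariable.

Section Antiderivative.
Variable (R : realType).
Implicit Types z : R -> R.

Lemma derivable_continuousR z : (forall x, derivable z x 1) -> continuous z.
Proof. by move=> dz x; apply: differentiable_continuous; exact/derivable1_diffP. Qed.

(** Since z vanishes to the left of A, the integral may start at the fixed point A - 1: for x < A
    the integral is locally zero, and for x >= A the fundamental theorem applies in the interior. *)
Lemma antiderivative z (A : R) : continuous z -> (forall x, x <= A -> z x = 0) ->
  exists Z : R -> R, forall x, is_derive x (1 : R) Z (z x).
Proof.
move=> cz z0; exists (fun y => \int[lebesgue_measure]_(t in `[A - 1, y]) z t).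
move=> x; have [xA|Ax] := ltP x A.
  rewrite z0 ?ltW//; apply: (@near_eq_is_derive _ _ _ (cst 0)).
  near=> y; rewrite (@eq_Rintegral _ _ _ _ _ (cst 0)); first by rewrite Rintegral_cst ?mul0r.
  move=> t; rewrite inE/= in_itv/= => /andP[_ ty]; apply: z0; rewrite (le_trans ty)// ltW//.
  by near: y; exact: lt_nbhsl.
have xx : x < x + 1 by rewrite ltrDl.
have A1 : A - 1 < x by rewrite (lt_le_trans _ Ax)// gtrBl.
have iz : lebesgue_measure.-integrable `[A - 1, x + 1] (EFin \o z).
  apply: continuous_compact_integrable; first exact: segment_compact.
  exact: continuous_subspaceT.
have [dZ Zx] := continuous_FTC1_closed xx iz A1 (cz x).
by rewrite -Zx derive1E; exact: derivableP.
Unshelve. all: by end_near. Qed.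

(* The kernel [z * 1_[0, r]], a smooth substitute for the tent function. *)
Lemma smooth_tent z (a b r : R) : 0 < r -> Cinfty z -> (forall x, 0 <= z x <= 1) ->
  (forall x, x <= a -> z x = 0) -> (forall x, b <= x -> z x = 0) ->
  exists t : R -> R, [/\ Cinfty t, forall x, derive1 t x = z x - z (x - r),
    forall x, 0 <= t x <= r, forall x, x <= a -> t x = 0 & forall x, b + r <= x -> t x = 0].
Proof.
move=> r0 Cz z01 za zb.
have cz : continuous z by apply: derivable_continuousR; exact: (Cz 1%N).1.
have [Z dZ] := antiderivative cz za.
have dt x : is_derive x (1 : R) (fun x => Z x - Z (x - r)) (z x - z (x - r)).
  apply: is_deriveB; have -> : z (x - r) = z (x - r) * 1 by rewrite mulr1.
  by apply: (@is_derive1_comp' _ (shift (- r)) Z); exact: is_derive_shift.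
have mvt x : exists2 c, x - r < c < x & Z x - Z (x - r) = z c * r.
  have xr : x - r < x by rewrite gtrBl.
  have [|c] := @MVT R Z z _ _ xr (fun y _ => dZ y).
    apply: continuous_subspaceT; apply: derivable_continuousR => y; exact: ex_derive.
  by rewrite in_itv/= => cx ->; exists c => //; congr (_ * _); ring.
exists (fun x => Z x - Z (x - r)); split.
- move=> [//|k]; apply: (CkS dt); apply: CkD; first exact: Cz.
  rewrite (_ : (fun x => - _) = fun x => -1 * z (1 * x + - r)); last first.
    by apply/funext => x; rewrite mul1r mulN1r.
  by apply: CkM; [exact: Ck_cst|apply: Ck_affine; exact: Cz].
- by move=> x; rewrite (derive1_is_derive dt).
- move=> x; have [c _ ->] := mvt x; have /andP[z0 z1] := z01 c.
  by rewrite mulr_ge0 ?(ltW r0)//= ler_piMl// ltW.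
- by move=> x xa; have [c /andP[_ cx] ->] := mvt x; rewrite za ?mul0r//; lra.
- by move=> x xb; have [c /andP[xc _] ->] := mvt x; rewrite zb ?mul0r//; lra.
Qed.

End Antiderivative.

Section Tensor.
Variables (R : realType) (n : nat).

Definition tensor (h : 'I_n -> R -> R) (y : 'rV[R]_n) : R := \prod_(j < n) h j (y ord0 j).

Lemma is_derive_tensor (h : 'I_n -> R -> R) (i : 'I_n) (x : 'rV[R]_n) :
  (forall j y, derivable (h j) y (1 : R)) ->
  is_derive x (delta_mx ord0 i : 'rV[R]_n) (tensor h)
    (tensor (fun j => if j == i then derive1 (h i) else h j) x).
Proof.
move=> dh; pose C := \prod_(j < n | j != i) h j (x ord0 j).
have cv : t^-1 *: ((tensor h \o shift x) (t *: delta_mx ord0 i) - tensor h x) @[t --> 0^']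
    --> (C * derive1 (h i) (x ord0 i) : R).
  have : (t : R)^-1 *: ((h i \o shift (x ord0 i)) (t *: (1 : R)) - h i (x ord0 i)) @[t --> 0^']
     --> (derive1 (h i) (x ord0 i) : R).
    by rewrite derive1E; exact: dh.
  move=> /(cvgM (cvg_cst C)) /=; apply: cvg_trans; apply: near_eq_cvg; near=> t.
  rewrite /GRing.scale/= mulrCA; congr (_ * _).
  rewrite /tensor (bigD1 i)//= [X in _ = _ - X](bigD1 i)//= !mxE !eqxx mulrBr.
  congr (_ - _); last by rewrite mulrC.
  rewrite mulrC; congr (_ * _); apply: eq_bigr => j /negbTE ji.
  by rewrite !mxE ji andbF mulr0 add0r.
rewrite [X in is_derive _ _ _ X](_ : _ = C * derive1 (h i) (x ord0 i)); last first.
  rewrite /tensor (bigD1 i)//= eqxx mulrC; congr (_ * _).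
  by apply: eq_bigr => j /negbTE ->.
by apply: DeriveDef; [apply/cvg_ex; eexists; exact: cv|exact/cvg_lim].
Unshelve. all: by end_near. Qed.

Lemma continuous_tensor h : (forall j, continuous (h j)) -> continuous (tensor h).
Proof.
move=> ch; apply: continuous_big => [|i _ x]; first exact: mul_continuous.
by apply: continuous_comp; [exact: coord_continuous|exact: ch].
Qed.

(** A partial derivative of a product of one-variable functions differentiates one factor and is
    again such a product, so induction on the list of directions stays in the class. *)
Lemma smooth_tensor h : (forall j, Cinfty (h j)) -> smooth (tensor h).
Proof.
move=> Ch s.
have [h' [Ch' ->]] : exists h', (forall j, Cinfty (h' j)) /\ pderivs s (tensor h) = tensor h'.
  elim: s => [|i s [h' [Ch' E]]]; first by exists h.
  exists (fun j => if j == i then derive1 (h' i) else h' j); split.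
    by move=> j; case: eqP => // _ k; have := (Ch' i k.+1).2.
  rewrite /= -/(pderivs _ _) E; apply/funext => x.
  by have [_ ->] := is_derive_tensor i x (fun j y => (Ch' j 1%N).1 y).
have dh' j y : derivable (h' j) y (1 : R) by exact: (Ch' j 1%N).1.
split; first by apply: continuous_tensor => j; exact: derivable_continuousR.
by move=> i x; have [] := is_derive_tensor i x dh'.
Qed.

Lemma pderivs1_tensor h i : (forall j, Cinfty (h j)) ->
  pderivs [:: i] (tensor h) = tensor (fun j => if j == i then derive1 (h i) else h j).
Proof.
move=> Ch; apply/funext => x /=.
by have [_ ->] := is_derive_tensor i x (fun j y => (Ch j 1%N).1 y).
Qed.

Lemma measurable_tensor h : (forall j, continuous (h j)) ->
  measurable_fun setT (tensor h : LebT R n -> R).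
Proof.
move=> ch; apply: measurable_prod => j _.
apply: (measurableT_comp (f := h j)) (measurable_coord j).
exact: continuous_measurable_fun.
Qed.

End Tensor.

(** * Translates of cubes *)

Section RintegralToolkit.
Context d (T : measurableType d) (R : realType) (mu : {measure set T -> \bar R}).
Implicit Types (D E A : set T) (f g h : T -> R).

Lemma Rintegral_dominated_cvg D (f_ : nat -> T -> R) f g : measurable D ->
  (forall k, measurable_fun D (f_ k)) ->
  (forall x, D x -> f_ k x @[k --> \oo] --> f x) ->
  mu.-integrable D (EFin \o g) ->
  (forall k x, D x -> `|f_ k x| <= g x) ->
  mu.-integrable D (EFin \o f) /\
  \int[mu]_(x in D) f_ k x @[k --> \oo] --> \int[mu]_(x in D) f x.
Proof.
move=> mD mf_ f_f ig fg.
have mf : measurable_fun D (EFin \o f).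
  apply: (@emeasurable_fun_cvg _ _ _ _ (fun k => EFin \o f_ k)) => //.
    by move=> k; apply/measurable_EFinP.
  by move=> x Dx; apply: cvg_EFin; [exact: nearW|exact: f_f].
have [|||i _ c] := @dominated_convergence _ _ _ mu D mD (fun k => EFin \o f_ k) (EFin \o f)
  (EFin \o g) _ mf _ ig _.
- by move=> k; apply/measurable_EFinP.
- by apply/aeW => x Dx; apply: cvg_EFin; [exact: nearW|exact: f_f].
- by apply/aeW => x k Dx; rewrite /= lee_fin fg.
split=> //; apply: fine_cvg; rewrite /Rintegral fineK//; exact: integrable_fin_num.
Qed.

Lemma Rintegral_indicM D A f : \int[mu]_(x in D) (f x * \1_A x) = \int[mu]_(x in D `&` A) f x.
Proof.
rewrite Rintegral_mkcondr; apply: eq_Rintegral => x _.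
by rewrite patchE indicE; case: ifP; rewrite ?mulr1 ?mulr0.
Qed.

Lemma Rintegral_indicM_sub D A f : A `<=` D ->
  \int[mu]_(x in D) (f x * \1_A x) = \int[mu]_(x in A) f x.
Proof. by move=> AD; rewrite Rintegral_indicM setIidr. Qed.

Lemma Rintegral_support D A f : A `<=` D -> (forall x, D x -> ~ A x -> f x = 0) ->
  \int[mu]_(x in D) f x = \int[mu]_(x in A) f x.
Proof.
move=> AD f0; rewrite -(Rintegral_indicM_sub f AD); apply: eq_Rintegral => x.
rewrite inE indicE => Dx; case: (boolP (x \in A)) => [_|]; first by rewrite mulr1.
by rewrite notin_setE => nA; rewrite f0 ?mul0r.
Qed.

Lemma integrable_indicM D A f : measurable D -> measurable A ->
  mu.-integrable D (EFin \o f) -> mu.-integrable D (EFin \o (fun x => f x * \1_A x)).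
Proof.
move=> mD mA fi; apply: (le_integrable mD _ _ fi).
  apply/measurable_EFinP; apply: measurable_funM.
    by apply/measurable_EFinP; exact: measurable_int fi.
  exact: measurable_indic.
move=> x _; rewrite /= lee_fin normrM ler_piMr// indicE.
by case: (_ \in _); rewrite ?normr1 ?normr0.
Qed.

Lemma le_Rintegral_sub D E f : measurable D -> measurable E -> D `<=` E ->
  mu.-integrable E (EFin \o f) -> (forall x, E x -> 0 <= f x) ->
  \int[mu]_(x in D) f x <= \int[mu]_(x in E) f x.
Proof.
move=> mD mE DE fi f0; rewrite -(Rintegral_indicM_sub f DE).
apply: le_Rintegral => // [|x /f0 fx]; first exact: integrable_indicM.
by rewrite ler_piMr// indicE; case: (_ \in _).
Qed.

Lemma Rintegral_sum D (I : Type) (s : seq I) (P : pred I) (F : I -> T -> R) :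
  measurable D -> (forall i, P i -> mu.-integrable D (EFin \o F i)) ->
  \int[mu]_(x in D) (\sum_(i <- s | P i) F i x) = \sum_(i <- s | P i) \int[mu]_(x in D) F i x.
Proof.
move=> mD iF; elim: s => [|i s ih].
  by rewrite big_nil; under eq_Rintegral do rewrite big_nil; rewrite Rintegral_cst// mul0r.
rewrite big_cons; under eq_Rintegral do rewrite big_cons.
case: ifP => // Pi; rewrite RintegralD ?ih//; first exact: iF.
rewrite (_ : _ \o _ = fun x => (\sum_(i <- s | P i) (F i x)%:E)%E).
  by apply: integrable_sum => // j Pj; exact: iF.
by apply/funext => x /=; rewrite sumEFin.
Qed.

Lemma integrable_sumR D (I : Type) (s : seq I) (P : pred I) (F : I -> T -> R) :
  measurable D -> (forall i, P i -> mu.-integrable D (EFin \o F i)) ->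
  mu.-integrable D (EFin \o (fun x => \sum_(i <- s | P i) F i x)).
Proof.
move=> mD iF; rewrite (_ : _ \o _ = fun x => (\sum_(i <- s | P i) (F i x)%:E)%E).
  by apply: integrable_sum => // j Pj; exact: iF.
by apply/funext => x /=; rewrite sumEFin.
Qed.

End RintegralToolkit.

Section CubeShift.
Variables (R : realType) (n : nat).
Implicit Types (a b x y : 'rV[R]_n) (Omega : set 'rV[R]_n) (v g : 'rV[R]_n -> R).
Notation mu := (@lebn R n).

Definition weak_partial Omega (i : 'I_n) v g :=
  forall phi, test_fun Omega phi ->
    (\int[mu]_(y in (Omega : set (LebT R n))) (v y * pderivs [:: i] phi y)%:E =
     - \int[mu]_(y in (Omega : set (LebT R n))) (g y * phi y)%:E)%E.

Lemma measurable_closed_box a b : measurable (closed_box a b : set (LebT R n)).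
Proof. exact: measurable_compact (@compact_closed_box _ _ _ _). Qed.

Lemma near_scaled_inv (e d : R) : 0 < d -> \forall k \near \oo, e * k.+1%:R^-1 < d.
Proof.
move=> d0; have : e * k.+1%:R^-1 @[k --> \oo] --> (e * 0 : R).
  by apply: cvgM; [exact: cvg_cst|exact: cvg_harmonic].
by rewrite mulr0 => /cvgr_lt; apply.
Qed.

(** The test functions are products of a smoothed tent in direction i and plateaus in the other
    directions. Their i-th derivatives tend to the indicator of K minus that of its translate K',
    while they themselves stay between 0 and rho. The margin e0 below the cubes houses the smoothing
    layers of width [e k]. *)
Lemma cube_shift_diff Omega v g (i : 'I_n) a (rho e0 : R) :
  0 < rho -> 0 < e0 -> open Omega ->
  closed_box (a - const_mx e0) (a + const_mx rho + rho *: delta_mx ord0 i) `<=` Omega ->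
  loc_integrable Omega v -> loc_integrable Omega g -> weak_partial Omega i v g ->
  `|\int[mu]_(y in cube (a + rho *: delta_mx ord0 i) rho) v y -
    \int[mu]_(y in cube a rho) v y| <=
  rho * \int[mu]_(y in cube a rho `|` cube (a + rho *: delta_mx ord0 i) rho) `|g y|.
Proof.
move=> rho0 e00 oO; set b2 := a + _ + _; set C := closed_box _ _ => CO liv lig wp.
set K := cube a rho; set K' := cube _ rho.
have cC : compact C by exact: compact_closed_box.
have mC : measurable (C : set (LebT R n)) by exact: measurable_closed_box.
have iv : mu.-integrable C (EFin \o v) by exact: liv.
have ig : mu.-integrable C (EFin \o g) by exact: lig.
have mO : measurable (Omega : set (LebT R n)) by exact: measurable_open.
pose e k : R := e0 * k.+1%:R^-1.
have e_gt0 k : 0 < e k by rewrite mulr_gt0// invr_gt0.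
have e_le k : e k <= e0 by rewrite ler_piMr ?(ltW e00)// invf_le1// ler1n.
have [z zP] := choice (fun kj : nat * 'I_n =>
  smooth_plateau (a ord0 kj.2) (a ord0 kj.2 + rho) (e_gt0 kj.1)).
have [t tP] : {t : nat -> R -> R & forall k, [/\ Cinfty (t k),
    forall s, derive1 (t k) s = z (k, i) s - z (k, i) (s - rho),
    forall s, 0 <= t k s <= rho, forall s, s <= a ord0 i - e k -> t k s = 0 &
    forall s, a ord0 i + rho + rho <= s -> t k s = 0]}.
  apply: (@choice nat (R -> R) (fun k t => [/\ Cinfty t,
    forall s, derive1 t s = z (k, i) s - z (k, i) (s - rho),
    forall s, 0 <= t s <= rho, forall s, s <= a ord0 i - e k -> t s = 0 &
    forall s, a ord0 i + rho + rho <= s -> t s = 0])) => k; have [Cz z01 _ za zb] := zP (k, i).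
  exact: (smooth_tent rho0 Cz z01 za zb).
pose H k j : R -> R := if j == i then t k else z (k, j).
have CH k j : Cinfty (H k j).
  by rewrite /H; case: eqP => _; [have [] := tP k|have [] := zP (k, j)].
pose phi k := tensor (H k).
pose psi k := pderivs [:: i] (phi k).
pose B k := box (a - const_mx (e k)) b2.
have BC k : B k `<=` C.
  move=> y By j; have /andP[h1 /ltW ->] := By j; rewrite andbT.
  by apply: le_trans h1; rewrite !mxE lerD2l lerN2.
have b2E j : b2 ord0 j = a ord0 j + rho + (if j == i then rho else 0).
  by rewrite !mxE eqxx/=; case: eqP => _; rewrite ?mulr1 ?mulr0.
have phi_bd k y : `|phi k y| <= rho.
  rewrite /phi /tensor normr_prod (bigD1 i)//= /H eqxx -[leRHS]mulr1.
  have [_ _ /(_ (y ord0 i)) /andP[t0 t1] _ _] := tP k.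
  apply: ler_pM => //; [exact: prodr_ge0|by rewrite ger0_norm|].
  apply: prodr_ile1 => j /negbTE ->; have [_ /(_ (y ord0 j)) /andP[z0 z1] _ _ _] := zP (k, j).
  by rewrite normr_ge0 ger0_norm.
have phi_supp k y : ~ B k y -> phi k y = 0.
  move=> /existsNP[j /negP]; rewrite /phi /tensor (bigD1 j)//= negb_and -!ltNge -leNgt b2E !mxE.
  move=> h; suff -> : H k j (y ord0 j) = 0 by rewrite mul0r.
  move: h; rewrite /H; case: eqP => [->|_].
    by have [_ _ _ ta tb] := tP k => /orP[/ltW|]; [exact: ta|exact: tb].
  by rewrite addr0; have [_ _ _ za zb] := zP (k, j) => /orP[/ltW|]; [exact: za|exact: zb].
have psiE k : psi k = tensor (fun j => if j == i then derive1 (H k i) else H k j).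
  by apply: pderivs1_tensor => j; exact: CH.
have psi_bd k y : `|psi k y| <= 1.
  rewrite psiE /tensor normr_prod; apply: prodr_ile1 => j _; rewrite normr_ge0/=.
  case: eqP => [->|/eqP/negbTE ji]; rewrite /H ?eqxx ?ji.
    have [_ -> _ _ _] := tP k; have [_ z01 _ _ _] := zP (k, i).
    have /andP[? ?] := z01 (y ord0 i); have /andP[? ?] := z01 (y ord0 i - rho).
    by rewrite ler_norml; apply/andP; split; lra.
  by have [_ /(_ (y ord0 j)) /andP[z0 z1] _ _ _] := zP (k, j); rewrite ger0_norm.
have psi_supp k y : ~ C y -> psi k y = 0.
  move=> nC; have /existsNP[j /negP] : ~ B k y by move=> /BC.
  rewrite psiE /tensor (bigD1 j)//= negb_and -!ltNge -leNgt b2E !mxE.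
  move=> h; suff -> : (if j == i then derive1 (H k i) else H k j) (y ord0 j) = 0.
    by rewrite mul0r.
  move: h.
  case: eqP => [->|/eqP/negbTE ji]; rewrite /H ?eqxx ?ji.
    have [_ -> _ _ _] := tP k; have [_ _ _ za zb] := zP (k, i).
    move=> /orP[h|h]; first by rewrite !za ?subrr//=; lra.
    by rewrite !zb ?subrr//=; lra.
  by rewrite addr0; have [_ _ _ za zb] := zP (k, j) => /orP[/ltW|]; [exact: za|exact: zb].
have zcvg j (s : R) : z (k, j) s @[k --> \oo] --> ((a ord0 j <= s < a ord0 j + rho)%R%:R : R).
  apply: cvg_near_cst; have [sa|sa] := ltP s (a ord0 j) => /=.
    have d0 : 0 < a ord0 j - s by rewrite subr_gt0.
    near=> k; have [_ _ _ za _] := zP (k, j); apply: za => /=.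
    suff : e k < a ord0 j - s by lra.
    by near: k; exact: near_scaled_inv.
  have [sb|sb] := ltP s (a ord0 j + rho) => /=; last first.
    by apply: nearW => k; have [_ _ _ _ zb] := zP (k, j); exact: zb.
  have d0 : 0 < a ord0 j + rho - s by rewrite subr_gt0.
  near=> k; have [_ _ z1 _ _] := zP (k, j); apply: z1 => /=; rewrite sa/=.
  suff : e k < a ord0 j + rho - s by lra.
  by near: k; exact: near_scaled_inv.
(* The limit holds at every point, boundaries included, because the plateaus tend to indicators of
   half-open intervals; no null set has to be discarded. *)
have psi_cvg y : psi k y @[k --> \oo] --> (\1_K y - \1_K' y : R).
  pose L j : R := if j == i then (a ord0 i <= y ord0 i < a ord0 i + rho)%R%:R -
    (a ord0 i <= y ord0 i - rho < a ord0 i + rho)%R%:R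
    else (a ord0 j <= y ord0 j < a ord0 j + rho)%R%:R.
  have -> : \1_K y - \1_K' y = \prod_(j < n) L j.
    have e1 : \1_K y = \prod_(j < n) (a ord0 j <= y ord0 j < a ord0 j + rho)%R%:R :> R.
      rewrite indicE; case: (boolP (y \in K)) => [|].
        by rewrite inE => /cubeE Ky; rewrite big1// => j _; rewrite Ky.
      rewrite notin_setE => nK; have /existsNP[j /negP/negbTE h] :
        ~ (forall j, a ord0 j <= y ord0 j < a ord0 j + rho) by move=> /cubeE.
      by rewrite (bigD1 j)//= h mul0r.
    have e2 : \1_K' y = \prod_(j < n) (a ord0 j + (if j == i then rho else 0) <= y ord0 j <
        a ord0 j + (if j == i then rho else 0) + rho)%R%:R :> R.
      have aE j : (a + rho *: delta_mx ord0 i) ord0 j = a ord0 j + (if j == i then rho else 0).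
        by rewrite !mxE eqxx/=; case: eqP => _; rewrite ?mulr1 ?mulr0.
      rewrite indicE; case: (boolP (y \in K')) => [|].
        by rewrite inE => /cubeE Ky; rewrite big1// => j _; rewrite -aE Ky.
      rewrite notin_setE => nK; have /existsNP[j /negP/negbTE h] :
        ~ (forall j, (a + rho *: delta_mx ord0 i) ord0 j <= y ord0 j <
           (a + rho *: delta_mx ord0 i) ord0 j + rho) by move=> /cubeE.
      by rewrite (bigD1 j)//= -aE h mul0r.
    rewrite e1 e2 (bigD1 i)//= [X in _ - X](bigD1 i)//= [RHS](bigD1 i)//= eqxx.
    rewrite (eq_bigr L) => [|j /negbTE ji]; last by rewrite /L ji.
    rewrite [X in _ - _ * X](eq_bigr L) => [|j /negbTE ji]; last by rewrite /L ji addr0.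
    by rewrite -mulrBl /L eqxx lerBrDr ltrBlDr.
  under eq_fun do rewrite psiE /tensor.
  apply: cvg_big => [|j _]; first exact: mul_continuous.
  rewrite /L; case: eqP => [->|/eqP/negbTE ji]; rewrite /H ?eqxx ?ji; last exact: zcvg.
  rewrite (_ : (fun k => _) = fun k => z (k, i) (y ord0 i) - z (k, i) (y ord0 i - rho)).
    by apply: cvgB; exact: zcvg.
  by apply/funext => k; have [_ -> _ _ _] := tP k.
have phi_test k : test_fun Omega (phi k).
  split; first by apply: smooth_tensor => j; exact: CH.
  by exists C; split=> // y nC; apply: phi_supp => /BC.
have cH k j : continuous (H k j).
  by apply: derivable_continuousR; exact: (CH k j 1%N).1.
have cdH k : continuous (derive1 (H k i)).
  by apply: derivable_continuousR; exact: (CH k i 2%N).2.1.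
have mphi k : measurable_fun setT (phi k : LebT R n -> R) by exact: measurable_tensor.
have mpsi k : measurable_fun setT (psi k : LebT R n -> R).
  by rewrite psiE; apply: measurable_tensor => j; case: eqP.
have id k : \int[mu]_(y in C) (v y * psi k y) = - \int[mu]_(y in C) (g y * phi k y).
  have -> : \int[mu]_(y in C) (v y * psi k y) = \int[mu]_(y in (Omega : set (LebT R n))) (v y * psi k y).
    by apply/esym/Rintegral_support => // y _ /psi_supp ->; rewrite mulr0.
  have -> : \int[mu]_(y in C) (g y * phi k y) = \int[mu]_(y in (Omega : set (LebT R n))) (g y * phi k y).
    apply/esym/Rintegral_support => // y _ nC.
    by rewrite phi_supp ?mulr0// => /BC.
  by rewrite /Rintegral (wp _ (phi_test k)) fineN.
pose D : set (LebT R n) := C.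
have mv : measurable_fun D v by apply/measurable_EFinP; exact: measurable_int iv.
have mg : measurable_fun D g by apply/measurable_EFinP; exact: measurable_int ig.
have mK : measurable (K : set (LebT R n)) by exact: measurable_cube.
have mK' : measurable (K' : set (LebT R n)) by exact: measurable_cube.
have KE : K `|` K' = box a b2.
  apply/seteqP; split=> y.
    move=> [/cubeE Ky|/cubeE Ky] j; have := Ky j; rewrite b2E.
      by move=> /andP[-> h]; case: eqP => _ /=; lra.
    by rewrite !mxE eqxx/=; case: eqP => _ /=; rewrite ?mulr1 ?mulr0 => /andP[h1 h2]; apply/andP; split; lra.
  move=> yab; have [yi|yi] := ltP (y ord0 i) (a ord0 i + rho); [left|right].
    apply/cubeE => j; have := yab j; rewrite b2E.
    by case: eqP => [->|_] /andP[-> h] //=; lra.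
  apply/cubeE => j; have := yab j; rewrite b2E !mxE eqxx/=.
  by case: eqP => [->|_]; rewrite ?mulr1 ?mulr0 => /andP[h1 h2]; apply/andP; split; lra.
have KKC : K `|` K' `<=` C.
  rewrite KE => y yab j; have /andP[h1 /ltW ->] := yab j; rewrite andbT.
  by apply: le_trans h1; rewrite !mxE gerBl ltW.
have KC : K `<=` C by move=> y Ky; apply: KKC; left.
have K'C : K' `<=` C by move=> y Ky; apply: KKC; right.
have mB k : measurable (B k : set (LebT R n)) by exact: measurable_box.
have B_cvg y : \1_(B k) y @[k --> \oo] --> (\1_(K `|` K') y : R).
  apply: cvg_near_cst; rewrite KE.
  have [yab|/existsNP[j /negP]] := pselect (box a b2 y).
    apply: nearW => k; rewrite !indicE !mem_set// => j.
    by have /andP[h1 ->] := yab j; rewrite andbT (le_trans _ h1)// !mxE gerBl ltW.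
  move=> yj; have -> : \1_(box a b2) y = 0 :> R.
    by rewrite indicE memNset// => /(_ j); exact/negP.
  move: yj; rewrite negb_and -ltNge -leNgt => /orP[yj|yj]; last first.
    apply: nearW => k; rewrite indicE memNset// => /(_ j) /andP[_].
    by rewrite ltNge yj.
  have d0 : 0 < a ord0 j - y ord0 j by rewrite subr_gt0.
  near=> k; rewrite indicE memNset// => /(_ j) /andP[+ _]; rewrite !mxE.
  suff : e k < a ord0 j - y ord0 j by lra.
  by near: k; exact: near_scaled_inv.
have v_bd k y : D y -> `|v y * psi k y| <= `|v y| by rewrite normrM ler_piMr.
have g_bd k y : D y -> `| `|g y| * \1_(B k) y| <= `|g y|.
  by rewrite normrM normr_id ler_piMr// indicE; case: (_ \in _); rewrite ?normr1 ?normr0.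
have [ivK lhs] := @Rintegral_dominated_cvg _ _ _ mu D (fun k y => v y * psi k y)
  (fun y => v y * (\1_K y - \1_K' y)) (fun y => `|v y|) mC
  (fun k => measurable_funM mv (measurable_funTS (mpsi k)))
  (fun y _ => cvgM (cvg_cst (v y)) (psi_cvg y)) (integrable_norm iv)
  v_bd.
have [_ rhs] := @Rintegral_dominated_cvg _ _ _ mu D (fun k y => `|g y| * \1_(B k) y)
  (fun y => `|g y| * \1_(K `|` K') y) (fun y => `|g y|) mC
  (fun k => measurable_funM (measurableT_comp (@normr_measurable R setT) mg)
     (measurable_indic (mB k)))
  (fun y _ => cvgM (cvg_cst `|g y|) (B_cvg y)) (integrable_norm ig)
  g_bd.
rewrite Rintegral_indicM_sub// in rhs.
have E : \int[mu]_(y in D) (v y * (\1_K y - \1_K' y)) =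
    \int[mu]_(y in K) v y - \int[mu]_(y in K') v y.
  under eq_Rintegral do rewrite mulrBr.
  by rewrite RintegralB ?Rintegral_indicM_sub//; exact: integrable_indicM.
move: lhs; rewrite E distrC => /cvg_norm lhs.
apply: (ler_cvg_to lhs (cvgM (cvg_cst rho) rhs)); apply: nearW => k; rewrite id normrN.
have iphi : mu.-integrable D (EFin \o (fun y => g y * phi k y)).
  rewrite (_ : _ \o _ = ((EFin \o g) \* (EFin \o phi k))%E)//.
  apply: integrableMl => //; first exact: measurable_funTS.
  exists rho; split; [exact: num_real|move=> r rr y _ /=].
  by apply: le_trans (phi_bd k y) _; exact: ltW.
apply: le_trans (le_normr_Rintegral mC iphi) _.
rewrite [leRHS]/= -RintegralZl//; last by apply: integrable_indicM => //; exact: integrable_norm.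
apply: le_Rintegral => //; first exact: integrable_norm.
  rewrite (_ : _ \o _ = fun y => (rho%:E * (`|g y| * \1_(B k) y)%:E)%E)//.
  by apply: integrableZl => //; apply: integrable_indicM => //; exact: integrable_norm.
move=> y _; rewrite normrM mulrCA ler_wpM2l// indicE.
case: (boolP (y \in B k)) => [_|]; first by rewrite mulr1.
by rewrite notin_setE => /phi_supp ->; rewrite normr0 mulr0.
Unshelve. all: by end_near. Qed.

End CubeShift.

(** * Averages over a grid *)

Section Grid.
Variables (R : realType) (n : nat).
Notation mu := (@lebn R n).
Variables (a : 'rV[R]_n) (r : R) (k : nat).
Hypothesis r0 : 0 < r.
Let Q : set (LebT R n) := cube a r.
Implicit Types (K : {ffun 'I_n -> 'I_k.+1}) (y : 'rV[R]_n) (h : 'rV[R]_n -> R).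

Definition mesh : R := r / k.+1%:R.

Definition cell_corner K : 'rV[R]_n := a + \row_j ((K j)%:R * mesh).

Definition cell K : set (LebT R n) := cube (cell_corner K) mesh.

Definition cell_avg h K : R := (mesh ^+ n)^-1 * \int[mu]_(y in cell K) h y.

Definition gridfun (U : {ffun 'I_n -> 'I_k.+1} -> R) y : R := \sum_K U K * \1_(cell K) y.

Lemma mesh_gt0 : 0 < mesh. Proof. by rewrite divr_gt0. Qed.

Lemma meshE : k.+1%:R * mesh = r. Proof. by rewrite mulrC divfK. Qed.

Lemma cellE K y : cell K y <-> forall j,
  a ord0 j + (K j)%:R * mesh <= y ord0 j < a ord0 j + (K j).+1%:R * mesh.
Proof.
have e j : cell_corner K ord0 j + mesh = a ord0 j + (K j).+1%:R * mesh.
  by rewrite !mxE -[(K j).+1%:R]natr1; ring.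
have e' j : cell_corner K ord0 j = a ord0 j + (K j)%:R * mesh by rewrite !mxE.
split=> [/cubeE h j|h]; first by rewrite -e -e'.
by apply/cubeE => j; rewrite e e'.
Qed.

Lemma cell_sub K : cell K `<=` Q.
Proof.
move=> y /cellE h; apply/cubeE => j; have /andP[h1 h2] := h j.
have m0 := mesh_gt0.
apply/andP; split; first by apply: le_trans h1; rewrite lerDl mulr_ge0// ltW.
apply: lt_le_trans h2 _; rewrite lerD2l.
by rewrite -meshE ler_pM2r// ler_nat.
Qed.

Lemma cell_index y : Q y -> exists K0, forall K, cell K y <-> K = K0.
Proof.
move=> /cubeE Qy; have m0 := mesh_gt0.
pose q j := (y ord0 j - a ord0 j) / mesh.
have q0 j : 0 <= q j by have /andP[h _] := Qy j; rewrite divr_ge0 ?subr_ge0// ltW.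
have qlt j : (Num.truncn (q j) < k.+1)%N.
  rewrite truncn_lt_nat//; have /andP[_ h] := Qy j.
  by rewrite ltr_pdivrMr// meshE; lra.
exists [ffun j => Ordinal (qlt j)] => K; split.
  move=> /cellE Ky; apply/ffunP => j; apply/val_inj; rewrite ffunE/=; apply/esym/eqP.
  rewrite truncn_eq// ler_pdivlMr// ltr_pdivrMr//.
  by have /andP[h1 h2] := Ky j; apply/andP; split; lra.
move=> ->; apply/cellE => j; rewrite ffunE/=.
have /andP[h1 h2] := truncn_itv (q0 j).
by move: h1 h2; rewrite ler_pdivlMr// ltr_pdivrMr// => h1 h2; apply/andP; split; lra.
Qed.

Lemma gridfunE U K y : cell K y -> gridfun U y = U K.
Proof.
move=> Ky; have [K0 K0P] := cell_index (cell_sub Ky).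
have KK0 := (K0P K).1 Ky.
rewrite /gridfun (bigD1 K)//= indicE mem_set// mulr1 big1 ?addr0// => K' K'K.
by rewrite indicE memNset ?mulr0// => /(K0P K').1 K'0; move: K'K; rewrite KK0 K'0 eqxx.
Qed.

Lemma sum_cell_indic y : Q y -> \sum_K \1_(cell K) y = 1 :> R.
Proof.
move=> Qy; have [K0 K0P] := cell_index Qy.
have := @gridfunE (fun=> 1) K0 y ((K0P K0).2 erefl).
by rewrite /gridfun; under eq_bigr do rewrite mul1r.
Qed.

Lemma measurable_cell K : measurable (cell K).
Proof. exact: measurable_cube. Qed.

Lemma lebn_cell K : mu (cell K) = (mesh ^+ n)%:E.
Proof. by rewrite lebn_cube// ltW// mesh_gt0. Qed.

Lemma integrable_cst_cube (b : 'rV[R]_n) (s c : R) : 0 <= s ->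
  mu.-integrable (cube b s : set (LebT R n)) (EFin \o cst c).
Proof.
move=> s0; apply: measurable_bounded_integrable => //; first exact: measurable_cube.
  by rewrite [X in (X < _)%E](lebn_cube b s0) ltry.
by exists `|c|; split; [exact: num_real|move=> x /ltW ? y _].
Qed.

Lemma integrable_gridfun U : mu.-integrable Q (EFin \o gridfun U).
Proof.
apply: integrable_sumR => // [|K _]; first exact: measurable_cube.
apply: integrable_indicM; [exact: measurable_cube|exact: measurable_cell|].
by apply: integrable_cst_cube; exact: ltW.
Qed.

Lemma Rintegral_cells h : mu.-integrable Q (EFin \o h) ->
  \int[mu]_(y in Q) h y = \sum_K \int[mu]_(y in cell K) h y.
Proof.
move=> ih; have mQ : measurable Q by exact: measurable_cube.
transitivity (\int[mu]_(y in Q) (\sum_K h y * \1_(cell K) y)).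
  apply: eq_Rintegral => y; rewrite inE => Qy.
  by rewrite -mulr_sumr sum_cell_indic// mulr1.
rewrite Rintegral_sum// => [|K _]; last first.
  by apply: integrable_indicM => //; exact: measurable_cell.
by apply: eq_bigr => K _; rewrite Rintegral_indicM_sub//; exact: cell_sub.
Qed.

Lemma Rintegral_cell_cst h K (c : R) : (forall y, cell K y -> h y = c) ->
  \int[mu]_(y in cell K) h y = mesh ^+ n * c.
Proof.
move=> hc; rewrite (@eq_Rintegral _ _ _ _ _ (cst c)) => [|y]; last by rewrite inE => /hc.
rewrite Rintegral_cst; last exact: measurable_cell.
by rewrite [X in fine X](lebn_cell K) /= mulrC.
Qed.

Lemma Rintegral_gridwise h (c : {ffun 'I_n -> 'I_k.+1} -> R) :
  (forall K y, cell K y -> h y = c K) ->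
  mu.-integrable Q (EFin \o h) /\ \int[mu]_(y in Q) h y = mesh ^+ n * \sum_K c K.
Proof.
move=> hc; have ih : mu.-integrable Q (EFin \o h).
  apply: eq_integrable (integrable_gridfun c); first exact: measurable_cube.
  move=> y; rewrite inE => Qy /=; congr EFin.
  have [K0 K0P] := cell_index Qy; have Ky := (K0P K0).2 erefl.
  by rewrite (gridfunE _ Ky) (hc _ _ Ky).
split=> //; rewrite Rintegral_cells// mulr_sumr; apply: eq_bigr => K _.
by apply: Rintegral_cell_cst => y; exact: hc.
Qed.

Lemma cell_avgB h1 h2 K : mu.-integrable Q (EFin \o h1) -> mu.-integrable Q (EFin \o h2) ->
  cell_avg h1 K - cell_avg h2 K = cell_avg (fun y => h1 y - h2 y) K.
Proof.
move=> i1 i2; rewrite /cell_avg RintegralB ?mulrBr//; first exact: measurable_cell.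
  by apply: integrableS i1 => //; [exact: measurable_cube|exact: measurable_cell|exact: cell_sub].
by apply: integrableS i2 => //; [exact: measurable_cube|exact: measurable_cell|exact: cell_sub].
Qed.

(** This is the triangle inequality on each cell. Being uniform in k, it reduces the L1 convergence
    of grid averages to a dense class of functions. *)
Lemma gridfun_avg_contraction h : mu.-integrable Q (EFin \o h) ->
  \int[mu]_(y in Q) `|gridfun (cell_avg h) y| <= \int[mu]_(y in Q) `|h y|.
Proof.
move=> ih; have [|_ ->] := @Rintegral_gridwise (fun y => `|gridfun (cell_avg h) y|)
  (fun K => `|cell_avg h K|).
  by move=> K y Ky; rewrite (gridfunE _ Ky).
rewrite Rintegral_cells; last exact: integrable_norm.
rewrite mulr_sumr; apply: ler_sum => K _.
have m0 : 0 < mesh ^+ n by rewrite exprn_gt0// mesh_gt0.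
rewrite /cell_avg normrM gtr0_norm ?invr_gt0// mulrA divff ?gt_eqF// mul1r.
apply: le_normr_Rintegral; first exact: measurable_cell.
by apply: integrableS ih => //; [exact: measurable_cube|exact: measurable_cell|exact: cell_sub].
Qed.

End Grid.

(** * Convergence of grid averages in L1 *)

Section GridDensity.
Variables (R : realType) (n : nat).
Notation mu := (@lebn R n).
Variables (a : 'rV[R]_n) (r : R).
Hypothesis r0 : 0 < r.
Let Q : set (LebT R n) := cube a r.
Implicit Types (y : 'rV[R]_n) (h : 'rV[R]_n -> R).

Let mQ : measurable Q. Proof. exact: measurable_cube. Qed.

Definition grid_avg k h := gridfun a r (@cell_avg R n a r k h).

(** The class on which grid averages converge. It is shown to be linear, closed under L1
    approximation, and to contain first the indicators of finite unions of boxes, then those of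
    measurable sets. The Poincare inequality asks for L1 convergence only, so no pointwise
    differentiation theorem is involved. *)
Definition L1grid h := mu.-integrable Q (EFin \o h) /\
  forall e, 0 < e -> \forall k \near \oo, \int[mu]_(y in Q) `|grid_avg k h y - h y| <= e.

Lemma grid_avgB k h1 h2 : mu.-integrable Q (EFin \o h1) -> mu.-integrable Q (EFin \o h2) ->
  forall y, grid_avg k h1 y - grid_avg k h2 y = grid_avg k (fun y => h1 y - h2 y) y.
Proof.
move=> i1 i2 y; rewrite /grid_avg /gridfun -sumrB; apply: eq_bigr => K _.
by rewrite -mulrBl cell_avgB.
Qed.

Lemma integrable_subR h1 h2 : mu.-integrable Q (EFin \o h1) -> mu.-integrable Q (EFin \o h2) ->
  mu.-integrable Q (EFin \o (fun y => h1 y - h2 y)).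
Proof. by move=> i1 i2; apply: (integrableB mQ i1 i2). Qed.

Lemma L1grid_approx h : mu.-integrable Q (EFin \o h) ->
  (forall e, 0 < e -> exists2 h', L1grid h' & \int[mu]_(y in Q) `|h y - h' y| <= e) -> L1grid h.
Proof.
move=> ih app; split=> // e e0.
have e30 : 0 < e / 3 by rewrite divr_gt0.
have [h' [ih' Lh'] hh'] := app _ e30.
near=> k.
have ig1 := integrable_subR ih ih'.
have igk f : mu.-integrable Q (EFin \o grid_avg k f) by exact: integrable_gridfun.
have i1 := integrable_norm (igk (fun y => h y - h' y)).
have i2 := integrable_norm (integrable_subR (igk h') ih').
have i3 := integrable_norm ig1.
have i23 : mu.-integrable Q (EFin \o (fun y => `|grid_avg k h' y - h' y| + `|h y - h' y|)).
  exact: (integrableD mQ i2 i3).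
apply: (@le_trans _ _ (\int[mu]_(y in Q) (`|grid_avg k (fun y => h y - h' y) y| +
   (`|grid_avg k h' y - h' y| + `|h y - h' y|)))).
  apply: le_Rintegral => //.
  - by apply: integrable_norm; exact: integrable_subR.
  - exact: (integrableD mQ i1 i23).
  move=> y _; rewrite -grid_avgB//.
  rewrite (_ : grid_avg k h y - h y = (grid_avg k h y - grid_avg k h' y) +
    ((grid_avg k h' y - h' y) - (h y - h' y))); last by ring.
  by rewrite (le_trans (ler_normD _ _))// lerD2l (le_trans (ler_normB _ _)).
rewrite RintegralD// RintegralD//.
have c := @gridfun_avg_contraction R n a r k r0 _ ig1.
have : \int[mu]_(y in Q) `|grid_avg k h' y - h' y| <= e / 3 by near: k; exact: Lh'.
by move: c hh'; rewrite -/(grid_avg _ _); lra.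
Unshelve. all: by end_near. Qed.

Lemma L1gridD h1 h2 : L1grid h1 -> L1grid h2 -> L1grid (fun y => h1 y + h2 y).
Proof.
move=> [i1 L1] [i2 L2].
have i12 : mu.-integrable Q (EFin \o (fun y => h1 y + h2 y)) by exact: (integrableD mQ i1 i2).
split=> // e e0.
have e20 : 0 < e / 2 by rewrite divr_gt0.
near=> k.
have igk f : mu.-integrable Q (EFin \o grid_avg k f) by exact: integrable_gridfun.
have j1 := integrable_norm (integrable_subR (igk h1) i1).
have j2 := integrable_norm (integrable_subR (igk h2) i2).
apply: (@le_trans _ _ (\int[mu]_(y in Q) (`|grid_avg k h1 y - h1 y| + `|grid_avg k h2 y - h2 y|))).
  apply: le_Rintegral => //.
  - by apply: integrable_norm; exact: integrable_subR.
  - exact: (integrableD mQ j1 j2).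
  move=> y _; apply: le_trans (ler_normD _ _); rewrite le_eqVlt; apply/orP; left; apply/eqP.
  have := grid_avgB k i12 i2 y; rewrite (_ : (fun y => h1 y + h2 y - h2 y) = h1); last first.
    by apply/funext => z; rewrite addrK.
  by move=> <-; congr (`|_|); ring.
rewrite RintegralD//.
have : \int[mu]_(y in Q) `|grid_avg k h1 y - h1 y| <= e / 2 by near: k; exact: L1.
have : \int[mu]_(y in Q) `|grid_avg k h2 y - h2 y| <= e / 2 by near: k; exact: L2.
lra.
Unshelve. all: by end_near. Qed.

Lemma grid_avgZ k (c : R) h : mu.-integrable Q (EFin \o h) ->
  forall y, grid_avg k (fun y => c * h y) y = c * grid_avg k h y.
Proof.
move=> ih y; rewrite /grid_avg /gridfun mulr_sumr; apply: eq_bigr => K _.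
have iK : mu.-integrable (cell a r K) (EFin \o h).
  by apply: integrableS ih => //; [exact: measurable_cell|exact: cell_sub].
rewrite /cell_avg (RintegralZl c (measurable_cell _ _ _) iK) !mulrA.
by congr (_ * _ * _); rewrite mulrC.
Qed.

Lemma L1gridZ (c : R) h : L1grid h -> L1grid (fun y => c * h y).
Proof.
move=> [ih Lh]; split; first exact: (integrableZl mQ c ih).
move=> e e0; have c0 : 0 < `|c| + 1 by rewrite ltr_wpDl.
near=> k.
have igk f : mu.-integrable Q (EFin \o grid_avg k f) by exact: integrable_gridfun.
have j1 := integrable_norm (integrable_subR (igk h) ih).
rewrite (@eq_Rintegral _ (LebT R n) R mu Q (fun y => `|c| * `|grid_avg k h y - h y|)); last first.
  by move=> y _; rewrite grid_avgZ// -mulrBr normrM.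
rewrite RintegralZl//.
have : \int[mu]_(y in Q) `|grid_avg k h y - h y| <= e / (`|c| + 1).
  by near: k; apply: Lh; rewrite divr_gt0.
rewrite ler_pdivlMr// mulrC; apply: le_trans; apply: ler_wpM2r; last by rewrite lerDl.
exact: Rintegral_ge0.
Unshelve. all: by end_near. Qed.

(** Says that y is off the topological boundary of W. *)
Definition loc_cst (W : set 'rV[R]_n) y := \forall z \near y, W z <-> W y.

Lemma loc_cstU W1 W2 y : loc_cst W1 y -> loc_cst W2 y -> loc_cst (W1 `|` W2) y.
Proof. by apply: filterS2 => z z1 z2; split=> -[/z1|/z2]; [left|right|left|right]. Qed.

Lemma ae_loc_cst_box (b c : 'rV[R]_n) : {ae mu, forall y, Q y -> loc_cst (box b c) y}.
Proof.
have hp i t : {ae mu, forall y : LebT R n, Q y -> (y : 'rV[R]_n) ord0 i != t}.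
  exists (Q `&` [set y | y ord0 i = t]); split.
  - apply: measurableI => //.
    by have := @measurable_coord R n i measurableT _ (measurable_set1 t); rewrite setTI.
  - by apply: lebn_box_hyperplane => j; rewrite !mxE lerDl ltW.
  - move=> y /= /not_implyP[Qy yt]; split=> //=.
    by apply/eqP; apply: contra_notT yt.
have : {ae mu, forall y : LebT R n, forall i : 'I_n, i \in enum 'I_n -> Q y ->
    ((y : 'rV[R]_n) ord0 i != b ord0 i) && ((y : 'rV[R]_n) ord0 i != c ord0 i)}.
  elim: (enum 'I_n) => [|i s ih]; first exact/aeW.
  apply: filterS2 (filterI (hp i (b ord0 i)) (hp i (c ord0 i))) ih => y [h1 h2] ys j.
  by rewrite inE => /predU1P[-> Qy|/ys]; [rewrite h1 ?h2|apply].
apply: filterS => y ybc Qy.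
have : nbhs y [set z : 'rV[R]_n | forall i, i \in enum 'I_n ->
   (b ord0 i <= z ord0 i < c ord0 i) = (b ord0 i <= y ord0 i < c ord0 i)].
  have : forall i, i \in enum 'I_n -> (y ord0 i != b ord0 i) && (y ord0 i != c ord0 i).
    by move=> i ie; exact: ybc.
  elim: (enum 'I_n) => [|i s ih] yb; first exact: filterE.
  have near_cmp t : y ord0 i != t ->
      nbhs y [set z : 'rV[R]_n | (t <= z ord0 i) = (t <= y ord0 i)].
    rewrite neq_lt => /orP[yt|ty].
      have H : nbhs y [set z : 'rV[R]_n | z ord0 i < t].
        exact: (@coord_continuous _ _ _ ord0 i y _ (lt_nbhsl yt)).
      by apply: filterS H => z /= zt; rewrite leNgt zt leNgt yt.
    have H : nbhs y [set z : 'rV[R]_n | t < z ord0 i].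
      exact: (@coord_continuous _ _ _ ord0 i y _ (lt_nbhsr ty)).
    by apply: filterS H => z /= zt; rewrite (ltW zt) (ltW ty).
  have /andP[yi1 yi2] := yb i (mem_head _ _).
  have ihs := ih (fun j js => yb j (@mem_behead _ (i :: s) j js)).
  apply: filterS2 (filterI (near_cmp _ yi1) (near_cmp _ yi2)) ihs => z [h1 h2] zs j.
  by rewrite inE => /predU1P[->|/zs//]; rewrite h1 !ltNge h2.
apply: filterS => z zy; split=> h i.
  by rewrite -zy ?mem_enum//; exact: h.
by rewrite zy ?mem_enum//; exact: h.
Qed.

(** Near a point off the boundary of W the small cells see a constant function, so the averages
    eventually equal the value exactly. They are bounded by 1, and dominated convergence applies. *)
Lemma L1grid_loc_cst (W : set (LebT R n)) : measurable W ->
  {ae mu, forall y, Q y -> loc_cst W y} -> L1grid \1_W.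
Proof.
move=> mW lW.
have iW : mu.-integrable Q (EFin \o \1_W).
  have := integrable_indicM mQ mW (@integrable_cst_cube R n a r 1 (ltW r0)).
  by apply: eq_integrable => // y _ /=; rewrite mul1r.
split=> // e e0.
have i1 : mu.-integrable Q (EFin \o cst 1) by exact: integrable_cst_cube (ltW r0).
have igk k : mu.-integrable Q (EFin \o (fun y => `|grid_avg k \1_W y - \1_W y|)).
  by apply: integrable_norm; apply: integrable_subR => //; exact: integrable_gridfun.
have ae1 : {ae mu, forall y, Q y -> (`|grid_avg k \1_W y - \1_W y|)%:E @[k --> \oo] --> 0%E}.
  move: lW; apply: filterS; first exact: (ae_filter_ringOfSetsType mu).
  move=> y lWy Qy; have [d d0 dW] := nbhs_rVP (lWy Qy).
  apply: cvg_EFin; first exact: nearW.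
  apply: cvg_near_cst; near=> k; apply/eqP; rewrite /= normr_eq0 subr_eq0; apply/eqP.
  have [K KP] := cell_index k r0 Qy; have Ky := (KP K).2 erefl.
  rewrite /grid_avg (gridfunE r0 _ Ky) /cell_avg.
  rewrite (@Rintegral_cell_cst _ _ _ _ _ r0 _ _ (\1_W y)).
    by rewrite mulKf// expf_neq0// gt_eqF// mesh_gt0.
  move=> z Kz; rewrite !indicE; suff : W z <-> W y.
    by move=> h; congr ((nat_of_bool _)%:R); apply/idP/idP; rewrite !inE => /h.
  apply: dW => i; have /cellE/(_ i)/andP[z1 z2] := Kz; have /cellE/(_ i)/andP[y1 y2] := Ky.
  apply: (@lt_trans _ _ (mesh r k)); last by near: k; exact: near_scaled_inv.
  rewrite ltr_norml; move: z1 z2 y1 y2; rewrite -!natr1 !mulrDl !mul1r => *.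
  by apply/andP; split; lra.
have bd : {ae mu, forall y k, Q y -> (`| (`|grid_avg k \1_W y - \1_W y|)%:E | <= 1%:E)%E}.
  apply/aeW => y k Qy; rewrite /= lee_fin normr_id.
  have [K KP] := cell_index k r0 Qy; have Ky := (KP K).2 erefl.
  rewrite /grid_avg (gridfunE r0 _ Ky).
  have m0 : 0 < mesh r k ^+ n by rewrite exprn_gt0// mesh_gt0.
  have A0 : 0 <= cell_avg a r \1_W K.
    by rewrite mulr_ge0 ?invr_ge0 ?(ltW m0)//; exact: Rintegral_ge0.
  have A1 : cell_avg a r \1_W K <= 1.
    rewrite /cell_avg ler_pdivrMl// mulr1.
    have <- : \int[mu]_(y in cell a r K) (cst 1 : LebT R n -> R) y = mesh r k ^+ n.
      by rewrite (@Rintegral_cell_cst _ _ _ _ _ r0 _ _ 1) ?mulr1.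
    apply: le_Rintegral => //; [exact: measurable_cell| | |].
    - by apply: integrableS iW => //; [exact: measurable_cell|exact: cell_sub].
    - by apply: integrableS i1 => //; [exact: measurable_cell|exact: cell_sub].
    - by move=> z _; rewrite indicE; case: (_ \in _).
  by rewrite indicE; case: (_ \in _) => /=; rewrite ler_norml; apply/andP; split; lra.
have [_ _ cv] := @dominated_convergence _ _ _ mu Q mQ
  (fun k y => (`|grid_avg k \1_W y - \1_W y|)%:E) (cst 0%E) (cst 1%:E)
  (fun k => measurable_int mu (igk k)) (measurable_cst _) ae1 i1 bd.
rewrite integral_cst// mul0e in cv.
exact: (cvgr_le _ (fine_cvg cv) _ e0).
Unshelve. all: by end_near. Qed.

(** As [mu] is an infimum over covers by boxes, A inside Q has a cover [Wi] exceeding it by less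
    than e / 2, and finitely many boxes [W m] exhaust [Wi] up to e / 2. Within Q the two indicators
    differ only on [Wi] minus A and on [Wi] minus [W m]. *)
Lemma L1grid_indic (A : set (LebT R n)) : measurable A -> L1grid \1_A.
Proof.
move=> mA; have iI (B : set (LebT R n)) : measurable B -> mu.-integrable Q (EFin \o \1_B).
  move=> mB; have := integrable_indicM mQ mB (@integrable_cst_cube R n a r 1 (ltW r0)).
  by apply: eq_integrable => // y _ /=; rewrite mul1r.
apply: L1grid_approx; first exact: iI.
move=> e e0; have e20 : 0 < e / 2 by rewrite divr_gt0.
have mAQ : measurable (A `&` Q) by exact: measurableI.
have AQfin : (mu (A `&` Q) < +oo)%E.
  apply: (@le_lt_trans _ _ (mu Q)); first by apply: le_outer_measure; exact: subIsetr.
  by rewrite [X in (X < _)%E](lebn_cube a (ltW r0)) ltry.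
have AQfn : mu (A `&` Q) \is a fin_num by rewrite ge0_fin_numE// measure_ge0.
have : (mu (A `&` Q) < mu (A `&` Q) + (e / 2)%:E)%E by rewrite lteDl.
move=> /ereal_inf_lt[_ [F [_ AF] <-] Fe].
have Fk k : (box_content (F k) < +oo)%E.
  rewrite ltNge leye_eq; apply/negP => /eqP Fk.
  move: Fe; rewrite (@eseries_pinfty _ _ predT k) ?ltNge ?leey// => j _.
  by rewrite gt_eqF// (lt_le_trans _ (box_content_ge0 _)).
have Fbox k : F k = set0 \/ exists b c : 'rV[R]_n, (forall i, b ord0 i <= c ord0 i) /\ F k = box b c.
  exact: box_content_lty.
have mF k : measurable (F k : set (LebT R n)).
  by have [->|[b [c [_ ->]]]] := Fbox k; [exact: measurable0|exact: measurable_box].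
have lF k : {ae mu, forall y, Q y -> loc_cst (F k) y}.
  have [->|[b [c [_ ->]]]] := Fbox k; last exact: ae_loc_cst_box.
  by apply/aeW => y _; exact: filterE.
pose W m : set (LebT R n) := \big[setU/set0]_(k < m) F k.
have mW m : measurable (W m) by apply: bigsetU_measurable => k _.
have lW m : {ae mu, forall y, Q y -> loc_cst (W m) y}.
  rewrite /W; elim: m => [|m ih].
    by rewrite big_ord0; apply/aeW => y _; exact: filterE.
  rewrite big_ord_recr/=; move: ih (lF m); apply: filterS2.
    exact: (ae_filter_ringOfSetsType mu).
  by move=> y h1 h2 Qy; apply: loc_cstU; [exact: h1|exact: h2].
pose Wi : set (LebT R n) := \bigcup_k F k.
have mWi : measurable Wi by exact: bigcupT_measurable.
have Wifin : (mu Wi < mu (A `&` Q) + (e / 2)%:E)%E.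
  apply: le_lt_trans Fe; apply: le_trans (outer_measure_sigma_subadditive (@leb_outer R n) F) _.
  apply: lee_nneseries => k *; first exact: outer_measure_ge0.
  have [->|[b [c [bc ->]]]] := Fbox k; first by rewrite box_content0 outer_measure0.
  by rewrite box_content_boxE// [X in (X <= _)%E](leb_outer_box bc).
have Wi_lty : (mu Wi < +oo)%E by rewrite (lt_trans Wifin)// lte_add_pinfty// ltry.
have Wcv : mu (W m) @[m --> \oo] --> mu Wi.
  have WiE : Wi = \bigcup_m W m.
    apply/seteqP; split=> [y [k _ Fky]|y [m _]].
      by exists k.+1 => //; rewrite /W -bigcup_mkord; exists k => /=.
    by rewrite /W -bigcup_mkord => -[k _ Fky]; exists k.
  rewrite WiE; apply: nondecreasing_cvg_mu => //; first by rewrite -WiE.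
  by move=> m1 m2 m12; apply/subsetPset; exact: subset_bigsetU.
have [m Wm] : exists m, (mu Wi - (e / 2)%:E < mu (W m))%E.
  have Wifn : mu Wi \is a fin_num by rewrite ge0_fin_numE// measure_ge0.
  rewrite -(fineK Wifn) in Wcv.
  have lt2 : fine (mu Wi) - e / 2 < fine (mu Wi) by rewrite gtrBl.
  have /filter_ex[m Wm] : \forall m \near \oo, fine (mu Wi) - e / 2 < fine (mu (W m)).
    exact: (cvgr_gt _ (fine_cvg Wcv) _ lt2).
  exists m; rewrite -(fineK Wifn) -EFinB -[ltRHS]fineK ?lte_fin//.
  rewrite ge0_fin_numE ?measure_ge0//; apply: le_lt_trans Wi_lty.
  by apply: le_outer_measure => y; rewrite /W -bigcup_mkord => -[k _ Fky]; exists k.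
exists \1_(W m); first exact: L1grid_loc_cst.
pose B1 := Wi `\` (A `&` Q); pose B2 := Wi `\` W m.
have WmWi : W m `<=` Wi by move=> y; rewrite /W -bigcup_mkord => -[k _ Fky]; exists k.
have AQWi : A `&` Q `<=` Wi by exact: AF.
have mB1 : measurable B1 by exact: measurableD.
have mB2 : measurable B2 by exact: measurableD.
have B1e : (mu B1 <= (e / 2)%:E)%E.
  rewrite [leLHS](measureD mWi mAQ Wi_lty) setIidr//.
  by rewrite leeBlDl// ltW.
have B2e : (mu B2 <= (e / 2)%:E)%E.
  rewrite [leLHS](measureD mWi (mW m) Wi_lty) setIidr//.
  have Wmfn : mu (W m) \is a fin_num.
    rewrite ge0_fin_numE ?measure_ge0//; apply: le_lt_trans Wi_lty.
    by apply: le_outer_measure.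
  by rewrite leeBlDl// -leeBlDr// ltW.
have intB (B : set (LebT R n)) : measurable B -> (mu B <= (e / 2)%:E)%E ->
    \int[mu]_(y in Q) \1_B y <= e / 2.
  move=> mB Be; rewrite /Rintegral integral_indic// -lee_fin fineK.
    by apply: le_trans Be; apply: le_outer_measure; exact: subIsetl.
  rewrite ge0_fin_numE ?measure_ge0//; apply: (@le_lt_trans _ _ (e / 2)%:E); last exact: ltry.
  by apply: le_trans Be; apply: le_outer_measure; exact: subIsetl.
apply: (@le_trans _ _ (\int[mu]_(y in Q) (\1_B1 y + \1_B2 y))).
  apply: le_Rintegral => //.
  - by apply: integrable_norm; apply: integrable_subR; exact: iI.
  - exact: (integrableD mQ (iI _ mB1) (iI _ mB2)).
  move=> y Qy; rewrite !indicE.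
  have [Ay|nAy] := pselect (A y); have [Wy|nWy] := pselect (W m y).
  - by rewrite (mem_set Ay) (mem_set Wy) subrr normr0 addr_ge0.
  - have B2y : B2 y by split=> //; exact: AQWi.
    by rewrite (mem_set Ay) (memNset nWy) (mem_set B2y) subr0 normr1 lerDr.
  - have B1y : B1 y by split; [exact: WmWi|move=> []].
    by rewrite (memNset nAy) (mem_set Wy) (mem_set B1y) sub0r normrN normr1 lerDl.
  - by rewrite (memNset nAy) (memNset nWy) subrr normr0 addr_ge0.
rewrite RintegralD//; [|exact: iI|exact: iI].
by rewrite [leRHS]splitr lerD// intB.
Qed.

Lemma L1grid_sum (I : Type) (s : seq I) (c : I -> R) (F : I -> 'rV[R]_n -> R) :
  (forall i, L1grid (F i)) -> L1grid (fun y => \sum_(i <- s) c i * F i y).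
Proof.
move=> LF; elim: s => [|i s ih].
  under eq_fun do rewrite big_nil.
  rewrite (_ : (fun=> 0) = fun y => 0 * \1_(set0 : set (LebT R n)) y).
    by apply: L1gridZ; exact: L1grid_indic.
  by apply/funext => y; rewrite mul0r.
under eq_fun do rewrite big_cons.
by apply: L1gridD => //; apply: L1gridZ.
Qed.

Import HBSimple.

Lemma grid_avg_cvg h : mu.-integrable Q (EFin \o h) ->
  forall e, 0 < e -> \forall k \near \oo, \int[mu]_(y in Q) `|grid_avg k h y - h y| <= e.
Proof.
move=> ih; suff [] : L1grid h by [].
apply: L1grid_approx => // e e0.
have [g_ [ig _ gh]] := approximation_sfun_integrable mQ ih.
have /filter_ex[m gm] : \forall m \near \oo,
    fine (\int[mu]_(z in Q) `|(h z)%:E - (g_ m z)%:E|) <= e.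
  exact: (cvgr_le _ (fine_cvg gh) _ e0).
exists (g_ m) => //.
rewrite (_ : g_ m = (fun y => \sum_(c <- finmap.enum_fset (fset_set (range (g_ m)))) c * \1_(g_ m @^-1` [set c]) y)
  :> ('rV[R]_n -> R)).
  apply: L1grid_sum => c; apply: L1grid_indic.
  by rewrite -[X in measurable X]setTI; exact: measurable_funP.
apply/funext => y; rewrite fimfunE fsbig_finite//; exact: fimfunP.
Qed.

End GridDensity.

(** * A truncated Poincare inequality *)

Section DiscretePoincare.
Variables (R : realFieldType) (n k : nat).
Notation index := {ffun 'I_n -> 'I_k.+1}.
Implicit Types (K : index) (i : 'I_n) (t : 'I_k.+1) (U F : index -> R).

Definition upd K i t : index := [ffun j => if j == i then t else K j].

Definition nextcell K i : index := upd K i (inord (K i).+1).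

Definition edge U i K : R := if ((K i).+1 < k.+1)%N then `|U (nextcell K i) - U K| else 0.

Definition line_avg i U K : R := k.+1%:R^-1 * \sum_t U (upd K i t).

Lemma upd_upd K i t t' : upd (upd K i t) i t' = upd K i t'.
Proof. by apply/ffunP => j; rewrite !ffunE; case: eqP. Qed.

Lemma upd_id K i : upd K i (K i) = K.
Proof. by apply/ffunP => j; rewrite !ffunE; case: eqP => // ->. Qed.

Lemma updE K i t : upd K i t i = t. Proof. by rewrite ffunE eqxx. Qed.

Lemma sum_upd i F : \sum_K \sum_t F (upd K i t) = k.+1%:R * \sum_K F K.
Proof.
rewrite pair_big /=.
(* Exchanging t with the i-th entry of K is an involution of the pairs; after it the summand depends
   on K alone and t merely counts. *)
pose phi (p : index * 'I_k.+1) := (upd p.1 i p.2, p.1 i).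
have phiK : involutive phi.
  by move=> [K t]; rewrite /phi /= upd_upd upd_id updE.
rewrite (reindex_inj (inv_inj phiK)) /=.
under eq_bigr do rewrite upd_upd upd_id.
rewrite -(pair_big xpredT xpredT (fun K _ => F K)) /= mulr_sumr.
by apply: eq_bigr => K _; rewrite sumr_const card_ord mulr_natl.
Qed.

Lemma dist_line_le U K i t : `|U K - U (upd K i t)| <= \sum_t' edge U i (upd K i t').
Proof.
pose u (s : nat) := U (upd K i (inord s)).
have uord (t' : 'I_k.+1) : u t' = U (upd K i t') by rewrite /u inord_val.
have ue (s : nat) : (s.+1 < k.+1)%N -> `|u s.+1 - u s| = edge U i (upd K i (inord s)).
  move=> sk; have s0 : (s < k.+1)%N := ltnW sk.
  by rewrite /edge /nextcell updE !upd_upd (inordK s0) sk.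
have tel (s1 s2 : nat) : (s1 <= s2 < k.+1)%N ->
    `|u s2 - u s1| <= \sum_(s1 <= s < s2) edge U i (upd K i (inord s)).
  move=> /andP[]; elim: s2 => [|s2 ih].
    by rewrite leqn0 => /eqP -> _; rewrite subrr normr0 big_geq.
  rewrite leq_eqVlt => /predU1P[-> _|]; first by rewrite subrr normr0 big_geq.
  rewrite ltnS => s12 s2k; rewrite big_nat_recr//= -ue//.
  rewrite (_ : u s2.+1 - u s1 = (u s2 - u s1) + (u s2.+1 - u s2)); last by ring.
  by rewrite (le_trans (ler_normD _ _))// lerD2r ih// ltnW.
have tot (s1 s2 : nat) : (s1 <= s2 < k.+1)%N -> `|u s2 - u s1| <= \sum_t' edge U i (upd K i t').
  move=> s12; apply: le_trans (tel _ _ s12) _; have /andP[s1s2 s2k] := s12.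
  have -> : \sum_t' edge U i (upd K i t') = \sum_(0 <= s < k.+1) edge U i (upd K i (inord s)).
    by rewrite big_mkord; apply: eq_bigr => t' _; rewrite inord_val.
  have e0 s : 0 <= edge U i (upd K i (inord s)) by rewrite /edge; case: ifP.
  rewrite (big_cat_nat (leq0n s1) (leq_trans s1s2 (ltnW s2k))) /=.
  rewrite (big_cat_nat s1s2 (ltnW s2k)) /=.
  by rewrite addrCA lerDl addr_ge0// sumr_ge0.
rewrite -{1}(upd_id K i) -!uord.
have [h|/ltnW h] := leqP (K i) t; last by apply: tot; rewrite h ltn_ord.
by rewrite distrC; apply: tot; rewrite h ltn_ord.
Qed.

Lemma sum_line_dev i U :
  \sum_K `|U K - line_avg i U K| <= k.+1%:R * \sum_K edge U i K.
Proof.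
rewrite -(sum_upd i); apply: ler_sum => K _.
have k0 : (0 : R) < k.+1%:R by [].
rewrite (_ : U K - line_avg i U K = k.+1%:R^-1 * \sum_t (U K - U (upd K i t))); last first.
  by rewrite sumrB sumr_const card_ord mulrBr -[U K *+ _]mulr_natl mulKf ?gt_eqF.
rewrite normrM gtr0_norm ?invr_gt0// ler_pdivrMl//.
apply: le_trans (ler_norm_sum _ _ _) _.
apply: (@le_trans _ _ (\sum_(t < k.+1) \sum_t' edge U i (upd K i t'))).
  by apply: ler_sum => t _; exact: dist_line_le.
by rewrite sumr_const card_ord mulr_natl.
Qed.

Lemma line_avgB i U F K : line_avg i U K - line_avg i F K = line_avg i (fun K => U K - F K) K.
Proof. by rewrite /line_avg -mulrBr -sumrB. Qed.

Lemma sum_norm_line_avg i U : \sum_K `|line_avg i U K| <= \sum_K `|U K|.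
Proof.
have k0 : (0 : R) < k.+1%:R by [].
rewrite -(ler_pM2l k0) -(sum_upd i (fun K => `|U K|)) mulr_sumr.
apply: ler_sum => K _; rewrite /line_avg normrM gtr0_norm ?invr_gt0// mulrA.
by rewrite divff ?gt_eqF// mul1r ler_norm_sum.
Qed.

Lemma sum_line_avg i U : \sum_K line_avg i U K = \sum_K U K.
Proof. by rewrite /line_avg -mulr_sumr sum_upd mulrA mulVf ?mul1r// gt_eqF. Qed.

Definition block_avg (s : seq 'I_n) U := foldr line_avg U s.

Lemma sum_block_avg s U : \sum_K block_avg s U K = \sum_K U K.
Proof. by elim: s => //= i s ih; rewrite sum_line_avg. Qed.

(** With B the block average already formed, U - line_avg i B is (U - line_avg i U) + line_avg i (U
    - B). Line averages contract the l1 norm, so the deviations of the single coordinates simply add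
    up. *)
Lemma sum_block_dev s U :
  \sum_K `|U K - block_avg s U K| <= \sum_(i <- s) k.+1%:R * \sum_K edge U i K.
Proof.
elim: s => [|i s ih] /=.
  by rewrite big_nil big1// => K _; rewrite subrr normr0.
rewrite big_cons; apply: le_trans (lerD (sum_line_dev i U) ih).
apply: le_trans (lerD (lexx _) (sum_norm_line_avg i (fun K => U K - block_avg s U K))).
rewrite -big_split/=; apply: ler_sum => K _; rewrite -line_avgB.
by rewrite (le_trans _ (ler_normD _ _))// addrA subrK.
Qed.

Lemma block_avg_local s U K K' : (forall j, j \notin s -> K j = K' j) ->
  block_avg s U K = block_avg s U K'.
Proof.
elim: s K K' => [|i s ih] K K' KK' /=.
  by congr U; apply/ffunP => j; exact: KK'.
congr (_ * _); apply: eq_bigr => t _; apply: ih => j js; rewrite !ffunE.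
by case: eqP => // /eqP ji; apply: KK'; rewrite inE negb_or ji.
Qed.

(** Averaging over all coordinates in turn leaves a constant, and each average preserves the sum, so
    this constant is the mean. The factor k + 1 is the number of cells along a side; multiplied by
    the mesh it becomes the side length. *)
Lemma discrete_poincare U :
  \sum_K `|U K - (k.+1%:R ^+ n)^-1 * \sum_K' U K'| <= k.+1%:R * \sum_i \sum_K edge U i K.
Proof.
set m := _^-1 * _; pose A := block_avg (enum 'I_n) U.
have AE K : A K = m.
  have cst K' : A K' = A K by apply: block_avg_local => j; rewrite mem_enum.
  rewrite /m -(sum_block_avg (enum 'I_n)) -/A (eq_bigr (fun=> A K)) => [|K' _]; last exact: cst.
  rewrite sumr_const card_ffun !card_ord -natrX mulrnAr -mulrnAl -[_^-1 *+ _]mulr_natl.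
  by rewrite divff ?mul1r// pnatr_eq0 -lt0n expn_gt0.
have := sum_block_dev (enum 'I_n) U; rewrite [leRHS]big_enum -mulr_sumr /=.
by under eq_bigr do rewrite -/A AE.
Qed.

End DiscretePoincare.

Lemma ler_dist_min (R : realDomainType) (x y s : R) :
  `|Num.min x s - Num.min y s| <= `|x - y|.
Proof.
wlog xy : x y / x <= y.
  move=> h; have [/h//|/ltW/h] := leP x y.
  by rewrite distrC [leRHS]distrC.
have mxy : Num.min x s <= Num.min y s by rewrite le_min !ge_min xy lexx !orbT.
rewrite distrC [leRHS]distrC !ger0_norm ?subr_ge0//.
have [ys|sy] := leP y s.
  by rewrite [Num.min x s]min_l// (le_trans xy).
have [xs|sx] := leP x s; first by rewrite lerD2r ltW.
by rewrite subrr subr_ge0.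
Qed.

(** Serves [cell_edge_bound], with q = A / s, M the volume of a cell and m the mesh: the deviations
    x and x' of a common value w from the two cell values are absorbed into the gradient integrals I
    and I'. *)
Lemma absorb_slack (R : realFieldType) (q M m I I' h h' p p' x x' : R) :
  q * (M * (x + x')) <= q * (m * (I + I')) -> 0 <= q * (m * (I + I')) ->
  (h + q * (p + M * x)) + (h' + q * (p' + M * x')) <=
  (h + q * p + 2 * q * m * I) + (h' + q * p' + 2 * q * m * I').
Proof. by move=> *; lra. Qed.

(** * From the grid to the truncated inequality on a cube *)

Section TruncatedPoincare.
Variables (R : realType) (n d : nat) (Omega : set 'rV[R]_n).
Variables (f : 'rV[R]_n -> 'rV[R]_d) (Df : 'I_d -> 'I_n -> 'rV[R]_n -> R).
Variables (a : 'rV[R]_n) (r e0 s : R) (c : 'rV[R]_d).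
Notation mu := (@lebn R n).
Hypotheses (oO : open Omega) (Wf : W11loc Omega f Df) (r0 : 0 < r) (e00 : 0 < e0) (s0 : 0 < s).
Hypothesis CO : closed_box (a - const_mx e0) (a + const_mx r) `<=` Omega.
Let Q : set (LebT R n) := cube a r.
Let mQ : measurable Q. Proof. exact: measurable_cube. Qed.
Let f_ j : LebT R n -> R := fun y => f y ord0 j.

Definition grad_sum (y : 'rV[R]_n) : R := \sum_j \sum_i `|Df j i y|.
Let G : LebT R n -> R := grad_sum.
Let F : LebT R n -> R := fun y => enorm (f y - c).
Let V (k : nat) (K : {ffun 'I_n -> 'I_k.+1}) : 'rV[R]_d := \row_j @cell_avg R n a r k (f_ j) K.
Let W (k : nat) (K : {ffun 'I_n -> 'I_k.+1}) : R := enorm (V K - c).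

Lemma integrable_sub_box (v : 'rV[R]_n -> R) : loc_integrable Omega v -> mu.-integrable Q (EFin \o v).
Proof.
move=> lv; have QO : Q `<=` closed_box (a - const_mx e0) (a + const_mx r).
  move=> y /cubeE Qy j; have /andP[h1 /ltW h2] := Qy j.
  by rewrite !mxE h2 andbT (le_trans _ h1)// gerBl ltW.
apply: (integrableS (measurable_closed_box _ _) mQ QO).
by apply: lv => //; exact: compact_closed_box.
Qed.

Let if_ j : mu.-integrable Q (EFin \o f_ j).
Proof. by have [+ _ _] := Wf => /(_ j); exact: integrable_sub_box. Qed.

Let iD j i : mu.-integrable Q (EFin \o Df j i).
Proof. by have [_ + _] := Wf => /(_ j i); exact: integrable_sub_box. Qed.

Lemma integrable_grad_sum : mu.-integrable Q (EFin \o G).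
Proof.
by apply: integrable_sumR => // j _; apply: integrable_sumR => // i _; exact: integrable_norm.
Qed.

Let iG := integrable_grad_sum.

Let G0 y : 0 <= G y.
Proof. by apply: sumr_ge0 => j _; exact: sumr_ge0. Qed.

Lemma measurable_dist : measurable_fun Q F.
Proof.
apply: (measurableT_comp (f := @Num.sqrt R)).
  by apply: continuous_measurable_fun; exact: sqrt_continuous.
apply: measurable_sum => j; apply: measurable_funX.
under eq_fun do rewrite !mxE.
have mf : measurable_fun Q (f_ j) by apply/measurable_EFinP; exact: measurable_int (if_ j).
exact: (measurable_funB mf (measurable_cst _)).
Qed.

Let mF := measurable_dist.

Let iF : mu.-integrable Q (EFin \o F).
Proof.
apply: (@le_integrable _ _ _ mu Q mQ _ (EFin \o (fun y => \sum_j (`|f_ j y| + `|c ord0 j|)))).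
- exact/measurable_EFinP.
- move=> y _; rewrite /= lee_fin (ger0_norm (enorm_ge0 _)).
  apply: le_trans (enorm_le_sum _) _; apply: le_trans (ler_norm _).
  apply: ler_sum => j _; rewrite !mxE.
  exact: ler_normB.
apply: integrable_sumR => // j _.
exact: (integrableD mQ (integrable_norm (if_ j))
  (@integrable_cst_cube R n a r `|c ord0 j| (ltW r0))).
Qed.

Let mG : measurable_fun Q G.
Proof. by apply/measurable_EFinP; exact: measurable_int iG. Qed.

Definition low_set : set (LebT R n) := Q `&` [set y | F y < 2 * s].
Definition steep_set (A : R) : set (LebT R n) := Q `&` [set y | A < G y].

Lemma measurable_low_set : measurable low_set.
Proof.
have := mF mQ (measurable_itv `]-oo, (2 * s)[).
by rewrite (_ : _ @^-1` _ = [set y | F y < 2 * s])//; apply/seteqP; split=> y; rewrite /= in_itv.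
Qed.

Lemma measurable_steep_set A : measurable (steep_set A).
Proof.
have := mG mQ (measurable_itv `]A, +oo[).
by rewrite (_ : _ @^-1` _ = [set y | A < G y])//; apply/seteqP; split=> y; rewrite /= in_itv/= andbT.
Qed.

Let H A : LebT R n -> R := fun y => G y * \1_low_set y + G y * \1_(steep_set A) y.

Let iH A : mu.-integrable Q (EFin \o H A).
Proof.
exact: (integrableD mQ (integrable_indicM mQ measurable_low_set iG)
  (integrable_indicM mQ (measurable_steep_set A) iG)).
Qed.

Let H0 A y : 0 <= H A y.
Proof. by rewrite addr_ge0// mulr_ge0// indicE; case: (_ \in _). Qed.

Let subcell k K (h : LebT R n -> R) : mu.-integrable Q (EFin \o h) ->
  mu.-integrable (@cell R n a r k K) (EFin \o h).
Proof.
by apply: integrableS => //; [exact: measurable_cell|exact: cell_sub].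
Qed.

Let iWF k K w : mu.-integrable (@cell R n a r k K) (EFin \o (fun y => `|w - F y|)).
Proof.
apply: subcell; apply: integrable_norm; apply: (integrable_subR (h1 := fun=> w)) => //.
exact: (@integrable_cst_cube _ _ _ _ _ (ltW r0)).
Qed.

(* If w < s <= F - s and G <= A, then |w - F| >= s and hence G <= A / s * |w - F|. *)
Lemma cell_grad_bound k K A w : 0 <= A -> w < s ->
  \int[mu]_(y in @cell R n a r k K) G y <= \int[mu]_(y in cell a r K) H A y +
   A / s * \int[mu]_(y in cell a r K) `|w - F y|.
Proof.
move=> A0 ws.
rewrite -RintegralZl//; [|exact: measurable_cell].
have iZ : mu.-integrable (@cell R n a r k K) (EFin \o (fun y => A / s * `|w - F y|)).
  exact: (integrableZl (measurable_cell _ _ _) (A / s) (iWF K w)).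
rewrite -RintegralD//; [|exact: measurable_cell|exact: subcell].
apply: le_Rintegral => //; [exact: measurable_cell|exact: subcell| |].
  have mK : measurable (@cell R n a r k K) := measurable_cell a r K.
  exact: (integrableD mK (@subcell k K _ (iH A)) iZ).
move=> y Ky; have Qy : Q y by exact: cell_sub Ky.
have As0 : 0 <= A / s by rewrite divr_ge0// ltW.
have i0 (B : set (LebT R n)) : 0 <= G y * \1_B y.
  by rewrite mulr_ge0// indicE; case: (_ \in _).
have w0 : 0 <= A / s * `|w - F y| by rewrite mulr_ge0.
have [Fy|Fy] := ltP (F y) (2 * s).
  have Ly : low_set y by [].
  have := i0 (steep_set A); rewrite /H [\1_low_set y]indicE (mem_set Ly) mulr1; lra.
have [Gy|Gy] := ltP A (G y).
  have Sy : steep_set A y by [].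
  have := i0 low_set; rewrite /H [\1_(steep_set A) y]indicE (mem_set Sy) mulr1; lra.
apply: (le_trans Gy); apply: ler_wpDl => //.
apply: (@le_trans _ _ (A / s * s)); first by rewrite divfK ?gt_eqF.
by rewrite ler_wpM2l// distrC (le_trans _ (ler_norm _))//; lra.
Qed.

Lemma cell_corner_next k (K : {ffun 'I_n -> 'I_k.+1}) i : ((K i).+1 < k.+1)%N ->
  cell_corner a r (nextcell K i) = cell_corner a r K + mesh r k *: delta_mx ord0 i.
Proof.
move=> Ki; apply/rowP => j; rewrite !mxE eqxx/= !ffunE -addrA; congr (_ + _).
case: eqP => [->|_]; last by rewrite mulr0 addr0.
by rewrite inordK// -natr1 mulrDl mul1r mulr1.
Qed.

Lemma cell_avg_next_diff k (K : {ffun 'I_n -> 'I_k.+1}) i j : ((K i).+1 < k.+1)%N ->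
  mesh r k ^+ n * `|cell_avg a r (f_ j) (nextcell K i) - cell_avg a r (f_ j) K| <=
  mesh r k * (\int[mu]_(y in cell a r K) `|Df j i y| +
              \int[mu]_(y in cell a r (nextcell K i)) `|Df j i y|).
Proof.
move=> Ki; have m0 : 0 < mesh r k by exact: mesh_gt0.
have mn0 : 0 < mesh r k ^+ n by rewrite exprn_gt0.
have [lf lD wD] := Wf.
have nE : cell a r (nextcell K i) = cube (cell_corner a r K + mesh r k *: delta_mx ord0 i) (mesh r k).
  by rewrite /cell cell_corner_next.
have CC : closed_box (cell_corner a r K - const_mx e0)
    (cell_corner a r K + const_mx (mesh r k) + mesh r k *: delta_mx ord0 i) `<=` Omega.
  apply: subset_trans CO => y yC l; have /andP[] := yC l; rewrite !mxE eqxx/= => h1 h2.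
  apply/andP; split.
    by apply: le_trans h1; rewrite lerD2r lerDl mulr_ge0// ltW.
  apply: (le_trans h2); rewrite -addrA -addrA lerD2l -[leRHS](meshE r k).
  case: eqP h2 => [->|_] _.
    rewrite mulr1; have : ((K i).+2%:R : R) <= k.+1%:R by rewrite ler_nat.
    rewrite -!natr1 => h; rewrite -(ler_pM2r m0) in h; lra.
  rewrite mulr0 addr0; have : ((K l).+1%:R : R) <= k.+1%:R by rewrite ler_nat.
  rewrite -!natr1 => h; rewrite -(ler_pM2r m0) in h; lra.
have := cube_shift_diff m0 e00 oO CC (lf j) (lD j i) (fun phi tphi => wD phi tphi j i).
rewrite -nE -/(cell a r K) => cs.
rewrite /cell_avg -mulrBr normrM gtr0_norm ?invr_gt0// mulrA divff ?gt_eqF// mul1r.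
apply: (le_trans cs); rewrite ler_pM2l// Rintegral_setU//; [exact: measurable_cell|exact: measurable_cell| |].
  have mU : measurable (cell a r K `|` cell a r (nextcell K i) : set (LebT R n)).
    by apply: measurableU; exact: measurable_cell.
  apply: (integrableS mQ mU); last exact: integrable_norm.
  by move=> y [|]; exact: cell_sub.
apply/disj_setPS => y [Ky nKy]; have [K0 K0P] := cell_index k r0 (cell_sub r0 Ky).
have := (K0P _).1 Ky; rewrite -((K0P _).1 nKy) => /ffunP/(_ i)/(congr1 val).
rewrite /nextcell updE /= inordK// => /eqP; rewrite ?(ltn_eqF (ltnSn _)) ?(gtn_eqF (ltnSn _)) //.
Qed.

Lemma cell_vec_next_diff k (K : {ffun 'I_n -> 'I_k.+1}) i : ((K i).+1 < k.+1)%N ->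
  mesh r k ^+ n * enorm (V (nextcell K i) - V K) <=
  mesh r k * (\int[mu]_(y in cell a r K) G y + \int[mu]_(y in cell a r (nextcell K i)) G y).
Proof.
move=> Ki; have m0 : 0 < mesh r k by exact: mesh_gt0.
have mn0 : 0 < mesh r k ^+ n by rewrite exprn_gt0.
have GE K' : \sum_j \int[mu]_(y in @cell R n a r k K') `|Df j i y| <=
    \int[mu]_(y in cell a r K') G y.
  rewrite -Rintegral_sum//; [|exact: measurable_cell|].
    apply: le_Rintegral => //; [exact: measurable_cell| |exact: subcell|].
      apply: subcell; apply: integrable_sumR => // j _; exact: integrable_norm.
    move=> y _; apply: ler_sum => j _.
    by rewrite [leRHS](bigD1 i)//= lerDl sumr_ge0.
  by move=> j _; apply: subcell; exact: integrable_norm.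
apply: (@le_trans _ _ (\sum_j mesh r k * (\int[mu]_(y in cell a r K) `|Df j i y| +
              \int[mu]_(y in cell a r (nextcell K i)) `|Df j i y|))); last first.
  by rewrite -mulr_sumr big_split/= ler_pM2l// lerD.
apply: (@le_trans _ _ (mesh r k ^+ n * \sum_j `|(V (nextcell K i) - V K) ord0 j|)).
  by rewrite ler_pM2l// enorm_le_sum.
rewrite mulr_sumr; apply: ler_sum => j _; rewrite !mxE; exact: cell_avg_next_diff.
Qed.

(** The share of one cell in the bound for its edges. The last term pays for comparing F with the
    value of the cell itself instead of that of its neighbour; its factor [mesh r k] makes it vanish
    on fine grids. *)
Let Z k (A : R) (K : {ffun 'I_n -> 'I_k.+1}) : R := \int[mu]_(y in cell a r K) H A y +
   A / s * \int[mu]_(y in cell a r K) `|W K - F y| +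
   2 * (A / s) * mesh r k * \int[mu]_(y in cell a r K) G y.

Let Z0 k A K : 0 <= A -> 0 <= @Z k A K.
Proof.
move=> A0; have m0 : 0 < mesh r k by exact: mesh_gt0.
have As0 : 0 <= A / s by rewrite divr_ge0// ltW.
have := @Rintegral_ge0 _ _ _ mu (@cell R n a r k K) (H A) (fun y _ => H0 A y).
have := @Rintegral_ge0 _ _ _ mu (@cell R n a r k K) G (fun y _ => G0 y).
have := @Rintegral_ge0 _ _ _ mu (@cell R n a r k K) (fun y => `|W K - F y|) (fun y _ => normr_ge0 _).
move=> h1 h2 h3; apply: addr_ge0; first by rewrite addr_ge0// mulr_ge0.
by rewrite mulr_ge0// mulr_ge0 ?(ltW m0)// mulr_ge0.
Qed.

(* An edge contributes only if W < s at one of its endpoints. *)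
Lemma cell_edge_bound k A (K : {ffun 'I_n -> 'I_k.+1}) i : 0 <= A -> ((K i).+1 < k.+1)%N ->
  mesh r k ^+ n * `|Num.min (W (nextcell K i)) s - Num.min (W K) s| <=
  mesh r k * (Z A K + Z A (nextcell K i)).
Proof.
move=> A0 Ki; have m0 : 0 < mesh r k by exact: mesh_gt0.
have mn0 : 0 < mesh r k ^+ n by rewrite exprn_gt0.
have As0 : 0 <= A / s by rewrite divr_ge0// ltW.
have RHS0 : 0 <= mesh r k * (Z A K + Z A (nextcell K i)).
  by rewrite mulr_ge0 ?(ltW m0)// addr_ge0// Z0.
set K1 := nextcell K i in RHS0 *.
have WW : `|W K1 - W K| <= enorm (V K1 - V K).
  rewrite /W (le_trans (ler_dist_enorm _ _))//.
  by rewrite opprB addrA subrK.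
have VV := cell_vec_next_diff Ki; rewrite -/K1 in VV.
clearbody K1.
have minl := ler_dist_min (W K1) (W K) s.
have main (w : R) (K' : {ffun 'I_n -> 'I_k.+1}) : w < s ->
    \int[mu]_(y in cell a r K') G y <= \int[mu]_(y in cell a r K') H A y +
    A / s * (\int[mu]_(y in cell a r K') `|W K' - F y| + mesh r k ^+ n * `|w - W K'|).
  move=> ws; apply: le_trans (cell_grad_bound K' A0 ws) _.
  rewrite lerD2l ler_wpM2l//.
  have cK' : mu.-integrable (cell a r K') (EFin \o (cst `|w - W K'| : LebT R n -> R)).
    by apply: subcell; exact: (@integrable_cst_cube _ _ _ _ _ (ltW r0)).
  rewrite -(@Rintegral_cell_cst R n a r k r0 (fun=> `|w - W K'|) K' `|w - W K'|)//.
  rewrite -RintegralD//; last exact: measurable_cell.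
  apply: le_Rintegral => //; first exact: measurable_cell.
    have mK' : measurable (@cell R n a r k K') := measurable_cell a r K'.
    exact: (integrableD mK' (@iWF k K' (W K')) cK').
  move=> y _; rewrite [leRHS]addrC; have := ler_normD (w - W K') (W K' - F y).
  by rewrite addrA subrK.
(* A value below s at one endpoint serves as w for both cells. Its distance to the other cell value
   is the jump across the edge, which [VV] bounds by the two gradient integrals times a power of the
   mesh. *)
have key (w : R) : w < s -> `|w - W K| + `|w - W K1| <= `|W K1 - W K| ->
  \int[mu]_(y in cell a r K) G y + \int[mu]_(y in cell a r K1) G y <= Z A K + Z A K1.
  move=> ws wW; have h1 := main w K ws; have h2 := main w K1 ws.
  set IK := \int[mu]_(y in cell a r K) G y in h1 VV *.
  set IK1 := \int[mu]_(y in cell a r K1) G y in h2 VV *.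
  have h3 : mesh r k ^+ n * (`|w - W K| + `|w - W K1|) <= mesh r k * (IK + IK1).
    by apply: le_trans VV; rewrite ler_pM2l// (le_trans wW).
  have h4 : A / s * (mesh r k ^+ n * (`|w - W K| + `|w - W K1|)) <=
      A / s * (mesh r k * (IK + IK1)) by rewrite ler_wpM2l.
  have I0 : 0 <= A / s * (mesh r k * (IK + IK1)).
    by rewrite mulr_ge0// mulr_ge0 ?(ltW m0)// addr_ge0// Rintegral_ge0.
  apply: le_trans (lerD h1 h2) _; rewrite /Z -/IK -/IK1.
  exact: absorb_slack h4 I0.
have fin : \int[mu]_(y in cell a r K) G y + \int[mu]_(y in cell a r K1) G y <= Z A K + Z A K1 ->
  mesh r k ^+ n * `|Num.min (W K1) s - Num.min (W K) s| <= mesh r k * (Z A K + Z A K1).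
  move=> h; apply: (@le_trans _ _ (mesh r k *
    (\int[mu]_(y in cell a r K) G y + \int[mu]_(y in cell a r K1) G y))).
    by apply: le_trans VV; rewrite ler_pM2l// (le_trans minl).
  by rewrite ler_pM2l.
have d1 (p q : R) : `|p - p| + `|p - q| <= `|q - p| by rewrite subrr normr0 add0r distrC.
have d2 (p q : R) : `|q - p| + `|q - q| <= `|q - p| by rewrite subrr normr0 addr0.
have d3 (p q x y : R) : s <= p -> s <= q -> 0 <= y ->
    x * `|Num.min p s - Num.min q s| <= y.
  by move=> sp sq y0; rewrite !min_r// subrr normr0 mulr0.
have lt_or p : (p < s) \/ (s <= p) by case: (ltP p s); [left|right].
have [WK|WK] := lt_or (W K); first exact: (fin (key _ WK (d1 _ _))).
have [WK1|WK1] := lt_or (W K1); first exact: (fin (key _ WK1 (d2 _ _))).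
exact: d3 WK1 WK RHS0.
Qed.

Let err (k : nat) : R := \sum_j \int[mu]_(y in Q) `|grid_avg a r k (f_ j) y - f_ j y|.

Let perr (k : nat) : LebT R n -> R := fun y => \sum_j `|grid_avg a r k (f_ j) y - f_ j y|.

Let igf k j : mu.-integrable Q (EFin \o (fun y => `|grid_avg a r k (f_ j) y - f_ j y|)).
Proof.
apply: integrable_norm; apply: integrable_subR; last exact: if_.
exact: integrable_gridfun.
Qed.

Let iperr k : mu.-integrable Q (EFin \o perr k).
Proof. by apply: integrable_sumR => // j _; exact: igf. Qed.

Let errE k : err k = \int[mu]_(y in Q) perr k y.
Proof. by rewrite Rintegral_sum// => j _; exact: igf. Qed.

Let perr_bound k K y : @cell R n a r k K y -> `|W K - F y| <= perr k y.
Proof.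
move=> Ky; rewrite (le_trans (ler_dist_enorm _ _))// opprB addrA subrK.
apply: le_trans (enorm_le_sum _) _; apply: ler_sum => j _; rewrite !mxE.
by rewrite /grid_avg (gridfunE r0 _ Ky).
Qed.

Lemma sum_cell_edge k A : 0 <= A ->
  \sum_i \sum_(K : {ffun 'I_n -> 'I_k.+1})
    mesh r k ^+ n * edge (fun K => Num.min (W K) s) i K <=
  2 * n%:R * mesh r k * \sum_K @Z k A K.
Proof.
move=> A0; have m0 : 0 < mesh r k by exact: mesh_gt0.
apply: (@le_trans _ _ (\sum_(i < n) 2 * mesh r k * \sum_K @Z k A K)); last first.
  by rewrite sumr_const card_ord -[_ *+ n]mulr_natl !mulrA [2 * n%:R]mulrC.
apply: ler_sum => i _.
(* The cyclic shift agrees with the next cell except at the last one, where there is no edge. Unlike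
   the shift to the next cell it is a bijection, so the sum over the far endpoints can be reindexed;
   the added wrap-around terms are nonnegative. *)
pose cyc (K : {ffun 'I_n -> 'I_k.+1}) := upd K i (ordS (K i)).
have cyc_inj : injective cyc.
  move=> K K' /ffunP E; apply/ffunP => j; have [->|ji] := eqVneq j i.
    by have := E i; rewrite !updE => /(can_inj (@ordSK _)).
  by have := E j; rewrite !ffunE (negbTE ji).
have cycE (K : {ffun 'I_n -> 'I_k.+1}) : ((K i).+1 < k.+1)%N -> nextcell K i = cyc K.
  move=> Ki; apply/ffunP => j; rewrite !ffunE; case: eqP => // _.
  by apply/val_inj; rewrite /= inordK// modn_small.
have -> : 2 * mesh r k * \sum_K @Z k A K = \sum_K mesh r k * (Z A K + Z A (cyc K)).
  have e : \sum_K Z A (cyc K) = \sum_K @Z k A K by rewrite [RHS](reindex_inj cyc_inj).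
  have e2 : \sum_K (Z A K + Z A (cyc K)) = \sum_K @Z k A K + \sum_K @Z k A K.
    by rewrite -{2}e; exact: big_split.
  have e3 (x y : R) : 2 * x * y = x * (y + y) by ring.
  by rewrite -mulr_sumr e2 e3.
apply: ler_sum => K _; rewrite /edge; case: ifP => [Ki|_].
  by rewrite -cycE//; exact: cell_edge_bound.
by rewrite mulr0 mulr_ge0 ?(ltW m0)// addr_ge0// Z0.
Qed.

Lemma sum_cell_Z k A : 0 <= A -> \sum_K @Z k A K <=
  \int[mu]_(y in low_set) G y + \int[mu]_(y in steep_set A) G y + A / s * err k +
  2 * (A / s) * mesh r k * \int[mu]_(y in Q) G y.
Proof.
move=> A0; have As0 : 0 <= A / s by rewrite divr_ge0// ltW.
rewrite !big_split/= -!mulr_sumr -(Rintegral_cells _ r0 (iH A)) -(Rintegral_cells _ r0 iG).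
rewrite lerD2r; apply: lerD.
  rewrite (RintegralD mQ (integrable_indicM mQ measurable_low_set iG)
    (integrable_indicM mQ (measurable_steep_set A) iG)).
  by rewrite !Rintegral_indicM_sub//; exact: subIsetl.
rewrite ler_wpM2l// errE (Rintegral_cells k r0 (iperr k)); apply: ler_sum => K _.
apply: le_Rintegral.
- exact: measurable_cell.
- exact: (@iWF k K (W K)).
- exact: (@subcell k K _ (iperr k)).
- by move=> y Ky; exact: perr_bound.
Qed.

Let u : LebT R n -> R := fun y => Num.min (F y) s.

Lemma integrable_trunc : mu.-integrable Q (EFin \o u).
Proof.
apply: (@le_integrable _ _ _ mu Q mQ _ (EFin \o F)) => //.
  by apply/measurable_EFinP; apply: measurable_minr.
move=> y _; rewrite /= lee_fin (ger0_norm (enorm_ge0 _)) ger0_norm; first by rewrite ge_min lexx.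
by rewrite le_min enorm_ge0 ltW.
Qed.

Let iu := integrable_trunc.

(** One [err k] is the L1 distance of the truncation u to its grid version [gU], the other bounds
    the difference of their means; what remains is the discrete inequality for the truncated cell
    values. *)
Lemma trunc_mean_osc_grid k A : 0 <= A ->
  \int[mu]_(y in Q) `|u y - (r ^+ n)^-1 * \int[mu]_(z in Q) u z| <=
  2 * err k + 2 * n%:R * r * (\int[mu]_(y in low_set) G y + \int[mu]_(y in steep_set A) G y +
   A / s * err k + 2 * (A / s) * mesh r k * \int[mu]_(y in Q) G y).
Proof.
move=> A0; have m0 : 0 < mesh r k by exact: mesh_gt0.
have mn0 : 0 < mesh r k ^+ n by rewrite exprn_gt0.
have rn0 : 0 < r ^+ n by rewrite exprn_gt0.
have kr : k.+1%:R * mesh r k = r by exact: meshE.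
have k0 : (0 : R) < k.+1%:R ^+ n by rewrite exprn_gt0.
set m := _^-1 * _.
pose U (K : {ffun 'I_n -> 'I_k.+1}) := Num.min (W K) s.
pose mk := (k.+1%:R ^+ n)^-1 * \sum_K U K.
pose gU := gridfun a r U.
have icst (w : R) : mu.-integrable Q (EFin \o (fun=> w)) := @integrable_cst_cube R n a r w (ltW r0).
have [igU IgU] : mu.-integrable Q (EFin \o gU) /\ \int[mu]_(y in Q) gU y = mesh r k ^+ n * \sum_K U K.
  by apply: Rintegral_gridwise => // K y Ky; rewrite /gU (gridfunE r0 _ Ky).
have [i2 I2] : mu.-integrable Q (EFin \o (fun y => `|gU y - mk|)) /\
    \int[mu]_(y in Q) `|gU y - mk| = mesh r k ^+ n * \sum_K `|U K - mk|.
  by apply: Rintegral_gridwise => // K y Ky; rewrite /gU (gridfunE r0 _ Ky).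
have iugU := integrable_subR iu igU.
have i1 : mu.-integrable Q (EFin \o (fun y => `|u y - gU y|)) := integrable_norm iugU.
have I1 : \int[mu]_(y in Q) `|u y - gU y| <= err k.
  rewrite errE; apply: le_Rintegral => // y Qy.
  have [K KP] := cell_index k r0 Qy; have Ky := (KP K).2 erefl.
  apply: le_trans (perr_bound Ky); rewrite /gU (gridfunE r0 _ Ky) /u /U.
  by rewrite distrC ler_dist_min.
have I3 : r ^+ n * `|mk - m| <= err k.
  have -> : r ^+ n * `|mk - m| = `|\int[mu]_(y in Q) (u y - gU y)|.
    rewrite RintegralB// IgU -[X in X * `|_|]gtr0_norm// -normrM distrC; congr `|_|.
    have e1 : r ^+ n * mk = mesh r k ^+ n * \sum_K U K.
      by rewrite /mk -{1}kr exprMn mulrACA mulfV ?mul1r// gt_eqF.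
    have e2 : r ^+ n * m = \int[mu]_(y in Q) u y.
      by rewrite /m mulrA mulfV ?mul1r// gt_eqF.
    by rewrite mulrBr e1 e2.
  by apply: le_trans I1; exact: le_normr_Rintegral.
apply: (@le_trans _ _ (\int[mu]_(y in Q) (`|u y - gU y| + (`|gU y - mk| + `|mk - m|)))).
  apply: le_Rintegral => //.
  - by apply: integrable_norm; exact: integrable_subR.
  - exact: (integrableD mQ i1 (integrableD mQ i2 (icst _))).
  move=> y _; rewrite (_ : u y - m = (u y - gU y) + ((gU y - mk) + (mk - m))); last by ring.
  by rewrite (le_trans (ler_normD _ _))// lerD2l ler_normD.
rewrite RintegralD//; last exact: (integrableD mQ i2 (icst _)).
rewrite RintegralD// Rintegral_cst// [X in fine X](lebn_cube a (ltW r0)) [fine _]/=.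
(* The factor k + 1 of the discrete inequality meets the factor [mesh r k] of [sum_cell_edge], and
   their product is r. *)
have I2' : \int[mu]_(y in Q) `|gU y - mk| <= 2 * n%:R * r * \sum_K @Z k A K.
  rewrite I2; apply: (@le_trans _ _ (mesh r k ^+ n * (k.+1%:R * \sum_i \sum_K edge U i K))).
    by rewrite ler_pM2l//; exact: discrete_poincare.
  have := sum_cell_edge k A0; under eq_bigr do rewrite -mulr_sumr; rewrite -mulr_sumr.
  rewrite -(@ler_pM2l _ k.+1%:R)// => h.
  rewrite -[X in _ * X * \sum_K _]kr; move: h; rewrite -/U; lra.
have := sum_cell_Z k A0; have nr0 : 0 <= 2 * n%:R * r by rewrite mulr_ge0 ?(ltW r0)// mulr_ge0.
move=> /(ler_wpM2l nr0) hZ; rewrite [`|mk - m| * _]mulrC; lra.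
Qed.

Lemma err_cvg0 : err k @[k --> \oo] --> (0 : R).
Proof.
have -> : (0 : R) = \sum_(j < d) 0 by rewrite big1.
apply: cvg_big => [|j _]; first exact: add_continuous.
apply/cvgr0Pnorm_le => e e0'; have := grid_avg_cvg r0 (if_ j) e0'.
by apply: filterS => k; rewrite ger0_norm// Rintegral_ge0.
Qed.

(** No chain rule for the truncation is used. With A fixed, refining the grid removes the terms
    carrying A / s; letting A tend to infinity afterwards removes the integral over [steep_set A].
    The gap between s and 2 s is what keeps cells with a value below s at a distance from points
    outside [low_set]. *)
Lemma truncated_poincare :
  \int[mu]_(y in (cube a r : set (LebT R n)))
    `|Num.min (enorm (f y - c)) s -
      (r ^+ n)^-1 * \int[mu]_(z in (cube a r : set (LebT R n))) Num.min (enorm (f z - c)) s| <=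
  2 * n%:R * r * \int[mu]_(y in low_set) grad_sum y.
Proof.
have stepA A : 0 <= A -> \int[mu]_(y in Q) `|u y - (r ^+ n)^-1 * \int[mu]_(z in Q) u z| <=
    2 * n%:R * r * (\int[mu]_(y in low_set) G y + \int[mu]_(y in steep_set A) G y).
  move=> A0.
  have cv : 2 * err k + 2 * n%:R * r * (\int[mu]_(y in low_set) G y + \int[mu]_(y in steep_set A) G y +
   A / s * err k + 2 * (A / s) * mesh r k * \int[mu]_(y in Q) G y) @[k --> \oo] -->
   2 * 0 + 2 * n%:R * r * (\int[mu]_(y in low_set) G y + \int[mu]_(y in steep_set A) G y +
   A / s * 0 + 2 * (A / s) * (r * 0) * \int[mu]_(y in Q) G y).
    apply: cvgD; first exact: (cvgM (cvg_cst _) err_cvg0).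
    apply: cvgM; first exact: cvg_cst.
    apply: cvgD; first apply: cvgD; first exact: cvg_cst.
      exact: (cvgM (cvg_cst _) err_cvg0).
    apply: cvgM; last exact: cvg_cst.
    apply: cvgM; first exact: cvg_cst.
    by apply: cvgM; [exact: cvg_cst|exact: cvg_harmonic].
  rewrite !(mulr0, mul0r, addr0, add0r) in cv.
  apply: (ler_cvg_to (cvg_cst _) cv); apply: nearW => k; exact: trunc_mean_osc_grid.
have tail0 y : Q y -> G y * \1_(steep_set k%:R) y @[k --> \oo] --> (0 : R).
  move=> _; apply: cvg_near_cst; near=> k; rewrite indicE memNset ?mulr0// => -[_ /=].
  by apply/negP; rewrite -leNgt; near: k; exact: nbhs_infty_ger.
have tail_bd k y : Q y -> `|G y * \1_(steep_set k%:R) y| <= G y.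
  by move=> _; rewrite normrM ger0_norm// ler_piMr// indicE; case: (_ \in _); rewrite ?normr1 ?normr0.
have [_ tail] := Rintegral_dominated_cvg mQ (fun k => measurable_funM mG
  (measurable_indic (measurable_steep_set k%:R))) tail0 iG tail_bd.
rewrite Rintegral_cst// mul0r in tail.
have cv : 2 * n%:R * r * (\int[mu]_(y in low_set) G y +
    \int[mu]_(y in Q) (G y * \1_(steep_set k%:R) y)) @[k --> \oo] -->
    2 * n%:R * r * (\int[mu]_(y in low_set) G y + 0).
  by apply: cvgM; [exact: cvg_cst|apply: cvgD => //; exact: cvg_cst].
rewrite addr0 in cv.
have cc : \int[mu]_(y in Q) `|u y - (r ^+ n)^-1 * \int[mu]_(z in Q) u z| @[k --> \oo] -->
  \int[mu]_(y in Q) `|u y - (r ^+ n)^-1 * \int[mu]_(z in Q) u z| by exact: cvg_cst.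
apply: (ler_cvg_to cc cv); apply: nearW => k.
by apply: le_trans (stepA k%:R _) _ => //; rewrite Rintegral_indicM_sub//; exact: subIsetl.
Unshelve. all: by end_near. Qed.

End TruncatedPoincare.

(** * Chaining over geometric scales *)

Section GeometricScales.
Variable R : realType.
Implicit Types (rho Y : R) (w : nat -> R).

(** The ratio 16 is 8 times 2: a value g that loses at most a factor 4 per scale stays eventually
    above 8^-j, so thresholds growing like 2^j, multiplied by the radius, can still be kept below
    it. *)
Definition srad rho (j : nat) : R := rho * 16^-1 ^+ j.

Lemma rad_gt0 rho j : 0 < rho -> 0 < srad rho j.
Proof. by move=> r0; rewrite mulr_gt0// exprn_gt0. Qed.

Lemma radS rho j : srad rho j.+1 = srad rho j / 16.
Proof. by rewrite /srad exprSr mulrA. Qed.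

Lemma rad_le rho j : 0 < rho -> srad rho j <= rho.
Proof. by move=> r0; rewrite ler_piMr ?(ltW r0)// exprn_ile1// invf_le1// ler1n. Qed.

Lemma rad_anti rho j : 0 < rho -> srad rho j.+1 <= srad rho j.
Proof. by move=> r0; rewrite radS ler_pdivrMr// ler_peMr ?ler1n// ltW// rad_gt0. Qed.

Lemma sum_rad_le rho L : 0 < rho -> \sum_(j < L) srad rho j <= 2 * rho.
Proof.
move=> r0; suff h : \sum_(j < L) srad rho j <= 2 * rho - 2 * srad rho L.
  by apply: le_trans h _; rewrite gerBl mulr_ge0// ltW// rad_gt0.
elim: L => [|L ih]; first by rewrite big_ord0 /srad expr0 mulr1 subrr.
have := rad_gt0 L r0; rewrite big_ord_recr/= radS; move: ih.
by move: (\sum_(j < L) _) (srad rho L) => S t; lra.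
Qed.

(* The largest term dominates a sum growing at least geometrically. *)
Lemma sum_below_le w Y L : 0 <= Y -> (forall j, 0 <= w j) -> (forall j, 2 * w j <= w j.+1) ->
  \sum_(j < L) w j * (w j < Y)%R%:R <= 2 * Y.
Proof.
move=> Y0 w0 w2; elim: L => [|L ih]; first by rewrite big_ord0 mulr_ge0.
rewrite big_ord_recr/=; case: ltP => wL; last by rewrite mulr0 addr0.
rewrite mulr1; suff h K : \sum_(j < K.+1) w j <= 2 * w K.
  case: L wL {ih} => [|L] wL; first by rewrite big_ord0 add0r (le_trans (ltW wL))// ler_peMl// ler1n.
  apply: (@le_trans _ _ (\sum_(j < L.+1) w j + w L.+1)).
    rewrite lerD2r; apply: ler_sum => j _.
    by rewrite ler_piMr// lern1 leq_b1.
  by have := h L; have := w2 L; move: (\sum_(j < L.+1) w j) => T; lra.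
elim: K => [|K ih']; first by rewrite big_ord1; have := w0 0%N; lra.
by rewrite big_ord_recr/=; have := w2 K; move: ih'; move: (\sum_(j < K.+1) w j) => T; lra.
Qed.

(* Where b <= g, split the scales: if g / beta <= 1 / srad rho j the middle term dominates, and the
   remaining weights grow geometrically and stay below (g / beta) ^ p. *)
Lemma scales_pointwise (p L : nat) rho (e q : nat -> bool) (S : bool) (g b beta : R) :
  0 < rho -> 0 <= g -> 0 <= b -> 0 < beta -> (0 < p)%N ->
  (forall j, e j -> q j) -> (forall j, e j -> b <= g -> S) ->
  \sum_(j < L) (srad rho j)^-1 ^+ p * (g * (e j)%:R) <=
  \sum_(j < L) (b * (srad rho j)^-1 ^+ p + beta * (srad rho j)^-1 ^+ p.+1) * (q j)%:R +
  2 * beta^-1 ^+ p * (g ^+ p.+1 * S%:R).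
Proof.
move=> r0 g0 b0 be0 p0 eq eS.
have wi0 j : 0 < (srad rho j)^-1 by rewrite invr_gt0 rad_gt0.
have w0 j i : 0 <= (srad rho j)^-1 ^+ i by rewrite exprn_ge0// ltW.
have last0 : 0 <= 2 * beta^-1 ^+ p * (g ^+ p.+1 * S%:R).
  by rewrite !mulr_ge0// ?exprn_ge0// invr_ge0 ltW.
have [gb|bg] := ltP g b.
  rewrite -[leLHS]addr0; apply: lerD => //; apply: ler_sum => j _.
  case ej : (e j); last first.
    rewrite !mulr0 mulr_ge0// addr_ge0// mulr_ge0// ltW//.
  rewrite (eq _ ej) !mulr1 mulrC (le_trans (y := b * (srad rho j)^-1 ^+ p))//.
    by rewrite ler_wpM2r// ltW.
  by rewrite lerDl mulr_ge0// ltW.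
pose Y := (g / beta) ^+ p.
have Y0 : 0 <= Y by rewrite exprn_ge0// divr_ge0// ltW.
have w2 j : 2 * (srad rho j)^-1 ^+ p <= (srad rho j.+1)^-1 ^+ p.
  have e16 (x : R) : (x / 16)^-1 = x^-1 * 16 by rewrite invf_div mulrC.
  rewrite radS e16 exprMn mulrC ler_wpM2l//.
  apply: (@le_trans _ _ 16); first by rewrite ler_nat.
  by rewrite -[leLHS]expr1 ler_weXn2l// ler1n.
have main : \sum_(j < L) (srad rho j)^-1 ^+ p * (g * (e j)%:R) <=
    \sum_(j < L) ((b * (srad rho j)^-1 ^+ p + beta * (srad rho j)^-1 ^+ p.+1) * (q j)%:R +
      g * S%:R * ((srad rho j)^-1 ^+ p * ((srad rho j)^-1 ^+ p < Y)%R%:R)).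
  apply: ler_sum => j _; case ej : (e j); last first.
    by rewrite !mulr0 addr_ge0// ?mulr_ge0// addr_ge0// mulr_ge0// ltW.
  rewrite (eq _ ej) (eS _ ej bg) !mulr1.
  have bw0 : 0 <= b * (srad rho j)^-1 ^+ p by rewrite mulr_ge0.
  have [rg|gr] := ltP (srad rho j)^-1 (g / beta).
    rewrite /Y ltrXn2r ?nnegrE ?(ltW (wi0 _)) ?divr_ge0 ?(ltW be0)// -lt0n p0 mulr1.
    by rewrite mulrC lerDr addr_ge0// mulr_ge0// ltW.
  have h3 : 0 <= g * ((srad rho j)^-1 ^+ p * ((srad rho j)^-1 ^+ p < Y)%R%:R).
    by rewrite mulr_ge0// mulr_ge0// ler0n.
  have h4 : (srad rho j)^-1 ^+ p * g <= beta * (srad rho j)^-1 ^+ p.+1.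
    by rewrite exprSr mulrCA ler_wpM2l// mulrC -ler_pdivrMr.
  by rewrite (le_trans h4)// -addrA addrCA lerDl addr_ge0.
apply: (le_trans main); rewrite big_split/= lerD2l -mulr_sumr.
apply: (@le_trans _ _ (g * S%:R * (2 * Y))); last first.
  rewrite /Y exprMn exprS le_eqVlt; apply/orP; left; apply/eqP; ring.
rewrite ler_wpM2l ?mulr_ge0//.
exact: (@sum_below_le (fun j => (srad rho j)^-1 ^+ p) Y L Y0 (fun j => w0 j p) w2).
Qed.

End GeometricScales.

Lemma half_le_sub (R : realType) (p q : \bar R) : p \is a fin_num -> q \is a fin_num ->
  (p < (2^-1)%:E * q -> (2^-1)%:E * q <= q - p)%E.
Proof.
by move: p q => [p| |] [q| |]//= _ _; rewrite -EFinM -EFinB lte_fin lee_fin => ?; lra.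
Qed.

Lemma half_sum_arith (R : realFieldType) (s S m0 ml p q t : R) :
  s - m0 <= 8 * t * q * S -> ml - s / 2 <= 8 * t * q * S -> m0 - ml <= 4 * t * p * S ->
  s / 2 <= (4 * t * p + 16 * t * q) * S.
Proof. by move=> *; lra. Qed.

Lemma lebn_eball_fin_num (R : realType) (n : nat) (x : 'rV[R]_n) (r : R) : 0 <= r ->
  @lebn R n (eball x r) \is a fin_num.
Proof.
move=> r0; rewrite ge0_fin_numE ?measure_ge0//.
by apply: le_lt_trans (lebn_eball_le _ r0) _; rewrite ltry.
Qed.

(** * Energy needed for a drop of the median between two scales *)

Section ScaleLemma.
Variables (R : realType) (n d : nat) (Omega : set 'rV[R]_n).
Variables (f : 'rV[R]_n -> 'rV[R]_d) (Df : 'I_d -> 'I_n -> 'rV[R]_n -> R).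
Variables (x : 'rV[R]_n) (c : 'rV[R]_d) (rho s : R).
Notation mu := (@lebn R n).
Hypotheses (oO : open Omega) (Wf : W11loc Omega f Df) (n2 : (2 <= n)%N).
Hypotheses (rho0 : 0 < rho) (s0 : 0 < s).
Hypothesis CO : closed_box (x - const_mx (2 * rho)) (x + const_mx (2 * rho)) `<=` Omega.

Definition centred_cube (r : R) : set (LebT R n) := cube (x - const_mx r) (2 * r).

Let Qj j := centred_cube (srad rho j).
Let Ej j := low_set f (x - const_mx (srad rho j)) (2 * srad rho j) s c.
Let G : LebT R n -> R := grad_sum Df.
Let F : LebT R n -> R := fun y => enorm (f y - c).
Let u : LebT R n -> R := fun y => Num.min (F y) s.
Let mean j : R := ((2 * srad rho j) ^+ n)^-1 * \int[mu]_(y in Qj j) u y.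
Let w j : R := (srad rho j)^-1 ^+ n.-1.

Let rj0 j : 0 < srad rho j. Proof. exact: rad_gt0. Qed.

Let side0 j : 0 < 2 * srad rho j. Proof. by rewrite mulr_gt0. Qed.

Let nS : n = n.-1.+1. Proof. by rewrite prednK// (leq_trans _ n2). Qed.

Let COj j : closed_box (x - const_mx (srad rho j) - const_mx rho)
  (x - const_mx (srad rho j) + const_mx (2 * srad rho j)) `<=` Omega.
Proof.
apply: subset_trans CO => y yj i; have := yj i; rewrite !mxE => /andP[h1 h2].
have hr := rad_le j rho0; have := rj0 j; move: (srad rho j) hr h1 h2 => t *.
by apply/andP; split; lra.
Qed.

Let mQj j : measurable (Qj j). Proof. exact: measurable_cube. Qed.

Let mEj j : measurable (Ej j). Proof. exact: (measurable_low_set s c Wf rho0 (@COj j)). Qed.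

Let EjQ j : Ej j `<=` Qj j. Proof. exact: subIsetl. Qed.

Let iG j : mu.-integrable (Qj j) (EFin \o G).
Proof. exact: (integrable_grad_sum Wf rho0 (@COj j)). Qed.

Let iu j : mu.-integrable (Qj j) (EFin \o u).
Proof. exact: (integrable_trunc c Wf (side0 j) rho0 s0 (@COj j)). Qed.

Let G0 y : 0 <= G y.
Proof. by apply: sumr_ge0 => j _; exact: sumr_ge0. Qed.

Let Qj_anti j : Qj j.+1 `<=` Qj j.
Proof.
move=> y /cubeE Qy; apply/cubeE => i; have := Qy i; rewrite !mxE => /andP[h1 h2].
have hr := rad_anti j rho0; move: (srad rho j) (srad rho j.+1) hr h1 h2 => t t' *.
by apply/andP; split; lra.
Qed.

Let Qj0 j : Qj j `<=` Qj 0.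
Proof. by elim: j => // j ih; apply: subset_trans ih; exact: Qj_anti. Qed.

Let icst j (t : R) : mu.-integrable (Qj j) (EFin \o cst t).
Proof. exact: integrable_cst_cube (ltW (side0 j)). Qed.

Let iosc j : mu.-integrable (Qj j) (EFin \o (fun y => `|u y - mean j|)).
Proof. apply: integrable_norm; exact: (integrableB (mQj j) (iu j) (icst j _)). Qed.

Let osc j : \int[mu]_(y in Qj j) `|u y - mean j| <=
  4 * n%:R * srad rho j * \int[mu]_(y in Ej j) G y.
Proof.
have e (p t q : R) : 2 * p * (2 * t) * q = 4 * p * t * q by ring.
rewrite -e; exact: (truncated_poincare c oO Wf (side0 j) rho0 s0 (@COj j)).
Qed.

Let w0 j : 0 <= w j. Proof. by rewrite exprn_ge0// invr_ge0 ltW. Qed.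

Let wE j : srad rho j * (srad rho j ^+ n)^-1 = w j.
Proof.
rewrite /w [in LHS]nS exprS invfM mulrA mulfV ?mul1r ?exprVn// gt_eqF//.
Qed.

(** Chebyshev's inequality on a set D as large as the lower bound for half a ball. The constant is
    the factor 4 n of [osc] divided by the relative volume of D, namely half of (2 / (n + 1))^n. *)
Let osc_half j (D : set (LebT R n)) (t : R) : measurable D -> D `<=` Qj j ->
  ((2^-1 * (2 / n.+1%:R * srad rho j) ^+ n)%:E <= mu D)%E ->
  (forall y, D y -> t <= `|u y - mean j|) ->
  t <= 8 * n%:R * (n.+1%:R / 2) ^+ n * (w j * \int[mu]_(y in Ej j) G y).
Proof.
move=> mD DQ muD tD.
have Dfin : (mu D < +oo)%E.
  apply: (@le_lt_trans _ _ (mu (Qj j))); first by apply: le_outer_measure.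
  by rewrite [X in (X < _)%E](lebn_cube _ (ltW (side0 j))) ltry.
have DE : mu D = (fine (mu D))%:E by rewrite fineK// ge0_fin_numE// measure_ge0.
have IE0 : 0 <= \int[mu]_(y in Ej j) G y by exact: Rintegral_ge0.
have h : t * fine (mu D) <= 4 * n%:R * srad rho j * \int[mu]_(y in Ej j) G y.
  apply: le_trans (osc j).
  apply: (@le_trans _ _ (\int[mu]_(y in D) `|u y - mean j|)); last first.
    by apply: le_Rintegral_sub => // y _; exact: normr_ge0.
  rewrite -(Rintegral_cst mu mD t).
  apply: le_Rintegral => //; first by exact: (integrableS (mQj j) mD DQ (icst j t)).
  exact: (integrableS (mQj j) mD DQ (iosc j)).
have [t0|t0] := leP t 0.
  apply: (le_trans t0); apply: mulr_ge0; last exact: mulr_ge0.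
  by rewrite mulr_ge0// exprn_ge0// divr_ge0.
have v0 : 0 < 2^-1 * (2 / n.+1%:R * srad rho j) ^+ n.
  by rewrite mulr_gt0// exprn_gt0// mulr_gt0.
have : t * (2^-1 * (2 / n.+1%:R * srad rho j) ^+ n) <= 4 * n%:R * srad rho j * \int[mu]_(y in Ej j) G y.
  by apply: le_trans h; rewrite ler_pM2l// -lee_fin -DE.
rewrite -(ler_pdivlMr _ _ v0) => h2; apply: (le_trans h2).
rewrite -wE invfM invrK exprMn invfM -exprVn invf_div.
move: (\int[mu]_(y in Ej j) G y) (srad rho j ^+ n)^-1 ((n.+1%:R / 2) ^+ n) (srad rho j) => I0 a b t'.
by rewrite le_eqVlt; apply/orP; left; apply/eqP; ring.
Qed.

(** Both means live on the smaller cube, whose side is an eighth of [srad rho j]; dividing the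
    larger oscillation by its volume gives 8^n. *)
Let mean_step j : `|mean j.+1 - mean j| <= 4 * n%:R * 8 ^+ n * (w j * \int[mu]_(y in Ej j) G y).
Proof.
have v0 : 0 < (2 * srad rho j.+1) ^+ n by rewrite exprn_gt0.
have iosc' : mu.-integrable (Qj j.+1) (EFin \o (fun y => u y - mean j)).
  exact: (integrableB (mQj _) (iu _) (icst _ _)).
have e : (2 * srad rho j.+1) ^+ n * `|mean j.+1 - mean j| = `|\int[mu]_(y in Qj j.+1) (u y - mean j)|.
  rewrite (RintegralB (mQj _) (iu _) (icst _ (mean j))) Rintegral_cst//.
  rewrite [X in fine X](lebn_cube _ (ltW (side0 _))) /=.
  rewrite -{1}(gtr0_norm v0) -normrM mulrBr; congr `|_ - _|; last by rewrite mulrC.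
  by rewrite /mean mulrA mulfV ?mul1r// gt_eqF.
have : (2 * srad rho j.+1) ^+ n * `|mean j.+1 - mean j| <=
    4 * n%:R * srad rho j * \int[mu]_(y in Ej j) G y.
  rewrite e; apply: le_trans (osc j).
  apply: le_trans (le_normr_Rintegral (mQj _) iosc') _.
  by apply: le_Rintegral_sub => // y _; exact: normr_ge0.
rewrite mulrC -(ler_pdivlMr _ _ v0) => h2; apply: (le_trans h2); rewrite -wE radS.
have -> : 2 * (srad rho j / 16) = 8^-1 * srad rho j by field.
rewrite exprMn invfM -exprVn invrK.
move: (\int[mu]_(y in Ej j) G y) (srad rho j ^+ n)^-1 (8 ^+ n : R) (srad rho j) => I0 a b t'.
by rewrite le_eqVlt; apply/orP; left; apply/eqP; ring.
Qed.

Lemma measurable_far_set j (t : R) : measurable ([set y | eball x (srad rho j) y /\ t <= enorm (f y - c)] : set (LebT R n)).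
Proof.
have -> : [set y | eball x (srad rho j) y /\ t <= enorm (f y - c)] =
    eball x (srad rho j) `&` (Qj j `&` F @^-1` `[t, +oo[%classic).
  apply/seteqP; split=> y [By Fy]; split=> //.
    by split; [exact: eball_sub_cube|rewrite /= in_itv/= andbT].
  by case: Fy => _; rewrite /= in_itv/= andbT.
apply: measurableI; first exact: measurable_eball.
exact: (measurable_dist c Wf rho0 (@COj j) (mQj j) (measurable_itv `[t, +oo[)).
Qed.

Let half_ball j : ((2^-1 * (2 / n.+1%:R * srad rho j) ^+ n)%:E <=
  (2^-1)%:E * mu (eball x (srad rho j)))%E.
Proof. by rewrite EFinM lee_wpmul2l ?lee_fin//; exact: lebn_eball_ge. Qed.

Let ball_fin j : mu (eball x (srad rho j)) \is a fin_num.
Proof. exact: lebn_eball_fin_num (ltW (rj0 j)). Qed.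

(** At scale 0 the truncation equals s on half of the ball, so the mean cannot be much below s.
    Symmetrically, [outer_osc] keeps the mean at scale l from being much above s / 2, because u < s
    / 2 on half of that ball. *)
Let inner_osc : ((2^-1)%:E * mu (eball x rho) <=
    mu [set y | eball x rho y /\ (s <= enorm (f y - c))%R])%E ->
  s - mean 0 <= 8 * n%:R * (n.+1%:R / 2) ^+ n * (w 0 * \int[mu]_(y in Ej 0) G y).
Proof.
have e0 : srad rho 0 = rho by rewrite /srad expr0 mulr1.
move=> h1; apply: (osc_half (measurable_far_set 0 s)).
- by move=> y [By _]; exact: eball_sub_cube.
- by apply: le_trans (half_ball 0) _; rewrite e0.
move=> y [_ sy]; rewrite /u (min_r sy); exact: ler_norm.
Qed.

Let outer_osc l :
  (mu [set y | eball x (srad rho l) y /\ (s / 2 <= enorm (f y - c))%R] <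
    (2^-1)%:E * mu (eball x (srad rho l)))%E ->
  mean l - s / 2 <= 8 * n%:R * (n.+1%:R / 2) ^+ n * (w l * \int[mu]_(y in Ej l) G y).
Proof.
move=> h2; set S := [set y | _] in h2.
have mS : measurable (S : set (LebT R n)) by exact: measurable_far_set.
have mB : measurable (eball x (srad rho l) : set (LebT R n)) by exact: measurable_eball.
apply: (osc_half (measurableD mB mS)).
- by move=> y [By _]; exact: eball_sub_cube.
- apply: le_trans (half_ball l) _.
  have Bfin : (mu (eball x (srad rho l)) < +oo)%E by rewrite -ge0_fin_numE ?measure_ge0.
  have Sfin : mu S \is a fin_num.
    rewrite ge0_fin_numE ?measure_ge0//; apply: le_lt_trans Bfin.
    by apply: le_outer_measure => y [].
  have DE : (mu (eball x (srad rho l) `\` S) = mu (eball x (srad rho l)) - mu S)%E.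
    have := measureD mB mS Bfin; rewrite setIidr//; last by move=> y [].
  by rewrite DE; exact: half_le_sub.
move=> y [By nSy]; have sF : F y < s / 2.
  by rewrite ltNge; apply/negP => sF; apply: nSy.
have s2 : s / 2 < s by rewrite ltr_pdivrMr// ltr_pMr// ltr1n.
have us : u y = F y by exact: (min_l (ltW (lt_trans sF s2))).
rewrite us distrC; apply: le_trans (ler_norm _); rewrite lerD2l lerN2.
exact: ltW.
Qed.

(** The first summand comes from the telescoped means, the second is twice the constant of
    [osc_half], once for each end of the chain. *)
Definition scale_const : R := 4 * n%:R * 8 ^+ n + 16 * n%:R * (n.+1%:R / 2) ^+ n.

Let tele l : mean 0 - mean l <= 4 * n%:R * 8 ^+ n * \sum_(j < l) w j * \int[mu]_(y in Ej j) G y.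
Proof.
rewrite mulr_sumr.
apply: (@le_trans _ _ (\sum_(j < l) `|mean j.+1 - mean j|)).
  rewrite -opprB -(telescope_sumr mean (leq0n l)) big_mkord -sumrN.
  by apply: ler_sum => j _; rewrite -normrN ler_norm.
by apply: ler_sum => j _; exact: mean_step.
Qed.

(** The drop s / 2 is split into s - mean 0, mean 0 - mean l and mean l - s / 2, each bounded by a
    part of the same sum over scales. *)
Let half_level l :
  ((2^-1)%:E * mu (eball x rho) <= mu [set y | eball x rho y /\ (s <= enorm (f y - c))%R])%E ->
  (mu [set y | eball x (srad rho l) y /\ (s / 2 <= enorm (f y - c))%R] <
    (2^-1)%:E * mu (eball x (srad rho l)))%E ->
  s / 2 <= scale_const * \sum_(j < l.+1) w j * \int[mu]_(y in Ej j) G y.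
Proof.
move=> /inner_osc h1 /outer_osc h2; have h3 := tele l.
have wI0 j : 0 <= w j * \int[mu]_(y in Ej j) G y by rewrite mulr_ge0// Rintegral_ge0.
have l0 : w 0 * \int[mu]_(y in Ej 0) G y <= \sum_(j < l.+1) w j * \int[mu]_(y in Ej j) G y.
  by rewrite big_ord_recl lerDl sumr_ge0.
have ll : w l * \int[mu]_(y in Ej l) G y <= \sum_(j < l.+1) w j * \int[mu]_(y in Ej j) G y.
  by rewrite big_ord_recr/= lerDr sumr_ge0.
have lt' : \sum_(j < l) w j * \int[mu]_(y in Ej j) G y <=
    \sum_(j < l.+1) w j * \int[mu]_(y in Ej j) G y.
  by rewrite big_ord_recr/= lerDl.
have c1 : 0 <= 8 * n%:R * (n.+1%:R / 2) ^+ n :> R by rewrite mulr_ge0// exprn_ge0// divr_ge0.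
have c2 : 0 <= 4 * n%:R * 8 ^+ n :> R by rewrite mulr_ge0// exprn_ge0.
have k1 := le_trans h1 (ler_wpM2l c1 l0).
have k2 := le_trans h2 (ler_wpM2l c1 ll).
have k3 := le_trans h3 (ler_wpM2l c2 lt').
exact: half_sum_arith k1 k2 k3.
Qed.

Lemma measurable_low_steep (b : R) : measurable (Ej 0 `&` [set y | b <= G y]).
Proof.
have -> : Ej 0 `&` [set y | b <= G y] = Ej 0 `&` (Qj 0 `&` G @^-1` `[b, +oo[%classic).
  apply/seteqP; split=> y [Ey Gy]; split=> //.
    by split; [exact: EjQ|rewrite /= in_itv/= andbT].
  by case: Gy => _; rewrite /= in_itv/= andbT.
apply: measurableI => //.
by have /measurable_EFinP mG := measurable_int mu (iG 0); exact: (mG (mQj 0)).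
Qed.

(** This is [scales_pointwise] integrated over the largest cube. The volume (2 srad)^n cancels the
    weight srad^-n, so every scale contributes the same amount beta; this is the origin of the
    factor l + 1. The sets [Ej j] all lie in [Ej 0], as the cubes are nested and the threshold 2 s
    is common. *)
Let scales_integral l (b beta : R) : 0 <= b -> 0 < beta ->
  mu.-integrable (Qj 0) (EFin \o (fun y => G y ^+ n)) ->
  \sum_(j < l.+1) w j * \int[mu]_(y in Ej j) G y <=
  2 ^+ n * (b * (2 * rho) + l.+1%:R * beta) +
  2 * beta^-1 ^+ n.-1 * \int[mu]_(y in Ej 0 `&` [set y | b <= G y]) G y ^+ n.
Proof.
move=> b0 be0 iGn; pose S := Ej 0 `&` [set y | b <= G y].
have mS : measurable S by exact: measurable_low_steep.
have SQ : S `<=` Qj 0 by move=> y [/EjQ].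
pose cf j := b * (srad rho j)^-1 ^+ n.-1 + beta * (srad rho j)^-1 ^+ n.-1.+1.
have iE j : mu.-integrable (Qj 0) (EFin \o (fun y => w j * (G y * \1_(Ej j) y))).
  exact: (integrableZl (mQj 0) (w j) (integrable_indicM (mQj 0) (mEj j) (iG 0))).
have iI j : mu.-integrable (Qj 0) (EFin \o (fun y => cf j * \1_(Qj j) y)).
  exact: (integrable_indicM (mQj 0) (mQj j) (icst 0 (cf j))).
have iK : mu.-integrable (Qj 0) (EFin \o (fun y => 2 * beta^-1 ^+ n.-1 * (G y ^+ n * \1_S y))).
  exact: (integrableZl (mQj 0) _ (integrable_indicM (mQj 0) mS iGn)).
have iSI : mu.-integrable (Qj 0) (EFin \o (fun y => \sum_(j < l.+1) cf j * \1_(Qj j) y)).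
  by apply: integrable_sumR => // j _; exact: iI.
have -> : \sum_(j < l.+1) w j * \int[mu]_(y in Ej j) G y =
    \int[mu]_(y in Qj 0) \sum_(j < l.+1) w j * (G y * \1_(Ej j) y).
  rewrite Rintegral_sum//; apply: eq_bigr => j _.
  rewrite (RintegralZl _ (mQj 0) (integrable_indicM (mQj 0) (mEj j) (iG 0))).
  by rewrite Rintegral_indicM_sub//; exact: subset_trans (@EjQ j) (@Qj0 j).
apply: (@le_trans _ _ (\int[mu]_(y in Qj 0) (\sum_(j < l.+1) cf j * \1_(Qj j) y +
    2 * beta^-1 ^+ n.-1 * (G y ^+ n * \1_S y)))).
  apply: le_Rintegral => //.
  - by apply: integrable_sumR => // j _; exact: iE.
  - exact: (integrableD (mQj 0) iSI iK).
  move=> y _; have p0 : (0 < n.-1)%N by rewrite -ltnS -nS.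
  have eq' j : y \in Ej j -> y \in Qj j by rewrite !inE => /EjQ.
  have eS j : y \in Ej j -> b <= G y -> y \in S.
    by rewrite !inE => -[Qy Fy] bG; split=> //; split=> //; exact: Qj0 Qy.
  have := @scales_pointwise R n.-1 l.+1 rho (fun j => y \in Ej j) (fun j => y \in Qj j)
    (y \in S) (G y) b beta rho0 (G0 y) b0 be0 p0 eq' eS.
  by rewrite (congr1 (GRing.exp (G y)) (esym nS)).
rewrite (RintegralD (mQj 0) iSI iK).
rewrite (RintegralZl _ (mQj 0) (integrable_indicM (mQj 0) mS iGn)) Rintegral_indicM_sub//.
rewrite lerD2r Rintegral_sum//.
have cE j : \int[mu]_(y in Qj 0) (cf j * \1_(Qj j) y) = 2 ^+ n * (b * srad rho j + beta).
  rewrite Rintegral_indicM_sub; last exact: Qj0.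
  rewrite Rintegral_cst// [X in fine X](lebn_cube _ (ltW (side0 j))) [fine _]/=.
  have r0 : srad rho j != 0 by rewrite gt_eqF.
  have e1 : (srad rho j)^-1 ^+ n.-1 * srad rho j ^+ n = srad rho j.
    rewrite (congr1 (GRing.exp (srad rho j)) nS) exprS mulrCA -exprMn mulVf// expr1n.
    exact: mulr1.
  have e2 : (srad rho j)^-1 ^+ n.-1.+1 * srad rho j ^+ n = 1.
    by rewrite (congr1 (GRing.exp (srad rho j)) nS) -exprMn mulVf// expr1n.
  by rewrite exprMn /cf mulrCA mulrDl -!mulrA e1 e2 mulr1.
rewrite (eq_bigr (fun j : 'I_l.+1 => 2 ^+ n * (b * srad rho j + beta))) => [|j _]; last exact: cE.
rewrite -mulr_sumr ler_wpM2l ?exprn_ge0// big_split/= -mulr_sumr sumr_const card_ord.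
by rewrite -[beta *+ _]mulr_natl lerD2r ler_wpM2l// sum_rad_le.
Qed.

Lemma scale_estimate l (b : R) : 0 <= b ->
  ((2^-1)%:E * mu (eball x rho) <= mu [set y | eball x rho y /\ (s <= enorm (f y - c))%R])%E ->
  (mu [set y | eball x (srad rho l) y /\ (s / 2 <= enorm (f y - c))%R] <
    (2^-1)%:E * mu (eball x (srad rho l)))%E ->
  scale_const * 2 ^+ (n + 4) * b * rho <= s ->
  mu.-integrable (centred_cube rho) (EFin \o (fun y => grad_sum Df y ^+ n)) ->
  s ^+ n <= (8 * scale_const * 2 ^+ n) ^+ n * l.+1%:R ^+ n.-1 *
    \int[mu]_(y in low_set f (x - const_mx rho) (2 * rho) s c `&`
      [set y | b <= grad_sum Df y]) grad_sum Df y ^+ n.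
Proof.
move=> b0 h1 h2 bs iGn; have hl := half_level h1 h2.
have e0 : srad rho 0 = rho by rewrite /srad expr0 mulr1.
have C0 : 0 < scale_const.
  by rewrite ltr_pwDl ?mulr_ge0 ?exprn_ge0 ?divr_ge0// !mulr_gt0 ?exprn_gt0// ltr0n (leq_trans _ n2).
pose A := 8 * scale_const * 2 ^+ n.
have A0 : 0 < A by rewrite mulr_gt0 ?exprn_gt0// mulr_gt0.
(* The part with beta then costs exactly s / 8. The hypothesis on b, where 2^4 is 2 times 8, keeps
   the part with b below s / 8 as well, so s / 4 of the drop s / 2 is left for the energy J. *)
pose beta := s / (A * l.+1%:R).
have be0 : 0 < beta by rewrite divr_gt0// mulr_gt0.
have iGn' : mu.-integrable (Qj 0) (EFin \o (fun y => G y ^+ n)) by rewrite /Qj e0.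
have := scales_integral l b0 be0 iGn'.
rewrite /Ej e0; set J := \int[mu]_(y in _ `&` _) _ => hI.
have J0 : 0 <= J by apply: Rintegral_ge0 => y _; rewrite exprn_ge0//; exact: G0.
rewrite -/(grad_sum Df) -/J.
have k1 := le_trans hl (ler_wpM2l (ltW C0) hI).
have k2 : scale_const * (2 ^+ n * (l.+1%:R * beta)) = s / 8.
  by rewrite /beta /A; field; rewrite !gt_eqF ?exprn_gt0// ltr0n.
have k3 : scale_const * (2 ^+ n * (b * (2 * rho))) <= s / 8.
  rewrite ler_pdivlMr//; apply: le_trans bs; rewrite exprD le_eqVlt; apply/orP; left; apply/eqP.
  by ring.
have k4 : s / 4 <= scale_const * (2 * beta^-1 ^+ n.-1 * J).
  move: k1; rewrite [2 ^+ n * (_ + _)]mulrDr !mulrDr k2; move: k3.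
  by move: (scale_const * (2 ^+ n * _)) (scale_const * (_ * J)) => p q; lra.
have k5 : s * beta ^+ n.-1 <= 8 * scale_const * J.
  have bn0 : 0 < beta ^+ n.-1 by rewrite exprn_gt0.
  move: k4; rewrite -(ler_pM2r bn0) exprVn => k4.
  have e (p q t : R) : q != 0 -> p * (2 * q^-1 * t) * q = 2 * p * t by move=> q0; field.
  by move: k4; rewrite e ?gt_eqF//; move: (beta ^+ _) => B; lra.
have -> : s ^+ n = s * beta ^+ n.-1 * (A * l.+1%:R) ^+ n.-1.
  rewrite -mulrA -exprMn /beta divfK ?gt_eqF ?mulr_gt0 ?ltr0n//.
  by rewrite -exprS -nS.
have An0 : 0 <= (A * l.+1%:R) ^+ n.-1 by rewrite exprn_ge0// mulr_ge0// ltW.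
apply: le_trans (ler_wpM2r An0 k5) _.
have hA : 8 * scale_const <= A by rewrite /A ler_peMr ?mulr_ge0 ?(ltW C0)// exprn_ege1// ler1n.
rewrite (congr1 (GRing.exp A) nS) exprS exprMn.
have e (p q t v : R) : p * q * t * v = p * (q * t * v) by ring.
have e' (p q t v : R) : p * v * (q * t) = p * (q * t * v) by ring.
rewrite e e'; apply: ler_wpM2r hA.
by rewrite !mulr_ge0// ?exprn_ge0// ltW.
Qed.

End ScaleLemma.

(** * Selection of good scales *)

Section ScaleSequence.
Variable R : realType.
Implicit Types (a b B D M y : R).

(* The gaps are as large as the bound l^(n-1) <= C k^lambda permits, b being lambda/(n-1); then for D
   large the assumed decay in k becomes geometric decay in i with ratio 1/5. *)
Fixpoint scale_seq D b (i : nat) : nat :=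
  if i is j.+1 then (scale_seq D b j + (Num.truncn (D * (scale_seq D b j)%:R `^ b)).+1)%N else 1%N.

Lemma scale_seq_gt0 D b i : (0 < scale_seq D b i)%N.
Proof. by elim: i => //= i; rewrite addn_gt0 => ->. Qed.

Lemma scale_seq_lt D b i : (scale_seq D b i < scale_seq D b i.+1)%N.
Proof. by rewrite /= addnS ltnS leq_addr. Qed.

Lemma scale_seq_ge1 D b i : 1 <= (scale_seq D b i)%:R :> R.
Proof. by rewrite ler1n scale_seq_gt0. Qed.

Lemma scale_seq_step_ge D b i : 0 <= D ->
  (scale_seq D b i)%:R + D * (scale_seq D b i)%:R `^ b <= (scale_seq D b i.+1)%:R :> R.
Proof. by move=> D0 /=; rewrite natrD lerD2l ltW// truncnS_gt. Qed.

Lemma scale_seq_step_le D b i : 0 <= D -> 0 <= b ->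
  ((scale_seq D b i.+1 - scale_seq D b i).+1%:R : R) <= (D + 2) * (scale_seq D b i)%:R `^ b.
Proof.
move=> D0 b0; rewrite [scale_seq D b i.+1]/= addKn.
have h : 1 <= (scale_seq D b i)%:R `^ b :> R.
  by have := ler_powR (scale_seq_ge1 D b i) b0; rewrite powRr0.
move: (_ `^ b) h => q q1; have Dq : 0 <= D * q by rewrite mulr_ge0// (le_trans _ q1).
have /andP[+ _] := truncn_itv Dq; rewrite mulrDl -!natr1.
move: (D * q) => p; move: (Num.truncn p)%:R => r; lra.
Qed.

Lemma leq_scale_seq D b i : (i <= scale_seq D b i)%N.
Proof. by elim: i => // i ih; apply: leq_ltn_trans ih (scale_seq_lt _ _ _). Qed.

(** By convexity in y the power lies below its chord over the unit interval; the induction on m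
    makes this algebraic. *)
Lemma exp_le_chord B y m : 0 <= B -> 0 <= y <= 1 ->
  (1 + B * y) ^+ m <= 1 + y * ((1 + B) ^+ m - 1).
Proof.
move=> B0 /andP[y0 y1]; elim: m => [|m ih]; first by rewrite !expr0 subrr mulr0 addr0.
have E0 : 0 <= (1 + B) ^+ m - 1 by rewrite subr_ge0 exprn_ege1// lerDl.
rewrite !exprS; apply: (le_trans (ler_wpM2l _ ih)); first by rewrite addr_ge0// mulr_ge0.
move: ((1 + B) ^+ m) E0 => e e0; rewrite -subr_ge0.
have -> : 1 + y * ((1 + B) * e - 1) - (1 + B * y) * (1 + y * (e - 1)) =
  y * (B * ((1 - y) * (e - 1))) by ring.
by rewrite !mulr_ge0// subr_ge0.
Qed.

(** The recursion is a discrete form of k' = D k^(1-a), along which k^a grows linearly; B is the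
    slope to be reached. *)
Lemma scale_seq_growth a B : 0 < a -> a <= 1 -> 0 <= B ->
  exists2 D, 0 <= D & forall i, B * i%:R <= (scale_seq D (1 - a) i)%:R `^ a.
Proof.
move=> a0 a1 B0; pose m := Num.bound a^-1; have am : a^-1 <= m%:R.
  by apply/ltW/archi_boundP; rewrite invr_ge0 ltW.
(* With y = k^-a and m >= 1/a, (1 + B y)^(1/a) <= (1 + B y)^m <= 1 + y D by the chord inequality; so
   a step multiplies k by at least (1 + B y)^(1/a) and raises k^a by at least B. *)
exists ((1 + B) ^+ m) => [|i]; first by rewrite exprn_ge0// addr_ge0.
set D := (1 + B) ^+ m; have D0 : 0 <= D by rewrite exprn_ge0// addr_ge0.
elim: i => [|i ih]; first by rewrite mulr0 powR_ge0.
have := scale_seq_step_ge (1 - a) i D0; have := scale_seq_ge1 D (1 - a) i.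
move: ih; set k := (scale_seq D (1 - a) i)%:R; set k' := (scale_seq D (1 - a) i.+1)%:R => ih k1 kk'.
have k0 : 0 < k by exact: lt_le_trans k1.
pose y := k `^ (- a).
have y0 : 0 <= y by exact: powR_ge0.
have y1 : y <= 1.
  by rewrite /y powRN invf_le1 ?powR_gt0// -(powRr0 k) ler_powR// ltW.
have z1 : 1 <= 1 + B * y by rewrite lerDl mulr_ge0.
have z0 : 0 <= 1 + B * y by exact: le_trans z1.
have h1 : k * (1 + B * y) `^ a^-1 <= k'.
  apply: le_trans kk'.
  have -> : k + D * k `^ (1 - a) = k * (1 + y * D).
    rewrite powRD ?(gt_eqF k0)//; last by rewrite implybT.
    by rewrite powRr1 ?(ltW k0)// -/y; ring.
  rewrite ler_pM2l//; apply: (le_trans (ler_powR z1 am)).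
  rewrite powR_mulrn//; apply: (le_trans (exp_le_chord m B0 _)); first by rewrite y0.
  by rewrite lerD2l ler_wpM2l// -/D lerBlDr lerDl.
have h2 : k `^ a * (1 + B * y) <= k' `^ a.
  have := ge0_ler_powR (ltW a0) _ _ h1; rewrite powRM ?powR_ge0 ?(ltW k0)//.
  rewrite -powRrM mulVf ?gt_eqF// powRr1//; apply.
    by rewrite nnegrE mulr_ge0 ?powR_ge0// ltW.
  by rewrite nnegrE; apply: le_trans h1; rewrite mulr_ge0 ?powR_ge0// ltW.
apply: le_trans h2; have -> : k `^ a * (1 + B * y) = k `^ a + B.
  rewrite mulrDr mulr1 mulrCA /y powRN mulfV ?mulr1// gt_eqF// powR_gt0//.
by rewrite -natr1 mulrDr mulr1 lerD2r.
Qed.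

(** The borderline case lambda = n - 1, that is alpha = 0: the gaps are proportional to k. *)
Lemma scale_seq_geometric D i : 0 <= D -> (1 + D) ^+ i <= (scale_seq D 1 i)%:R.
Proof.
move=> D0; elim: i => [|i ih]; first by rewrite expr0.
apply: le_trans (scale_seq_step_ge 1 i D0); rewrite powRr1//.
have -> : (scale_seq D 1 i)%:R + D * (scale_seq D 1 i)%:R = (1 + D) * (scale_seq D 1 i)%:R by ring.
by rewrite exprS ler_wpM2l// addr_ge0.
Qed.

Variables (g L : nat -> R) (mu c beta : R).
Hypotheses (mu0 : 0 < mu) (c0 : 0 < c) (beta0 : 0 <= beta) (beta1 : beta <= 1).
Hypothesis cL : forall k, c * k%:R <= L k.
Hypothesis gpos : forall k, 0 < 1 - beta -> g k <= expR (- (mu * L k `^ (1 - beta))).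
Hypothesis gzero : forall k, 1 - beta = 0 -> g k <= L k `^ (- mu).

(** The ratio 1/5 has to beat the factor 1/4 which [good_scale] allows to be lost per step. *)
Lemma scale_seq_decay : exists2 D, 0 <= D &
  exists C, forall i, g (scale_seq D beta i) <= C * 5^-1 ^+ i.
Proof.
have [b1|b1] := ltP beta 1.
  have a0 : 0 < 1 - beta by rewrite subr_gt0.
  have ln5 : 0 < ln (5 : R) by rewrite ln_gt0// ltr1n.
  have mc0 : 0 < mu * c `^ (1 - beta) by rewrite mulr_gt0// powR_gt0.
  (* The slope is such that k^(1-beta) >= B i turns the exponent mu (c k)^(1-beta) into at least i
     ln 5. *)
  have [|||D D0 hD] := @scale_seq_growth (1 - beta) (ln 5 / (mu * c `^ (1 - beta))) => //.
  - by rewrite gerBl.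
  - by rewrite ltW// divr_gt0.
  rewrite opprB addrCA subrr addr0 in hD.
  exists D => //; exists 1 => i; rewrite mul1r; set k := scale_seq D beta i.
  apply: (le_trans (gpos k a0)).
  have -> : 5^-1 ^+ i = expR (- (ln 5 * i%:R)) :> R.
    by rewrite expRN expRM_natr lnK ?posrE// exprVn.
  rewrite ler_expR lerN2.
  have h : (c * k%:R) `^ (1 - beta) <= L k `^ (1 - beta).
    have ck : 0 <= c * k%:R by rewrite mulr_ge0// ltW.
    by apply: ge0_ler_powR => //; rewrite ?nnegrE ?(ltW a0)//; exact: le_trans (cL k).
  apply: (@le_trans _ _ (mu * (c * k%:R) `^ (1 - beta))); last by rewrite ler_pM2l.
  rewrite powRM ?(ltW c0)// mulrA.
  apply: le_trans (ler_wpM2l (ltW mc0) (hD i)).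
  by rewrite [leRHS]mulrA mulrCA mulfV ?mulr1// gt_eqF.
have be : beta = 1 by apply/eqP; rewrite eq_le beta1.
have a0 : 1 - beta = 0 by rewrite be subrr.
(* Here (1 + D)^mu = 5, so the geometric growth of k makes k^(-mu) at most 5^-i. *)
pose D : R := 5 `^ mu^-1 - 1.
have D1 : 1 + D = 5 `^ mu^-1 by rewrite /D addrC subrK.
have D0 : 0 <= D.
  have m0 : 0 <= mu^-1 by rewrite invr_ge0 ltW.
  have f1 : 1 <= 5 :> R by rewrite ler1n.
  by have := ler_powR f1 m0; rewrite powRr0 /D subr_ge0.
exists D => //; exists (c `^ (- mu)) => i; rewrite be; set k := scale_seq D 1 i.
apply: (le_trans (gzero k a0)); rewrite !powRN exprVn -invfM.
have p0 : 0 < c `^ mu * 5 ^+ i by rewrite mulr_gt0 ?powR_gt0// exprn_gt0.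
rewrite lef_pV2 ?posrE//; last first.
  rewrite powR_gt0//; apply: lt_le_trans (cL k); rewrite mulr_gt0// ltr0n scale_seq_gt0//.
have -> : c `^ mu * 5 ^+ i = (c * (1 + D) ^+ i) `^ mu.
  rewrite powRM ?(ltW c0)//; last by rewrite exprn_ge0// addr_ge0.
  congr (_ * _); rewrite D1 -[X in _ = X `^ _]powR_mulrn ?powR_ge0// -!powRrM.
  by rewrite mulrCA mulVf ?gt_eqF// mulr1 powR_mulrn.
have h : c * (1 + D) ^+ i <= L k.
  by apply: le_trans (cL k); rewrite ler_pM2l//; exact: scale_seq_geometric.
have q0 : 0 <= c * (1 + D) ^+ i by rewrite mulr_ge0 ?(ltW c0)// exprn_ge0// addr_ge0.
by apply: ge0_ler_powR => //; rewrite ?nnegrE ?(ltW mu0)//; exact: le_trans h.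
Qed.

Lemma median_bound_vanishes (e : R) : 0 < e -> exists K, forall k, (K <= k)%N -> g k <= e.
Proof.
move=> e0; have big M : exists K, forall k, (K <= k)%N -> M <= L k.
  exists (Num.bound (`|M| / c)) => k Kk; apply: le_trans (cL k).
  apply: (le_trans (ler_norm M)); rewrite mulrC -ler_pdivrMr//.
  have /archi_boundP/ltW h : 0 <= `|M| / c by rewrite divr_ge0// ltW.
  by apply: (le_trans h); rewrite ler_nat.
have [b1|b1] := ltP beta 1.
  have a0 : 0 < 1 - beta by rewrite subr_gt0.
  pose M := `|ln e| / mu; have M0 : 0 <= M by rewrite divr_ge0// ltW.
  have [K hK] := big (M `^ (1 - beta)^-1); exists K => k /hK h.
  apply: (le_trans (gpos k a0)); rewrite -[leRHS](lnK (_ : e \in Num.pos)) ?posrE//.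
  rewrite ler_expR lerNl; apply: (le_trans (ler_norm _)); rewrite normrN.
  rewrite mulrC -ler_pdivrMr// -/M.
  have -> : M = (M `^ (1 - beta)^-1) `^ (1 - beta).
    by rewrite -powRrM mulVf ?powRr1// gt_eqF.
  by apply: ge0_ler_powR => //; rewrite ?nnegrE ?(ltW a0) ?powR_ge0//; apply: le_trans h; exact: powR_ge0.
have a0 : 1 - beta = 0 by apply/eqP; rewrite subr_eq0 eq_le b1.
have [K hK] := big (e `^ (- mu^-1)); exists K => k /hK h.
apply: (le_trans (gzero k a0)); rewrite powRN invf_ple ?posrE ?powR_gt0//; last first.
  by apply: lt_le_trans h; rewrite powR_gt0.
have -> : e^-1 = (e `^ (- mu^-1)) `^ mu.
  by rewrite -powRrM mulNr mulVf ?gt_eqF// powRN powRr1// ltW.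
by apply: ge0_ler_powR => //; rewrite ?nnegrE ?(ltW mu0) ?powR_ge0//; apply: le_trans h; exact: powR_ge0.
Qed.

End ScaleSequence.

Section GoodScale.
Variables (R : realType) (g r : nat -> R) (kap : nat -> nat) (C : R).
Hypotheses (r0 : forall k, 0 < r k) (kap_ge : forall i, (i <= kap i)%N).
Hypothesis decay : forall i, g (kap i) <= C * 5^-1 ^+ i.

Lemma geometric_small (q A B : R) : 0 < A -> 0 <= q -> q < 1 ->
  exists K, forall k, (K <= k)%N -> B * q ^+ k < A.
Proof.
move=> A0 q0 q1; have B0 : 0 < `|B| + 1 by rewrite ltr_wpDl.
have /cvgr0Pnorm_lt/(_ _ (divr_gt0 A0 B0)) : (fun k => q ^+ k) @ \oo --> (0 : R).
  by apply: cvg_expr; rewrite ger0_norm.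
case=> K _ hK; exists K => k /hK /=; rewrite ger0_norm ?exprn_ge0// => h.
apply: (@le_lt_trans _ _ ((`|B| + 1) * q ^+ k)).
  by rewrite ler_wpM2r ?exprn_ge0// (le_trans (ler_norm B))// lerDl.
by rewrite mulrC -ltr_pdivlMr.
Qed.

(* Otherwise g would lose at most a factor 4 per step, first along all scales and so staying above
   8^-k, then along kap, against its decay with ratio 1/5. *)
Lemma good_scale K : exists2 k, (K <= k)%N &
  [\/ g k < r k, 0 < g k /\ g k.+1 < g k / 4 |
    8^-1 ^+ k < g k /\ exists2 i, k = kap i & g (kap i.+1) < g k / 4].
Proof.
apply: contrapT => no.
have gr k : (K <= k)%N -> r k <= g k.
  by move=> Kk; rewrite leNgt; apply/negP => gk; apply: no; exists k => //; constructor 1.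
have g0 k : (K <= k)%N -> 0 < g k by move=> /gr; exact: lt_le_trans.
have g4 k : (K <= k)%N -> g k / 4 <= g k.+1.
  move=> Kk; rewrite leNgt; apply/negP => gk; apply: no; exists k => //; constructor 2.
  by split=> //; exact: g0.
have lower j : g K * 4^-1 ^+ j <= g (K + j)%N.
  elim: j => [|j ih]; first by rewrite expr0 mulr1 addn0.
  rewrite addnS; apply: le_trans (g4 _ (leq_addr _ _)).
  by rewrite exprSr mulrA ler_wpM2r.
have e2 : (8^-1 : R) = 4^-1 * 2^-1 by rewrite -invfM -natrM.
have [K1 hK1] := @geometric_small 2^-1 (g K) (8^-1 ^+ K) (g0 _ (leqnn K)) ltac:(by rewrite invr_ge0)
  ltac:(by rewrite invf_lt1// ltr1n).
have g8 k : (K + K1 <= k)%N -> 8^-1 ^+ k < g k.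
  move=> Kk; have Kk' : (K <= k)%N by exact: leq_trans (leq_addr _ _) Kk.
  have := lower (k - K)%N; rewrite subnKC//; apply: lt_le_trans.
  rewrite -{1}(subnKC Kk') exprD {2}e2 exprMn mulrCA mulrC ltr_pM2r ?exprn_gt0//.
  by apply: hK1; rewrite leq_subRL.
pose I := (K + K1)%N.
have g4k i : (I <= i)%N -> g (kap i) / 4 <= g (kap i.+1).
  move=> Ii; rewrite leNgt; apply/negP => gk; apply: no; exists (kap i).
    by apply: leq_trans (kap_ge i); apply: leq_trans Ii; exact: leq_addr.
  constructor 3; split; last by exists i.
  by apply: g8; apply: leq_trans (kap_ge i).
have lower' j : g (kap I) * 4^-1 ^+ j <= g (kap (I + j)%N).
  elim: j => [|j ih]; first by rewrite expr0 mulr1 addn0.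
  rewrite addnS; apply: le_trans (g4k _ (leq_addr _ _)).
  by rewrite exprSr mulrA ler_wpM2r.
have gI : 0 < g (kap I).
  by apply: g0; apply: leq_trans (kap_ge _); exact: leq_addr.
have q1 : (4 / 5 : R) < 1 by rewrite ltr_pdivrMr// mul1r ltr_nat.
have [J hJ] := @geometric_small (4 / 5) (g (kap I)) (C * 5^-1 ^+ I) gI ltac:(by rewrite divr_ge0) q1.
have := hJ J (leqnn J); apply/negP; rewrite -leNgt.
have := le_trans (lower' J) (decay _).
by rewrite exprD mulrA exprVn ler_pdivrMr ?exprn_gt0// exprMn [4 ^+ J * _]mulrC mulrA.
Qed.

End GoodScale.

Section GradNorm.
Variables (R : realType) (n d : nat) (Omega : set 'rV[R]_n).
Variables (f : 'rV[R]_n -> 'rV[R]_d) (Df : 'I_d -> 'I_n -> 'rV[R]_n -> R).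
Hypotheses (oO : open Omega) (Wf : W11loc Omega f Df).

Lemma grad_norm_ge0 y : 0 <= grad_norm Df y. Proof. exact: sqrtr_ge0. Qed.

Lemma le_partial_grad_norm j i y : `|Df j i y| <= grad_norm Df y.
Proof.
rewrite -sqrtr_sqr; apply: ler_wsqrtr.
rewrite (bigD1 j)//= (bigD1 i)//= -addrA lerDl addr_ge0//.
  by apply: sumr_ge0 => k _; exact: sqr_ge0.
by apply: sumr_ge0 => k _; apply: sumr_ge0 => l _; exact: sqr_ge0.
Qed.

Lemma grad_sum_le_norm y : grad_sum Df y <= (d * n)%:R * grad_norm Df y.
Proof.
apply: (@le_trans _ _ (\sum_(j < d) \sum_(i < n) grad_norm Df y)).
  by apply: ler_sum => j _; apply: ler_sum => i _; exact: le_partial_grad_norm.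
by rewrite !sumr_const !card_ord -mulrnA mulr_natl mulnC.
Qed.

Lemma measurable_grad_norm : measurable_fun (Omega : set (LebT R n)) (grad_norm Df : LebT R n -> R).
Proof.
apply: (measurableT_comp (f := @Num.sqrt R)).
  by apply: continuous_measurable_fun; exact: sqrt_continuous.
apply: measurable_sum => j; apply: measurable_sum => i; apply: measurable_funX.
by have [_ + _] := Wf => /(_ j i) /(loc_integrable_measurable oO).
Qed.

Lemma measurable_energy (p : nat) (lam : R) : measurable_fun (Omega : set (LebT R n))
  (fun y => grad_norm Df y ^+ p * ln (expR 1 + grad_norm Df y) `^ lam : R).
Proof.
apply: measurable_funM; first by apply: measurable_funX; exact: measurable_grad_norm.
apply: (measurableT_comp (measurable_powR lam)).
apply: (measurableT_comp (@measurable_ln R)).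
by apply: measurable_funD => //; exact: measurable_grad_norm.
Qed.

End GradNorm.

(** * The median modulus as a threshold for half of the ball *)

Section MedianModulus.
Variables (R : realType) (n d : nat) (Omega : set 'rV[R]_n).
Variables (f : 'rV[R]_n -> 'rV[R]_d) (Df : 'I_d -> 'I_n -> 'rV[R]_n -> R).
Variables (x : 'rV[R]_n) (r : R).
Hypotheses (oO : open Omega) (Wf : W11loc Omega f Df) (r0 : 0 < r).
Hypothesis CO : closed_box (x - const_mx (2 * r)) (x + const_mx (2 * r)) `<=` Omega.
Notation mu := (@lebn R n).
Let far t : set (LebT R n) := [set y | eball x r y /\ t <= enorm (f y - f x)].

Lemma measurable_far t : measurable (far t).
Proof.
have := @measurable_far_set R n d Omega f Df x (f x) r Wf r0 CO 0 t.
by rewrite /srad expr0 mulr1.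
Qed.

Let medset := [set s : R | 0 <= s /\ (mu (far s) < (2^-1)%:E * mu (eball x r))%E].

Let lb0 : lbound medset 0. Proof. by move=> s []. Qed.

Lemma below_median t : 0 <= t -> t < median_mod f x r -> ((2^-1)%:E * mu (eball x r) <= mu (far t))%E.
Proof.
move=> t0 tg; rewrite leNgt; apply/negP => h; move: tg; apply/negP; rewrite -leNgt.
by apply: ge_inf; [exists 0; exact: lb0|].
Qed.

Let half_ball_gt0 : (0 < (2^-1)%:E * mu (eball x r))%E.
Proof.
apply: mule_gt0; first by rewrite lte_fin invr_gt0.
by apply: lt_le_trans (lebn_eball_ge x r0); rewrite lte_fin exprn_gt0// mulr_gt0.
Qed.

(** An infimum over the empty set would be a default value and carry no information. The sets
    [far k%:R] decrease to the empty set inside a ball of finite measure, so one of them fills less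
    than half of it. *)
Let medset_neq0 : medset !=set0.
Proof.
have h : mu \o (fun k => far k%:R) @ \oo --> mu (\bigcap_k far k%:R).
  apply: nonincreasing_cvg_mu.
  - apply: (@le_lt_trans _ _ (mu (eball x r))); first by apply: le_outer_measure => y [].
    by rewrite -ge0_fin_numE ?measure_ge0//; exact: lebn_eball_fin_num (ltW r0).
  - by move=> k; exact: measurable_far.
  - by apply: bigcap_measurable => // k _; exact: measurable_far.
  - move=> k l kl; apply/subsetPset => y [By ly]; split=> //.
    by rewrite (le_trans _ ly)// ler_nat.
have e : \bigcap_k far k%:R = set0.
  apply/seteqP; split=> // y hy; have [_] := hy (Num.bound (enorm (f y - f x))) I.
  by rewrite leNgt archi_boundP// enorm_ge0.
rewrite e measure0 in h.
have [K _ hK] := h _ (open_ereal_lt' half_ball_gt0).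
exists K%:R; split; [exact: ler0n|exact: (hK K (leqnn K))].
Qed.

Lemma median_mod_ge0 : 0 <= median_mod f x r.
Proof. exact: lb_le_inf medset_neq0 lb0. Qed.

Lemma above_median t : median_mod f x r < t -> (mu (far t) < (2^-1)%:E * mu (eball x r))%E.
Proof.
move=> gt; have [s [s0 hs] st] := inf_lt medset_neq0 gt.
apply: le_lt_trans hs; apply: le_outer_measure => y [By ty]; split=> //.
by rewrite (le_trans _ ty)// ltW.
Qed.

End MedianModulus.

(** * The energy integral *)

Section Energy.
Variables (R : realType) (n d : nat) (Omega : set 'rV[R]_n) (lam : R).
Variables (f : 'rV[R]_n -> 'rV[R]_d) (Df : 'I_d -> 'I_n -> 'rV[R]_n -> R).
Notation mu := (@lebn R n).
Hypotheses (n2 : (2 <= n)%N) (oO : open Omega) (Wf : W11loc Omega f Df) (lam0 : 0 <= lam).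

Definition energy (y : LebT R n) : R := grad_norm Df y ^+ n * ln (expR 1 + grad_norm Df y) `^ lam.

Hypothesis iE : (\int[mu]_(y in (Omega : set (LebT R n))) (energy y)%:E < +oo)%E.

Lemma ln_grad_ge1 y : 1 <= ln (expR 1 + grad_norm Df y).
Proof.
have h : expR 1 <= expR 1 + grad_norm Df y by rewrite lerDl grad_norm_ge0.
rewrite -[leLHS](expRK 1) ler_ln// posrE ?expR_gt0//.
exact: lt_le_trans (expR_gt0 1) h.
Qed.

Lemma energy_ge0 y : 0 <= energy y.
Proof. by rewrite mulr_ge0 ?powR_ge0// exprn_ge0// grad_norm_ge0. Qed.

Lemma grad_norm_pow_le_energy y : grad_norm Df y ^+ n <= energy y.
Proof.
rewrite ler_peMr ?exprn_ge0 ?grad_norm_ge0//.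
by have := ler_powR (ln_grad_ge1 y) lam0; rewrite powRr0.
Qed.

Lemma grad_sum_ge0 y : 0 <= grad_sum Df y.
Proof. by apply: sumr_ge0 => j _; exact: sumr_ge0. Qed.

Lemma grad_sum_pow_le y : grad_sum Df y ^+ n <= (d * n)%:R ^+ n * grad_norm Df y ^+ n.
Proof.
rewrite -exprMn ler_pXn2r ?nnegrE ?grad_sum_ge0 ?mulr_ge0 ?grad_norm_ge0 ?(leq_trans _ n2)//.
exact: grad_sum_le_norm.
Qed.

Lemma integrable_energy : mu.-integrable (Omega : set (LebT R n)) (EFin \o energy).
Proof.
apply/integrableP; split; first by apply/measurable_EFinP; exact: measurable_energy oO Wf n lam.
by under eq_integral => y _ do rewrite /= ger0_norm ?energy_ge0//.
Qed.

Variables (x : 'rV[R]_n) (rho : R).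
Hypothesis rho0 : 0 < rho.
Hypothesis CO : closed_box (x - const_mx (2 * rho)) (x + const_mx (2 * rho)) `<=` Omega.

Lemma centred_cube_sub : centred_cube x rho `<=` Omega.
Proof.
apply: subset_trans CO => y /cubeE yQ i; have := yQ i; rewrite !mxE => /andP[h1 h2].
by apply/andP; split; move: h1 h2 rho0; lra.
Qed.

Lemma measurable_centred_cube : measurable (centred_cube x rho).
Proof. exact: measurable_cube. Qed.

Lemma integrable_grad_sum_pow : mu.-integrable (centred_cube x rho) (EFin \o (fun y => grad_sum Df y ^+ n)).
Proof.
have mQ := measurable_centred_cube.
have mO : measurable (Omega : set (LebT R n)) by exact: measurable_open.
have iEQ := integrableS mO mQ centred_cube_sub integrable_energy.
apply: (@le_integrable _ _ _ mu _ mQ _ (EFin \o (fun y => (d * n)%:R ^+ n * energy y))).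
- apply/measurable_EFinP; apply: measurable_funX.
  apply: (measurable_funS mO centred_cube_sub).
  apply: measurable_sum => j; apply: measurable_sum => i.
  apply: (measurableT_comp (@normr_measurable R setT)).
  by have [_ + _] := Wf => /(_ j i) /(loc_integrable_measurable oO).
- move=> y _; rewrite /= lee_fin ger0_norm ?exprn_ge0 ?grad_sum_ge0//.
  apply: le_trans (ler_norm _); apply: (le_trans (grad_sum_pow_le y)).
  by rewrite ler_wpM2l ?exprn_ge0// grad_norm_pow_le_energy.
- exact: (integrableZl mQ ((d * n)%:R ^+ n) iEQ).
Qed.

Variables (c : 'rV[R]_d) (s : R).
Hypothesis s0 : 0 < s.

(** A is the constant by which the logarithm in the energy pays for the factor l^(n-1) where the
    gradient is at least b. The integrand [1 + energy] gives all kinds of scales the same form; its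
    constant part is what carries [near_part]. *)
Lemma scale_estimate_energy l (b A : R) : 0 <= b ->
  ((2^-1)%:E * mu (eball x rho) <= mu [set y | eball x rho y /\ (s <= enorm (f y - c))%R])%E ->
  (mu [set y | eball x (srad rho l) y /\ (s / 2 <= enorm (f y - c))%R] <
    (2^-1)%:E * mu (eball x (srad rho l)))%E ->
  scale_const R n * 2 ^+ (n + 4) * b * rho <= s ->
  (forall y, b <= grad_sum Df y -> l.+1%:R ^+ n.-1 * grad_sum Df y ^+ n <= A * energy y) -> 0 <= A ->
  exists D : set (LebT R n), [/\ measurable D, D `<=` centred_cube x rho,
    forall y, D y -> enorm (f y - c) < 2 * s &
    ((s ^+ n)%:E <= ((8 * scale_const R n * 2 ^+ n) ^+ n * A)%:E * \int[mu]_(y in D) (1 + energy y)%:E)%E].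
Proof.
move=> b0 h1 h2 bs hA A0.
have hs := scale_estimate oO Wf n2 rho0 s0 CO b0 h1 h2 bs integrable_grad_sum_pow.
set D := _ `&` _ in hs; set K := (8 * scale_const R n * 2 ^+ n) ^+ n in hs *.
have mD : measurable D.
  by have := @measurable_low_steep R n d Omega f Df x c rho s Wf rho0 CO b; rewrite /srad expr0 mulr1.
have DQ : D `<=` centred_cube x rho by move=> y [[]].
have mO : measurable (Omega : set (LebT R n)) by exact: measurable_open.
have DO : D `<=` Omega by exact: subset_trans DQ centred_cube_sub.
exists D; split=> //; first by move=> y [[]].
have iED := integrableS mO mD DO integrable_energy.
have iGD := integrableS measurable_centred_cube mD DQ integrable_grad_sum_pow.
have K0 : 0 <= K.
  by rewrite exprn_ge0// !mulr_ge0// /scale_const addr_ge0// !mulr_ge0// exprn_ge0// divr_ge0.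
have h : s ^+ n <= K * A * \int[mu]_(y in D) energy y.
  apply: (le_trans hs); rewrite -!mulrA ler_wpM2l//.
  rewrite -(RintegralZl _ mD iGD) -(RintegralZl _ mD iED).
  apply: le_Rintegral => //.
  - exact: (integrableZl mD (l.+1%:R ^+ n.-1) iGD).
  - exact: (integrableZl mD A iED).
  - by move=> y [_ by_]; exact: hA.
apply: (@le_trans _ _ ((K * A)%:E * (\int[mu]_(y in D) energy y)%:E)%E).
  by rewrite -EFinM lee_fin.
rewrite lee_wpmul2l ?lee_fin ?mulr_ge0// /Rintegral fineK; last exact: integrable_fin_num.
apply: ge0_le_integral; [exact: mD| |exact: measurable_int iED| |].
- by move=> y _; rewrite lee_fin energy_ge0.
- apply/measurable_EFinP; apply: measurable_funD => //.
  by apply/measurable_EFinP; exact: measurable_int iED.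
- by move=> y _; rewrite lee_fin lerDr.
Qed.

End Energy.

Lemma closed_box_sub_eball (R : realType) (n : nat) (x : 'rV[R]_n) (t e : R) :
  0 <= t -> n%:R * t < e -> closed_box (x - const_mx t) (x + const_mx t) `<=` eball x e.
Proof.
move=> t0 te y yb; apply: le_lt_trans te; apply: (le_trans (enorm_le_sum _)).
apply: (@le_trans _ _ (\sum_(i < n) t)); last by rewrite sumr_const card_ord mulr_natl.
apply: ler_sum => i _; have := yb i; rewrite !mxE => /andP[h1 h2].
by rewrite ler_norml; apply/andP; split; move: h1 h2; lra.
Qed.

Lemma powR_le_ln_gain (R : realType) (lam t : R) k : 0 <= lam -> 0 <= t -> (3 / 2) ^+ k <= t ->
  k%:R `^ lam <= (ln (3 / 2))^-1 `^ lam * ln (expR 1 + t) `^ lam.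
Proof.
move=> lam0 t0 kt; have a0 : 0 < ln (3 / 2 : R) by rewrite ln_gt0// ltr_pdivlMr// mul1r ltr_nat.
have h : k%:R * ln (3 / 2) <= ln (expR 1 + t).
  rewrite -ln_powR powR_mulrn ?divr_ge0//.
  have p0 : 0 < (3 / 2 : R) ^+ k by rewrite exprn_gt0// divr_gt0.
  have h : (3 / 2 : R) ^+ k <= expR 1 + t by rewrite (le_trans kt)// lerDr expR_ge0.
  by rewrite ler_ln// posrE; exact: lt_le_trans h.
have l0 : 0 <= ln (expR 1 + t) by apply: le_trans h; rewrite mulr_ge0// ltW.
rewrite -powRM ?invr_ge0 ?(ltW a0)//.
apply: ge0_ler_powR => //; rewrite ?nnegrE//; first by rewrite mulr_ge0// invr_ge0 ltW.
by rewrite mulrC ler_pdivlMr.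
Qed.

(** * Good scales at a point of N *)

Section LocalScale.
Variables (R : realType) (n d : nat) (Omega : set 'rV[R]_n) (lam : R).
Variables (f : 'rV[R]_n -> 'rV[R]_d) (Df : 'I_d -> 'I_n -> 'rV[R]_n -> R).
Notation mu := (@lebn R n).
Notation E := (energy lam Df).
Hypotheses (n2 : (2 <= n)%N) (d1 : (1 <= d)%N) (oO : open Omega) (Wf : W11loc Omega f Df).
Hypotheses (lam0 : 0 <= lam) (lam1 : lam <= n.-1%:R).
Hypothesis iE : (\int[mu]_(y in (Omega : set (LebT R n))) (E y)%:E < +oo)%E.
Variables (x : 'rV[R]_n) (R0 nu : R).
Hypotheses (R00 : 0 < R0) (R01 : R0 < 1) (nu0 : 0 < nu) (BO : eball x R0 `<=` Omega).
Hypothesis med : forall r, 0 < r <= R0 ->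
  (0 < 1 - lam / (n.-1)%:R ->
     median_mod f x r <= expR (- (nu * (ln r^-1) `^ (1 - lam / (n.-1)%:R))))
  /\ (1 - lam / (n.-1)%:R = 0 -> median_mod f x r <= (ln r^-1) `^ (- nu)).

Let n0 : (0 < n)%N. Proof. exact: leq_trans n2. Qed.
Let n10 : 0 < n.-1%:R :> R. Proof. by rewrite ltr0n -ltnS prednK. Qed.
Let beta := lam / n.-1%:R.
Let beta0 : 0 <= beta. Proof. by rewrite divr_ge0. Qed.
Let beta1 : beta <= 1. Proof. by rewrite ler_pdivrMr// mul1r. Qed.

(** Closed boxes of half side 2 rho0 fit into [eball x R0], since n times 2 rho0 is R0 / 2. *)
Let rho0 := R0 / (4 * n%:R).
Let n_gt0 : 0 < n%:R :> R. Proof. by rewrite ltr0n. Qed.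
Let rho00 : 0 < rho0. Proof. by rewrite divr_gt0// mulr_gt0. Qed.
Let rhoR : rho0 <= R0.
Proof.
rewrite ler_pdivrMr ?mulr_gt0// ler_peMr ?(ltW R00)//.
by rewrite -natrM ler1n muln_gt0.
Qed.
Let rho1 : rho0 < 1. Proof. exact: le_lt_trans rhoR R01. Qed.

Let r k := srad rho0 k.
Let r0 k : 0 < r k. Proof. exact: rad_gt0. Qed.
Let rle k : r k <= rho0. Proof. exact: rad_le. Qed.
Let rD k l : srad (r k) l = r (k + l)%N. Proof. by rewrite /r /srad exprD mulrA. Qed.

Let CO k : closed_box (x - const_mx (2 * r k)) (x + const_mx (2 * r k)) `<=` Omega.
Proof.
apply: subset_trans BO; apply: closed_box_sub_eball; first by rewrite mulr_ge0// ltW.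
have h : n%:R * (2 * r k) <= n%:R * (2 * rho0) by rewrite ler_pM2l// ler_pM2l.
apply: (le_lt_trans h); rewrite /rho0.
have -> : n%:R * (2 * (R0 / (4 * n%:R))) = R0 / 2 by field; rewrite gt_eqF.
by rewrite ltr_pdivrMr// ltr_pMr// ltr1n.
Qed.

Let g k := median_mod f x (r k).
Let L k := ln (r k)^-1.

Let ln16 : 0 < ln (16 : R). Proof. by rewrite ln_gt0// ltr1n. Qed.

(** As ln (1 / r k) = ln (1 / rho0) + k ln 16, it suffices that rho0 < 1, which comes from R0 <
    1. *)
Let cL k : ln 16 * k%:R <= L k.
Proof.
rewrite /L /r /srad invfM -exprVn invrK lnM ?posrE ?invr_gt0 ?exprn_gt0//.
rewrite -[X in _ + ln X]powR_mulrn// ln_powR mulrC lerDr ln_ge0// invf_ge1// ltW//.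
Qed.

Let rR0 k : 0 < r k <= R0. Proof. by rewrite r0 (le_trans (rle k)). Qed.

Let gpos k : 0 < 1 - beta -> g k <= expR (- (nu * L k `^ (1 - beta))).
Proof. by have [+ _] := med (rR0 k). Qed.

Let gzero k : 1 - beta = 0 -> g k <= L k `^ (- nu).
Proof. by have [_] := med (rR0 k). Qed.

Let far_half k t : 0 <= t -> t < g k ->
  ((2^-1)%:E * mu (eball x (r k)) <= mu [set y | eball x (r k) y /\ (t <= enorm (f y - f x))%R])%E.
Proof. exact: below_median. Qed.

Let far_lt_half k t : g k < t ->
  (mu [set y | eball x (r k) y /\ (t <= enorm (f y - f x))%R] < (2^-1)%:E * mu (eball x (r k)))%E.
Proof. exact: (above_median Wf (r0 k) (@CO k)). Qed.

(** More than half of the ball about x is sent within r k of f x. Its volume, comparable to (r k)^n,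
    already pays for the target ball; no gradient enters, and the case g k = 0 is included. *)
Let near_part k (U : set 'rV[R]_n) : g k < r k -> centred_cube x (r k) `<=` U -> U `<=` Omega ->
  exists D : set (LebT R n), [/\ measurable D, D `<=` U,
    forall y, D y -> enorm (f y - f x) < 2 * r k &
    ((r k ^+ n)%:E <= (2 * (n.+1%:R / 2) ^+ n)%:E * \int[mu]_(y in D) (1 + E y)%:E)%E].
Proof.
move=> gr QU UO; set S := [set y | eball x (r k) y /\ r k <= enorm (f y - f x)].
have mS : measurable (S : set (LebT R n)) by exact: (measurable_far Wf (r0 k) (@CO k)).
have mB : measurable (eball x (r k) : set (LebT R n)) by exact: measurable_eball.
pose D : set (LebT R n) := eball x (r k) `\` S.
have mD : measurable D by exact: measurableD.
have DU : D `<=` U by move=> y [By _]; apply: QU; exact: eball_sub_cube.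
have mO : measurable (Omega : set (LebT R n)) by exact: measurable_open.
have DO : D `<=` Omega by exact: subset_trans UO.
exists D; split=> //.
  move=> y [By nS]; apply: (@lt_trans _ _ (r k)); last by rewrite ltr_pMl// ltr1n.
  by rewrite ltNge; apply/negP => h; apply: nS.
have Bfin := lebn_eball_fin_num x (ltW (r0 k)).
have hD : ((2^-1)%:E * mu (eball x (r k)) <= mu D)%E.
  have Sfin : mu S \is a fin_num.
    rewrite ge0_fin_numE ?measure_ge0//; apply: (@le_lt_trans _ _ (mu (eball x (r k)))).
      by apply: le_outer_measure => y [].
    by rewrite -ge0_fin_numE ?measure_ge0.
  have Blt : (mu (eball x (r k)) < +oo)%E by rewrite -ge0_fin_numE ?measure_ge0.
  have DE : (mu D = mu (eball x (r k)) - mu S)%E.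
    by have := measureD mB mS Blt; rewrite setIidr//; move=> y [].
  by rewrite DE; apply: half_le_sub => //; exact: far_lt_half.
apply: (@le_trans _ _ ((2 * (n.+1%:R / 2) ^+ n)%:E * mu D)%E).
  apply: (@le_trans _ _ ((2 * (n.+1%:R / 2) ^+ n)%:E * ((2^-1)%:E * ((2 / n.+1%:R * r k) ^+ n)%:E))%E).
    rewrite -!EFinM lee_fin.
    have {1}-> : r k = (n.+1%:R / 2) * (2 / n.+1%:R * r k) by rewrite !mulrA divfK// mulfV// mul1r.
    rewrite exprMn le_eqVlt; apply/orP; left; apply/eqP.
    by move: ((_ / 2) ^+ n) ((_ * r k) ^+ n) => p q; field.
  rewrite lee_wpmul2l ?lee_fin ?mulr_ge0 ?exprn_ge0 ?divr_ge0//.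
  by apply: le_trans hD; rewrite lee_wpmul2l ?lee_fin//; exact: lebn_eball_ge.
rewrite lee_wpmul2l ?lee_fin ?mulr_ge0 ?exprn_ge0 ?divr_ge0//.
rewrite -[leLHS]mul1e -(integral_cst mu mD 1); apply: ge0_le_integral; [exact: mD|by []|exact: measurable_cst| |].
- apply/measurable_EFinP; apply: measurable_funD => //.
  by apply: (measurable_funS mO DO); exact: measurable_energy oO Wf n lam.
- by move=> y _; rewrite lee_fin lerDl energy_ge0.
Qed.

Let sc_gt0 : 0 < scale_const R n.
Proof.
rewrite /scale_const ltr_pwDl ?mulr_ge0 ?exprn_ge0 ?divr_ge0//.
by rewrite !mulr_gt0 ?exprn_gt0.
Qed.

(** The level s = g k / 2 lies below the median at scale k, and s / 2 = g k / 4 lies above the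
    median at scale k + l: these are the two half-ball conditions of the scale estimate. *)
Let far_part k l (b A : R) (U : set 'rV[R]_n) : 0 < g k -> g (k + l)%N < g k / 4 -> 0 <= b ->
  scale_const R n * 2 ^+ (n + 4) * b * r k <= g k / 2 ->
  (forall y, b <= grad_sum Df y -> l.+1%:R ^+ n.-1 * grad_sum Df y ^+ n <= A * E y) -> 0 <= A ->
  centred_cube x (r k) `<=` U ->
  exists D : set (LebT R n), [/\ measurable D, D `<=` U,
    forall y, D y -> enorm (f y - f x) < 2 * (g k / 2) &
    (((g k / 2) ^+ n)%:E <=
      ((8 * scale_const R n * 2 ^+ n) ^+ n * A)%:E * \int[mu]_(y in D) (1 + E y)%:E)%E].
Proof.
move=> g0 gl b0 hb hA A0 QU; have s0 : 0 < g k / 2 by rewrite divr_gt0.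
have h1 := far_half (ltW s0) (_ : g k / 2 < g k).
have s2 : g k / 2 < g k by rewrite ltr_pdivrMr// ltr_pMr// ltr1n.
have s4 : g k / 2 / 2 = g k / 4 by rewrite -mulrA -invfM -natrM.
have h2 := @far_lt_half (k + l)%N (g k / 2 / 2); rewrite s4 -rD in h2.
rewrite -s4 in gl h2.
have [D [mD DQ Df2 sD]] := scale_estimate_energy n2 oO Wf lam0 iE (r0 k) (@CO k) s0 b0
  (h1 s2) (h2 gl) hb hA A0.
by exists D; split=> //; exact: subset_trans DQ QU.
Qed.

Let cube_small (U : set 'rV[R]_n) : open U -> U x ->
  exists K, forall k, (K <= k)%N -> centred_cube x (r k) `<=` U.
Proof.
move=> oU Ux; have [e e0 eU] := nbhs_rVP (open_nbhs_nbhs (conj oU Ux)).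
have [K hK] := @geometric_small R 16^-1 e rho0 e0 ltac:(by rewrite invr_ge0)
  ltac:(by rewrite invf_lt1// ltr1n).
exists K => k /hK h y /cubeE yQ; apply: eU => i; have := yQ i; rewrite !mxE -/(r k) => /andP[h1 h2].
have {}h : r k < e by exact: h.
by rewrite ltr_norml; apply/andP; split; move: h h1 h2; lra.
Qed.

(** C adds the constants of the three alternatives of [good_scale] and depends on x through [D0]
    alone, not on delta or U. These only determine how far out the scale is searched: the cube must
    lie in U, and g k and r k must be at most delta. *)
Lemma local_scale : exists C : R, forall (delta : R) (U : set 'rV[R]_n), 0 < delta ->
  open U -> U x -> U `<=` Omega -> exists (s : R) (D : set (LebT R n)),
  [/\ 0 < s <= delta, measurable D, D `<=` U,
    forall y, D y -> enorm (f y - f x) < 2 * s &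
    ((s ^+ n)%:E <= C%:E * \int[mu]_(y in D) (1 + E y)%:E)%E].
Proof.
have [D0 D00 [C5 decay]] := scale_seq_decay nu0 ln16 beta0 beta1 cL gpos gzero.
pose c1 : R := (2 * (scale_const R n * 2 ^+ (n + 4)))^-1.
have c10 : 0 < c1 by rewrite invr_gt0 mulr_gt0// mulr_gt0// exprn_gt0.
have dn0 : 0 < (d * n)%:R :> R by rewrite ltr0n muln_gt0 d1.
pose c2 := c1 / (d * n)%:R; have c20 : 0 < c2 by rewrite divr_gt0.
pose A1 : R := 2 ^+ n.-1 * (d * n)%:R ^+ n.
pose A2 : R := (D0 + 2) ^+ n.-1 * (ln (3 / 2))^-1 `^ lam * (d * n)%:R ^+ n.
have A10 : 0 <= A1 by rewrite mulr_ge0// exprn_ge0.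
have A20 : 0 <= A2 by rewrite !mulr_ge0 ?powR_ge0 ?exprn_ge0 ?addr_ge0.
pose K1 := (8 * scale_const R n * 2 ^+ n) ^+ n.
have K10 : 0 <= K1 by rewrite exprn_ge0// !mulr_ge0// ltW.
pose K2 : R := 2 * (n.+1%:R / 2) ^+ n.
have K20 : 0 <= K2 by rewrite mulr_ge0// exprn_ge0// divr_ge0.
exists (K2 + K1 * (A1 + A2)) => delta U delta0 oU Ux UO.
have [k1 hk1] := cube_small oU Ux.
have [k2 hk2] := median_bound_vanishes nu0 ln16 beta1 cL gpos gzero delta0.
have [k3 hk3] := @geometric_small R 16^-1 delta rho0 delta0 ltac:(by rewrite invr_ge0)
  ltac:(by rewrite invf_lt1// ltr1n).
(* Once (3/4)^k < c2, the bound c2 2^k for |Df| contains (3/2)^k, which is free of constants and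
   ready for [powR_le_ln_gain]. *)
have [k4 hk4] := @geometric_small R (3 / 4) c2 1 c20 ltac:(by rewrite divr_ge0)
  ltac:(by rewrite ltr_pdivrMr// mul1r ltr_nat).
have weaken (C' s : R) (D : set (LebT R n)) : C' <= K2 + K1 * (A1 + A2) ->
    ((s ^+ n)%:E <= C'%:E * \int[mu]_(y in D) (1 + E y)%:E)%E ->
    ((s ^+ n)%:E <= (K2 + K1 * (A1 + A2))%:E * \int[mu]_(y in D) (1 + E y)%:E)%E.
  move=> CC h; apply: (le_trans h); rewrite lee_wpmul2r ?lee_fin//.
  by apply: integral_ge0 => y _; rewrite lee_fin addr_ge0// energy_ge0.
have [k kK hk] := @good_scale R g r (scale_seq D0 beta) C5 r0 (leq_scale_seq D0 beta) decay
  (maxn (maxn k1 k2) (maxn k3 k4)).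
move: kK; rewrite !geq_max => /andP[/andP[kk1 kk2] /andP[kk3 kk4]].
have QU := hk1 _ kk1.
have gd : g k / 2 <= delta.
  have gk0 : 0 <= g k by exact: (median_mod_ge0 Wf (r0 k) (@CO k)).
  by apply: le_trans (hk2 _ kk2); rewrite ler_pdivrMr// ler_peMr// ler1n.
case: hk => [gr|[g0 g4]|[g8 [i ki g4]]].
- have [D [mD DU Dr sD]] := near_part gr QU UO.
  exists (r k), D; split=> //.
    by rewrite r0 /= ltW//; exact: hk3 kk3.
  by apply: weaken sD; rewrite lerDl mulr_ge0// addr_ge0.
(* Between consecutive scales l = 1, so the loss 2^(n-1) is a constant: the threshold b = 0 is
   admissible and no logarithm has to pay. *)
- have hA y : 0 <= grad_sum Df y -> 2%:R ^+ n.-1 * grad_sum Df y ^+ n <= (A1 + A2) * E y.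
    move=> _; apply: (@le_trans _ _ (A1 * E y)).
      rewrite /A1 -mulrA ler_wpM2l ?exprn_ge0//; apply: (le_trans (grad_sum_pow_le Df n2 y)).
      by rewrite ler_wpM2l ?exprn_ge0//; exact: grad_norm_pow_le_energy.
    by rewrite ler_wpM2r ?energy_ge0// lerDl.
  have hb : scale_const R n * 2 ^+ (n + 4) * 0 * r k <= g k / 2.
    by rewrite mulr0 mul0r divr_ge0// ltW.
  rewrite -addn1 in g4.
  have [D [mD DU Dr sD]] := far_part g0 g4 (lexx 0) hb hA (addr_ge0 A10 A20) QU.
  exists (g k / 2), D; split=> //; first by rewrite gd divr_gt0.
  by apply: weaken sD; rewrite lerDr.
have g0 : 0 < g k by apply: le_lt_trans g8; rewrite exprn_ge0.
pose l := (scale_seq D0 beta i.+1 - scale_seq D0 beta i)%N.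
have kl : (k + l)%N = scale_seq D0 beta i.+1.
  by rewrite ki subnKC// ltnW// scale_seq_lt.
rewrite -kl in g4.
(* By the choice of c1 the left side of [hb] is rho0 8^-k / 2, below g k / 2 at this scale. Still b
   grows exponentially, so where the gradient exceeds it k is at most a multiple of the
   logarithm. *)
pose b : R := c1 * 2 ^+ k.
have b0 : 0 <= b by rewrite mulr_ge0 ?exprn_ge0// ltW.
have hb : scale_const R n * 2 ^+ (n + 4) * b * r k <= g k / 2.
  have -> : scale_const R n * 2 ^+ (n + 4) * b * r k = rho0 * 8^-1 ^+ k / 2.
    rewrite /b /c1 /r /srad.
    have -> : (8^-1 : R) = 2 * 16^-1 by field.
    rewrite exprMn; field.
    by rewrite !gt_eqF// exprn_gt0.
  rewrite ler_pM2r ?invr_gt0//; apply: le_trans (ltW g8).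
  by rewrite ler_piMl ?exprn_ge0// ltW.
have hA y : b <= grad_sum Df y -> l.+1%:R ^+ n.-1 * grad_sum Df y ^+ n <= (A1 + A2) * E y.
  move=> by_; apply: (@le_trans _ _ (A2 * E y)); last first.
    by rewrite ler_wpM2r ?energy_ge0// lerDr.
  have gn0 := grad_norm_ge0 Df y.
  have hk : (3 / 2) ^+ k <= grad_norm Df y.
    apply: (@le_trans _ _ (c2 * 2 ^+ k)).
      have -> : (3 / 2 : R) = 3 / 4 * 2 by field.
      rewrite exprMn ler_pM2r ?exprn_gt0//.
      by apply: ltW; have := hk4 _ kk4; rewrite mul1r.
    rewrite /c2 mulrAC ler_pdivrMr// -/b mulrC.
    exact: le_trans by_ (grad_sum_le_norm Df y).
  (* Here l + 1 <= (D0 + 2) k^beta by the construction of the scales, and beta (n - 1) = lam matches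
     the loss with the power of the logarithm in the energy. *)
  have hl : l.+1%:R ^+ n.-1 <= (D0 + 2) ^+ n.-1 * k%:R `^ lam.
    have := scale_seq_step_le i D00 beta0; rewrite -/l -ki => hl.
    have -> : k%:R `^ lam = (k%:R `^ beta) ^+ n.-1.
      by rewrite -[RHS]powR_mulrn ?powR_ge0// -powRrM divfK// gt_eqF.
    rewrite -exprMn; apply: lerXn2r hl; rewrite nnegrE//.
    by rewrite mulr_ge0 ?powR_ge0// addr_ge0.
  have hg := powR_le_ln_gain lam0 gn0 hk.
  have D2 : 0 <= (D0 + 2) ^+ n.-1 by rewrite exprn_ge0// addr_ge0.
  have h3 := le_trans hl (ler_wpM2l D2 hg).
  have l0 : 0 <= l.+1%:R ^+ n.-1 :> R by rewrite exprn_ge0.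
  have gs0 : 0 <= grad_sum Df y ^+ n by rewrite exprn_ge0// grad_sum_ge0.
  apply: (le_trans (ler_pM l0 gs0 h3 (grad_sum_pow_le Df n2 y))).
  by rewrite /A2 /energy le_eqVlt; apply/orP; left; apply/eqP; ring.
have [D [mD DU Dr sD]] := far_part g0 g4 b0 hb hA (addr_ge0 A10 A20) QU.
exists (g k / 2), D; split=> //; first by rewrite gd divr_gt0.
by apply: weaken sD; rewrite lerDr.
Qed.

End LocalScale.

(** * Covering in the target space *)

Section Vitali.
Variables (R : realType) (d : nat) (T : Type).
Implicit Types (z : 'rV[R]_d) (D : set T).

(** Balls of the sup norm: their conditions are coordinatewise, which gives rational points and
    diameters at once, and they contain the Euclidean balls of the same radius. *)
Definition supball z (r : R) : set 'rV[R]_d :=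
  [set w | forall i, `|w ord0 i - z ord0 i| < r].

Lemma supball_meet z z' r r' : supball z r `&` supball z' r' !=set0 ->
  supball z' (r' + r) z.
Proof.
move=> [w [wz wz']] i; rewrite (le_lt_trans (ler_distD (w ord0 i) _ _))//.
by rewrite addrC ltrD// distrC.
Qed.

(** Every ball contains a rational point, and disjointness makes the choice of such a point
    injective. *)
Lemma countable_disjoint_supball D (a : T -> 'rV[R]_d) (r : T -> R) :
  (forall t, D t -> 0 < r t) -> trivIset D (fun t => supball (a t) (r t)) -> countable D.
Proof.
move=> r0 tD; have hq t i : {q : rat | D t -> `|ratr q - a t ord0 i| < r t}.
  apply/cid; have [Dt|nDt] := pselect (D t); last by exists 0.
  have : a t ord0 i < a t ord0 i + r t by rewrite ltrDl r0.
  move=> /rat_in_itvoo[q]; rewrite in_itv/= => /andP[aq qa]; exists q => _.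
  by rewrite gtr0_norm ?subr_gt0// ltrBlDl.
pose q t : 'rV[rat]_d := \row_i sval (hq t i).
apply/countable_injP; exists (pickle \o q) => t t' Dt Dt' /(pcan_inj pickleK) qq.
rewrite !inE in Dt Dt'.
apply: tD => //; exists (\row_i ratr (q t ord0 i)); split=> i; rewrite mxE.
  by rewrite mxE; case: (hq t i) => p /= h; exact: h.
by rewrite qq mxE; case: (hq t' i) => p /= h; exact: h.
Qed.

(* Zorn's lemma for the subfamilies satisfying the last clause below; a ball disjoint from a maximal
   such subfamily would allow adding one whose radius is more than half the supremum. *)
Lemma vitali_supball (V : set T) (a : T -> 'rV[R]_d) (r : T -> R) (M : R) :
  (forall t, V t -> 0 < r t <= M) ->
  exists D, [/\ D `<=` V, countable D, trivIset D (fun t => supball (a t) (r t)) &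
    forall t, V t -> exists2 t', D t' & supball (a t') (3 * r t') (a t)].
Proof.
move=> rM; pose B t := supball (a t) (r t).
pose good D := [/\ D `<=` V, trivIset D B &
  forall t t', V t -> D t' -> B t `&` B t' !=set0 ->
    exists t2, [/\ D t2, B t `&` B t2 !=set0 & r t < 2 * r t2]].
have [F Fgood Ftot|D [[DV tD gD] Dmax]] := @Zorn_bigcup T good.
  split.
  - by move=> t [D FD Dt]; have [+ _ _] := Fgood _ FD; apply.
  - move=> t t' [D FD Dt] [D' FD' Dt'].
    have [/(_ _ Dt) D't|/(_ _ Dt') Dt2] := Ftot _ _ FD FD'.
      by have [_ + _] := Fgood _ FD'; apply.
    by have [_ + _] := Fgood _ FD; apply.
  - move=> t t' Vt [D FD Dt'] m; have [_ _ g] := Fgood _ FD.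
    by have [t2 [Dt2 m2 r2]] := g _ _ Vt Dt' m; exists t2; split=> //; exists D.
have r0 t : V t -> 0 < r t by move=> /rM/andP[].
have Bself t : V t -> B t `&` B t !=set0.
  by move=> Vt; exists (a t); split=> i; rewrite subrr normr0 r0.
exists D; split=> //.
  by apply: (countable_disjoint_supball _ tD) => t /DV/r0.
move=> t Vt; have [[t1 [Dt1 m1]]|nomeet] := pselect (exists t1, D t1 /\ B t `&` B t1 !=set0).
  have [t2 [Dt2 m2 r2]] := gD _ _ Vt Dt1 m1; exists t2 => // i.
  by apply: lt_le_trans (supball_meet m2 i) _; move: (r t) (r t2) r2 => p q; lra.
exfalso; pose W := [set t | V t /\ forall t1, D t1 -> ~ (B t `&` B t1 !=set0)].
have Wt : W t by split=> // t1 Dt1 m; apply: nomeet; exists t1.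
have rW : has_sup (r @` W).
  by split; [exists (r t); exists t|exists M => _ [t1 [Vt1 _] <-]; have /andP[] := rM _ Vt1].
have s0 : 0 < sup (r @` W).
  by apply: lt_le_trans (r0 _ Vt) _; apply: ub_le_sup; [case: rW|exists t].
have [_ [t1 [Vt1 Wt1] <-] st1] := sup_adherent (divr_gt0 s0 (ltr0n R 2)) rW.
apply: (Dmax (D `|` [set t1])).
  split; first by move=> t' ?; left.
  by move=> /(_ t1 (or_intror erefl)) Dt1; exact: (Wt1 _ Dt1 (Bself _ Vt1)).
split.
- by move=> t' [/DV//|->].
- move=> t' t2 [Dt'|->] [Dt2|->] // m; first exact: tD.
    by exfalso; apply: (Wt1 _ Dt'); rewrite setIC.
  by exfalso; exact: (Wt1 _ Dt2).
- move=> t2 t' Vt2 Dt' m.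
  have [[t3 [Dt3 m3]]|no3] := pselect (exists t3, D t3 /\ B t2 `&` B t3 !=set0).
    by have [t4 [Dt4 m4 r4]] := gD _ _ Vt2 Dt3 m3; exists t4; split=> //; left.
  case: Dt' m => [Dt' m|-> m]; first by exfalso; apply: no3; exists t'.
  exists t1; split=> //; first by right.
  have rs : r t2 <= sup (r @` W).
    apply: ub_le_sup; [by case: rW|exists t2 => //; split=> // t3 Dt3 m3].
    by apply: no3; exists t3.
  apply: le_lt_trans rs _.
  move: st1; move: (sup _) (r t1) => p q; lra.
Qed.

End Vitali.

(** * Hausdorff measure of the image *)

Section HausdorffCover.
Variables (R : realType) (n d : nat).
Local Open Scope ereal_scope.
Notation mu := (@lebn R n).

Lemma ediam_set0 : ediam (@set0 'rV[R]_d) = 0.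
Proof.
rewrite /ediam; have -> : [set z | exists x y, [/\ @set0 'rV[R]_d x, set0 y &
    z = (enorm (x - y))%:E]] = set0 by apply/seteqP; split=> z // [x [y []]].
by rewrite setU0 ereal_sup1.
Qed.

Lemma ediam_ge0 (C : set 'rV[R]_d) : 0 <= ediam C.
Proof. by apply: ereal_sup_ubound; left. Qed.

Lemma ediam_supball z (r : R) : (0 <= r)%R -> ediam (supball z r : set 'rV[R]_d) <= (d%:R * (2 * r))%:E.
Proof.
move=> r0; apply: ge_ereal_sup => _ [->|[x [y [xz yz ->]]]].
  by rewrite lee_fin !mulr_ge0.
rewrite lee_fin (le_trans (enorm_le_sum _))//.
apply: (@le_trans _ _ (\sum_(i < d) 2 * r)%R); last by rewrite sumr_const card_ord -[leLHS]mulr_natl.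
apply: ler_sum => i _; rewrite !mxE (le_trans (ler_distD (z ord0 i) _ _))//.
by rewrite mulr_natl mulr2n lerD ?ltW// distrC.
Qed.

(** Disjointness is pulled back through f: points common to [D x] and [D x'] would have their image
    in both balls of radius 2 s. Only the centres f x have to be covered; the tripled balls of
    radius 6 s do so, and their diameter is at most 12 d s. *)
Lemma hausdorff_pre_cover (Omega V : set 'rV[R]_n) (f : 'rV[R]_n -> 'rV[R]_d)
    (h : LebT R n -> \bar R) (s : 'rV[R]_n -> R) (D : 'rV[R]_n -> set (LebT R n)) (delta : R) :
  (0 < n)%N -> (0 <= delta)%R -> measurable (Omega : set (LebT R n)) -> measurable_fun (Omega : set (LebT R n)) h ->
  (forall y, 0 <= h y) ->
  (forall x, V x -> (0 < s x <= delta)%R) ->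
  (forall x, V x -> [/\ measurable (D x), D x `<=` Omega,
      forall y, D x y -> (enorm (f y - f x) < 2 * s x)%R &
      (s x ^+ n)%:E <= \int[mu]_(y in D x) h y]) ->
  hausdorff_pre n%:R (12 * d%:R * delta)%R (f @` V) <=
    ((12 * d%:R) ^+ n)%:E * \int[mu]_(y in (Omega : set (LebT R n))) h y.
Proof.
move=> n0 delta0 mO mh h0 sd hD.
have rM x : V x -> (0 < 2 * s x <= 2 * delta)%R.
  by move=> /sd/andP[s0 ?]; rewrite mulr_gt0//= ler_wpM2l.
have [I [IV /countable_injP[code icode] tI cI]] := @vitali_supball R d _ V f (fun x => 2 * s x)%R _ rM.
(* Turns the countable family I into a sequence of sets; an index that codes no point yields the
   empty set, whose diameter has n-th power 0 because n > 0. *)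
have hdec (k : nat) : {o : option 'rV[R]_n | (forall x, o = Some x -> I x /\ code x = k) /\
    (o = None -> forall x, I x -> code x <> k)}.
  apply/cid; have [[x [Ix cx]]|no] := pselect (exists x, I x /\ code x = k).
    by exists (Some x); split=> // _ [<-].
  by exists None; split=> // _ x Ix cx; apply: no; exists x.
pose dec k := sval (hdec k).
have decI k x : dec k = Some x -> I x /\ code x = k.
  by rewrite /dec; case: (hdec k) => o [/= hk _]; exact: hk.
have decN k : dec k = None -> forall x, I x -> code x <> k.
  by rewrite /dec; case: (hdec k) => o [/= _ hk]; exact: hk.
have decK x : I x -> dec (code x) = Some x.
  move=> Ix; case e : (dec (code x)) => [x'|]; last by have := decN _ e _ Ix.
  have [Ix' cx'] := decI _ _ e; congr Some; apply: icode; rewrite ?inE//.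
pose C k := if dec k is Some x then supball (f x) (6 * s x) else set0.
pose E k : set (LebT R n) := if dec k is Some x then D x else set0.
have s0 x : I x -> (0 < s x)%R by move=> /IV/sd/andP[].
have Cd k x : dec k = Some x -> ediam (C k) <= (12 * d%:R * s x)%:E.
  move=> e; rewrite /C e; have [Ix _] := decI _ _ e.
  apply: le_trans (ediam_supball _ _) _; first by rewrite mulr_ge0// ltW// s0.
  by rewrite lee_fin le_eqVlt; apply/orP; left; apply/eqP; ring.
have mE k : measurable (E k).
  by rewrite /E; case e : (dec k) => [x|//]; have [/IV/hD[]] := decI _ _ e.
have EO k : E k `<=` Omega.
  rewrite /E; case e : (dec k) => [x|]; last exact: sub0set.
  by have [/IV/hD[]] := decI _ _ e.
have tE : trivIset setT E.
  move=> k k' _ _; rewrite /E; case e : (dec k) => [x|]; last by rewrite set0I => -[].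
  case e' : (dec k') => [x'|]; last by rewrite setI0 => -[].
  have [Ix <-] := decI _ _ e; have [Ix' <-] := decI _ _ e' => -[y [Dy Dy']].
  congr code; apply: (tI _ _ Ix Ix'); exists (f y).
  have [_ _ Dx _] := hD _ (IV _ Ix); have [_ _ Dx' _] := hD _ (IV _ Ix').
  have near z t : (enorm (f y - f z) < t)%R -> supball (f z) t (f y).
    by move=> yt i; apply: le_lt_trans yt; have := le_coord_enorm (f y - f z) i; rewrite !mxE.
  by split; apply: near; [exact: Dx|exact: Dx'].
apply: (@le_trans _ _ (\sum_(k <oo) ((fine (ediam (C k))) `^ n%:R)%:E)).
  apply: ereal_inf_lbound; exists C => //; split=> [_ [x Vx <-]|k].
    have [x' Ix' xx'] := cI _ Vx; exists (code x') => //; rewrite /C decK//.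
    by have -> : (6 * s x' = 3 * (2 * s x'))%R by ring.
  case e : (dec k) => [x|]; last first.
    by rewrite /C e ediam_set0 lee_fin !mulr_ge0.
  apply: le_trans (Cd _ _ e) _; rewrite lee_fin ler_wpM2l ?mulr_ge0//.
  by have [/IV/sd/andP[]] := decI _ _ e.
apply: (@le_trans _ _ (\sum_(k <oo) ((12 * d%:R) ^+ n)%:E * \int[mu]_(y in E k) h y)).
  apply: lee_nneseries => k _; first by move=> _; rewrite lee_fin powR_ge0.
  rewrite powR_mulrn ?fine_ge0 ?ediam_ge0//.
  case e : (dec k) => [x|]; last first.
    rewrite /C e ediam_set0 /= expr0n gtn_eqF// mule_ge0// ?lee_fin ?exprn_ge0 ?mulr_ge0//.
    exact: integral_ge0.
  have [Ix _] := decI _ _ e; have [_ _ _ hs] := hD _ (IV _ Ix).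
  rewrite [in leRHS]/E e; apply: (@le_trans _ _ (((12 * d%:R) ^+ n)%:E * (s x ^+ n)%:E)).
    rewrite -EFinM lee_fin -exprMn ler_pXn2r// ?nnegrE ?fine_ge0 ?ediam_ge0 ?mulr_ge0 ?(ltW (s0 _ Ix))//.
    rewrite -lee_fin fineK ?Cd// ge0_fin_numE ?ediam_ge0//.
    by apply: le_lt_trans (Cd _ _ e) _; rewrite ltry.
  by rewrite lee_wpmul2l// lee_fin exprn_ge0// mulr_ge0.
rewrite nneseriesZl; last by move=> k _; exact: integral_ge0.
rewrite lee_wpmul2l ?lee_fin ?exprn_ge0 ?mulr_ge0//.
rewrite -ge0_integral_bigcup//.
- apply: ge0_subset_integral => //; first exact: bigcup_measurable.
  by move=> y [k _ /EO].
- by apply: measurable_funS mh => // y [k _ /EO].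
Qed.

End HausdorffCover.

Section HausdorffNull.
Variables (R : realType) (n d : nat).
Local Open Scope ereal_scope.
Notation mu := (@lebn R n).

(** Absolute continuity of the integral provides t. A neighbourhood of measure at most t / 2 handles
    Phi, and measure at most e / 2 handles the constant 1. *)
Lemma null_open_small_integral (Omega N : set 'rV[R]_n) (Phi : LebT R n -> R) (e : R) :
  open Omega -> N `<=` Omega -> @leb_outer R n N = 0 ->
  measurable_fun (Omega : set (LebT R n)) Phi -> (forall y, (0 <= Phi y)%R) ->
  \int[mu]_(y in (Omega : set (LebT R n))) (Phi y)%:E < +oo -> (0 < e)%R ->
  exists U : set 'rV[R]_n, [/\ open U, N `<=` U, U `<=` Omega &
    \int[mu]_(y in (U : set (LebT R n))) (1 + Phi y)%:E <= e%:E].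
Proof.
move=> oO NO N0 mPhi Phi0 iPhi e0.
have mO : measurable (Omega : set (LebT R n)) by exact: measurable_open.
have intPhi : mu.-integrable (Omega : set (LebT R n)) (EFin \o Phi).
  apply/integrableP; split; first exact/measurable_EFinP.
  by under eq_integral => y _ do rewrite /= ger0_norm//.
have intT : mu.-integrable setT (EFin \o (Phi \_ (Omega : set (LebT R n)))).
  by rewrite -restrict_EFin; apply/integrable_restrict => //; rewrite setTI.
have [t [t0 ht]] := integral_normr_continuous intT (divr_gt0 e0 (ltr0n R 2)).
have m0 : (0 < Num.min (t / 2) (e / 2))%R by rewrite lt_min !divr_gt0.
have [U [oU NU muU]] := lebn_null_open N0 m0.
pose V := U `&` Omega; exists V; split=> //; first exact: openI.
- by move=> x Nx; split; [exact: NU|exact: NO].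
- exact: subIsetr.
have mV : measurable (V : set (LebT R n)) by apply: measurable_open; exact: openI.
have muV : mu V <= (Num.min (t / 2) (e / 2))%:E.
  by apply: le_trans muU; apply: le_outer_measure; exact: subIsetl.
have VO : V `<=` Omega by exact: subIsetr.
have hV : \int[mu]_(y in (V : set (LebT R n))) (Phi y)%:E <= (e / 2)%:E.
  have tV : mu V < t%:E.
    apply: le_lt_trans muV _; rewrite lte_fin gt_min; apply/orP; left.
    by rewrite ltr_pdivrMr// ltr_pMr// ltr1n.
  have := ht _ mV tV; rewrite -lte_fin => /ltW; apply: le_trans.
  rewrite le_eqVlt; apply/orP; left; apply/eqP.
  rewrite /Rintegral fineK.
    apply: eq_integral => y; rewrite inE => Vy; rewrite patchE ifT ?ger0_norm//.
    by rewrite inE; exact: VO.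
  have iV := integrableS measurableT mV (@subsetT _ V) intT.
  exact: (integrable_fin_num mV (integrable_norm iV)).
under eq_integral do rewrite EFinD.
have mPV : measurable_fun (V : set (LebT R n)) (EFin \o Phi).
  by apply/measurable_EFinP; exact: measurable_funS mPhi.
rewrite ge0_integralD//; last by move=> y _; rewrite lee_fin.
rewrite integral_cst// mul1e [e in leRHS](_ : _ = (e / 2 + e / 2)%R); last by rewrite -splitr.
rewrite EFinD leeD//; apply: le_trans muV _.
by rewrite lee_fin ge_min lexx orbT.
Qed.

Lemma hausdorff_pre_ge0 (s delta : R) (A : set 'rV[R]_d) : 0 <= hausdorff_pre s delta A.
Proof.
apply: le_ereal_inf_tmp => _ [C _ <-]; apply: nneseries_ge0 => k _ _.
by rewrite lee_fin powR_ge0.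
Qed.

(** The constant C at a point is not controlled over N, so it is hidden in the integrand h, the sum
    over m of (m + 1) (1 + Phi) on U_m. At x an m with C <= m + 1 is taken and D is found inside
    U_m, where h dominates C (1 + Phi). *)
Lemma hausdorff_null (Omega N : set 'rV[R]_n) (f : 'rV[R]_n -> 'rV[R]_d) (Phi : LebT R n -> R) :
  (0 < n)%N -> (0 < d)%N -> open Omega -> N `<=` Omega -> @leb_outer R n N = 0 ->
  measurable_fun (Omega : set (LebT R n)) Phi -> (forall y, (0 <= Phi y)%R) ->
  \int[mu]_(y in (Omega : set (LebT R n))) (Phi y)%:E < +oo ->
  (forall x, N x -> exists C : R, forall (delta : R) (U : set 'rV[R]_n), (0 < delta)%R ->
     open U -> U x -> U `<=` Omega -> exists (s : R) (D : set (LebT R n)),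
     [/\ (0 < s <= delta)%R, measurable D, D `<=` U,
       forall y, D y -> (enorm (f y - f x) < 2 * s)%R &
       (s ^+ n)%:E <= C%:E * \int[mu]_(y in D) (1 + Phi y)%:E]) ->
  hausdorff n%:R (f @` N) = 0.
Proof.
move=> n0 d0 oO NO N0 mPhi Phi0 iPhi hN.
have mO : measurable (Omega : set (LebT R n)) by exact: measurable_open.
apply/eqP; rewrite eq_le; apply/andP; split; last first.
  apply: (le_trans (hausdorff_pre_ge0 (n%:R)%R 1%R (f @` N))); 
  by apply: ereal_sup_ubound; exists 1%R => //=; exact: ltr01.
apply: ge_ereal_sup => _ [delta delta0 <-] /=; rewrite /= in delta0.
apply/lee_addgt0Pr => e e0; rewrite add0e.
pose K : R := ((12 * d%:R) ^+ n)%R.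
have K0 : (0 < K)%R by rewrite exprn_gt0// mulr_gt0// ltr0n.
(* The factor 1 / (m + 1) cancels the weight of U_m in [g], 2^-(m+1) makes the sum over m converge,
   and K is the constant of [hausdorff_pre_cover]. *)
have hU (m : nat) : {U : set 'rV[R]_n | [/\ open U, N `<=` U, U `<=` Omega &
    \int[mu]_(y in (U : set (LebT R n))) (1 + Phi y)%:E <=
      (m.+1%:R^-1 * (e / K / (2 ^ m.+1)%:R))%:E]}.
  apply/cid; apply: null_open_small_integral => //.
  by rewrite mulr_gt0 ?invr_gt0// !divr_gt0// ltr0n expn_gt0.
pose U m : set (LebT R n) := sval (hU m).
have oU m : open (U m : set 'rV[R]_n) by rewrite /U; case: (hU m) => ? [].
have NU m : N `<=` U m by rewrite /U; case: (hU m) => ? [].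
have UO m : U m `<=` Omega by rewrite /U; case: (hU m) => ? [].
have iU m : \int[mu]_(y in U m) (1 + Phi y)%:E <= (m.+1%:R^-1 * (e / K / (2 ^ m.+1)%:R))%:E.
  by rewrite /U; case: (hU m) => ? [].
have mU m : measurable (U m) by exact: measurable_open.
pose g (m : nat) : LebT R n -> \bar R := (fun y => (m.+1%:R * (1 + Phi y))%:E) \_ (U m).
have P0 y : (0 <= 1 + Phi y)%R by rewrite addr_ge0.
have g0 m y : 0 <= g m y.
  by rewrite /g patchE; case: ifP => // _; rewrite lee_fin mulr_ge0.
have mP1 : measurable_fun (Omega : set (LebT R n)) (fun y => (1 + Phi y)%:E).
  by apply/measurable_EFinP; apply: measurable_funD.
have mPm m : measurable_fun (Omega : set (LebT R n)) (fun y => (m.+1%:R * (1 + Phi y))%:E).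
  apply/measurable_EFinP; apply: measurable_funM; first exact: measurable_cst.
  exact/measurable_EFinP.
have mg m : measurable_fun (Omega : set (LebT R n)) (g m).
  apply/(measurable_restrict _ (mU m) mO).
  by apply: measurable_funS (mPm m) => // y [].
have ig m : \int[mu]_(y in (Omega : set (LebT R n))) g m y =
    m.+1%:R%:E * \int[mu]_(y in U m) (1 + Phi y)%:E.
  rewrite /g -integral_mkcondr setIidr//.
  under eq_integral do rewrite EFinM.
  have mPU : measurable_fun (U m) (fun y => (1 + Phi y)%:E) by exact: measurable_funS mO (UO m) mP1.
  by rewrite (ge0_integralZl mu (mU m) mPU) => [//|y _|//]; rewrite lee_fin.
pose h y := \sum_(m <oo) g m y.
have gh m y : g m y <= h y.
  apply: le_trans (@nneseries_lim_ge R (g^~ y) xpredT 0 m.+1 (fun k _ _ => g0 k y)).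
  by rewrite big_nat_recr//= leeDr// sume_ge0.
have h0 y : 0 <= h y by exact: nneseries_ge0.
have mh : measurable_fun (Omega : set (LebT R n)) h.
  by apply: ge0_emeasurable_sum => //.
have ih : \int[mu]_(y in (Omega : set (LebT R n))) h y <= (e / K)%:E.
  rewrite /h integral_nneseries//.
  apply: le_trans (epsilon_trick0 _ (ltW (divr_gt0 e0 K0))).
  apply: lee_nneseries => m _; first by move=> _; exact: integral_ge0.
  rewrite ig; apply: le_trans (lee_wpmul2l _ (iU m)) _; first by rewrite lee_fin.
  by rewrite -EFinM mulrA mulfV ?mul1r ?pnatr_eq0//.
have hx x : {sD : R * set (LebT R n) | N x -> [/\ (0 < sD.1 <= delta / (12 * d%:R))%R,
    measurable sD.2, sD.2 `<=` Omega, forall y, sD.2 y -> (enorm (f y - f x) < 2 * sD.1)%R &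
    (sD.1 ^+ n)%:E <= \int[mu]_(y in sD.2) h y]}.
  apply/cid; have [Nx|nNx] := pselect (N x); last by exists (0%R, set0).
  have [C hC] := hN _ Nx; pose m := Num.bound `|C|%R.
  have Cm : (C <= m.+1%:R)%R.
    apply: le_trans (ler_norm C) _; apply: le_trans (ltW (archi_boundP (normr_ge0 C))) _.
    by rewrite ler_nat.
  have dd0 : (0 < delta / (12 * d%:R))%R by rewrite divr_gt0// mulr_gt0// ltr0n.
  have [s [D [sd mD DU Df sC]]] := hC _ (U m) dd0 (oU m) (NU _ _ Nx) (UO m).
  exists (s, D) => _; split=> //=; first exact: subset_trans (UO m).
  apply: (le_trans sC).
  apply: (@le_trans _ _ (m.+1%:R%:E * \int[mu]_(y in D) (1 + Phi y)%:E)).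
    rewrite lee_wpmul2r ?lee_fin//; apply: integral_ge0 => y _; by rewrite lee_fin.
  have DO : D `<=` Omega by exact: subset_trans (UO m).
  have mPD : measurable_fun D (fun y => (1 + Phi y)%:E) by exact: measurable_funS mO DO mP1.
  rewrite -(ge0_integralZl mu mD mPD); [|by move=> y _; rewrite lee_fin|by []].
  apply: ge0_le_integral; [exact: mD| | |exact: measurable_funS mh|].
  - by move=> y _; rewrite mule_ge0// lee_fin.
  - by under eq_fun do rewrite -EFinM; exact: measurable_funS (mPm m).
  - move=> y Dy; apply: le_trans (gh m y); rewrite /g patchE ifT ?EFinM//.
    by rewrite inE; exact: DU.
have hx' x : N x -> (0 < (sval (hx x)).1 <= delta / (12 * d%:R))%R.
  by move=> Nx; case: (hx x) => sD /= /(_ Nx)[].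
have := @hausdorff_pre_cover R n d Omega N f h (fun x => (sval (hx x)).1) (fun x => (sval (hx x)).2)
  (delta / (12 * d%:R))%R n0 _ mO mh h0 hx' _.
rewrite [X in hausdorff_pre _ X](_ : _ = delta); last first.
  by field; rewrite pnatr_eq0 -lt0n.
move=> H; apply: le_trans (H _ _) _.
- by rewrite divr_ge0// ltW.
- by move=> x Nx; case: (hx x) => sD /= /(_ Nx)[].
apply: le_trans (lee_wpmul2l _ ih) _; first by rewrite lee_fin ltW.
by rewrite -EFinM -/K mulrC divfK ?gt_eqF.
Qed.

End HausdorffNull.

Theorem theorem3p1 (R : realType) (n d : nat) (Omega : set 'rV[R]_n)
    (lam : R) (f : 'rV[R]_n -> 'rV[R]_d) (Df : 'I_d -> 'I_n -> 'rV[R]_n -> R)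
    (N : set 'rV[R]_n) :
  (2 <= n)%N -> (1 <= d)%N -> open Omega ->
  0 <= lam -> lam <= (n.-1)%:R ->
  W11loc Omega f Df ->
  N `<=` Omega -> @leb_outer R n N = 0%E ->
  (forall x, N x -> exists R0 mu : R,
     [/\ 0 < R0 < 1, 0 < mu, eball x R0 `<=` Omega &
      forall r, 0 < r <= R0 ->
        (0 < 1 - lam / (n.-1)%:R ->
           median_mod f x r <= expR (- (mu * (ln r^-1) `^ (1 - lam / (n.-1)%:R))))
        /\ (1 - lam / (n.-1)%:R = 0 ->
           median_mod f x r <= (ln r^-1) `^ (- mu))]) ->
  (\int[@lebn R n]_(y in (Omega : set (LebT R n)))
      ((grad_norm Df y ^+ n * (ln (expR 1 + grad_norm Df y)) `^ lam)%:E)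
    < +oo)%E ->
  hausdorff n%:R (f @` N) = 0%E.
Proof.
move=> n2 d1 oO lam0 lam1 Wf NO N0 hN iE.
have n0 : (0 < n)%N by exact: leq_trans n2.
apply: (@hausdorff_null R n d Omega N f (energy lam Df)) => //.
- exact: measurable_energy oO Wf n lam.
- exact: energy_ge0.
move=> x Nx; have [R0 [mu [/andP[R00 R01] mu0 BO hmed]]] := hN _ Nx.
exact: (local_scale n2 d1 oO Wf lam0 lam1 iE R00 R01 mu0 BO hmed).
Qed.
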